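(* (ZF) Let $U$ be a $\sigma$-complete ultrafilter on a set $X$ with $\bigcap U=\emptyset$, and let $\rho$ be a regular cardinal. Suppose there is $V_\eta$ with $\rho,U\in V_\eta$ and an elementary embedding $j:V_\eta\to M$ that is either (a) continuous at $\rho$ and type I discontinuous at $U$, or (b) discontinuous at $\rho$ and type II continuous at $U$. Then $U$ is $\rho$-indecomposable, and the tree Prikry forcing $\mathbb{P}(U)$ does not add a cofinal sequence to $\rho$ of length $\tau<\kappa$, where $\kappa=\mathrm{cp}(U)$.
   Context: The base theory is ZF (no choice). $M$ is understood to be transitive. $\sigma$-complete means closed under countable intersections. $\mathrm{cp}(U)$ is the completeness of $U$: the largest cardinal $\kappa$ such that $U$ is closed under intersections of fewer than $\kappa$ members. $j$ is continuous at an ordinal $\alpha$ if $\sup(j''\alpha)=j(\alpha)$ and discontinuous at $\alpha$ if $\sup(j''\alpha)<j(\alpha)$. For a filter $F\in V_\eta$ with $\bigcap F=\emptyset$: $j$ is type I discontinuous at $F$ if $\bigcap j''F\ne\emptyset$; $j$ is type II continuous at $F$ if $j[\cup F]\in j(F)$ (here $\cup F$ is the underlying set of $F$). $U$ is $\rho$-decomposable if there is a sequence $\langle Z_\alpha:\alpha<\rho\rangle$ of sets $Z_\alpha\notin U$ such that $\bigcup_{\alpha<\rho}Z_\alpha\in U$ but $\bigcup_{\alpha<\beta}Z_\alpha\notin U$ for all $\beta<\rho$; it is $\rho$-indecomposable otherwise. Tree Prikry forcing $\mathbb{P}(U)$ for an ultrafilter $U$ on $X$: conditions are pairs $p=(s,T)$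 where $s\in X^{<\omega}$ and $T\subseteq X^{<\omega}$ is a $U$-large tree, i.e. a tree with $\langle\rangle\in T$ and $\mathrm{succ}_T(t)=\{x: t^\frown\langle x\rangle\in T\}\in U$ for every $t\in T$. For $r\in T$ let $T_r=\{t: r^\frown t\in T\}$. A direct extension of $(s,T)$ is $(s,T')$ with $T'\subseteq T$; a one-point extension of $(s,T)$ is $(s^\frown\langle x\rangle,T_{\langle x\rangle})$ with $x\in\mathrm{succ}_T(\langle\rangle)$. A condition $q$ extends $p$ if it is obtained from $p$ by finitely many one-point extensions and direct extensions. *)

(* Defs.v *)
(** A theorem of ZF is rendered as a statement about an arbitrary model of
    first-order ZF.  All set-theoretic notions below are first-order over the
    model: they quantify over its elements only.  In particular choice at the
    level of Rocq gives no choice inside the model. *)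

Set Implicit Arguments.
Unset Strict Implicit.
Unset Printing Implicit Defensive.

Record structure := Structure {
  carrier :> Type;
  mem : carrier -> carrier -> Prop
}.

Notation "x ∈ y" := (mem x y) (at level 70, no associativity).
Notation "x ∉ y" := (~ mem x y) (at level 70, no associativity).

(** * First-order formulas, with de Bruijn indices *)

Inductive formula : Type :=
| fmem (i j : nat)
| feq (i j : nat)
| fneg (A : formula)
| fand (A B : formula)
| fall (A : formula).

Definition for_ (A B : formula) := fneg (fand (fneg A) (fneg B)).
Definition fimp (A B : formula) := fneg (fand A (fneg B)).
Definition fiff (A B : formula) := fand (fimp A B) (fimp B A).
Definition fex (A : formula) := fneg (fall (fneg A)).

Definition scons {T : Type} (x : T) (e : nat -> T) : nat -> T :=
  fun n => match n with O => x | S k => e k end.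

Fixpoint sat {V : structure} (e : nat -> V) (A : formula) : Prop :=
  match A with
  | fmem i j => e i ∈ e j
  | feq i j => e i = e j
  | fneg B => ~ sat e B
  | fand B C => sat e B /\ sat e C
  | fall B => forall x : V, sat (scons x e) B
  end.

Section Sets.
Context {V : structure}.
Implicit Types a b c d f i j n p q s t u v w x y z : V.

Definition subset a b := forall x, x ∈ a -> x ∈ b.
Definition is_empty z := forall x, x ∉ z.
Definition is_succ y x := forall w, w ∈ y <-> (w ∈ x \/ w = x).
Definition is_upair z x y := forall w, w ∈ z <-> (w = x \/ w = y).
Definition is_opair z x y :=
  forall w, w ∈ z <-> (is_upair w x x \/ is_upair w x y).
Definition is_union z a := forall x, x ∈ z <-> exists y, y ∈ a /\ x ∈ y.

Definition inductive a :=
  (exists z, z ∈ a /\ is_empty z) /\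
  (forall x, x ∈ a -> exists y, y ∈ a /\ is_succ y x).

(** * The axioms of ZF *)

Definition extensionality :=
  forall a b, (forall x, x ∈ a <-> x ∈ b) -> a = b.
Definition foundation :=
  forall a, (exists x, x ∈ a) ->
    exists x, x ∈ a /\ forall y, y ∈ x -> y ∉ a.
Definition pairing := forall x y, exists z, is_upair z x y.
Definition union := forall a, exists z, is_union z a.
Definition powerset := forall a, exists z, forall x, x ∈ z <-> subset x a.
Definition infinity := exists a, inductive a.
Definition separation :=
  forall (A : formula) (e : nat -> V) a,
    exists b, forall x, x ∈ b <-> (x ∈ a /\ sat (scons x e) A).
Definition replacement :=
  forall (A : formula) (e : nat -> V) a,
    (forall x y y', x ∈ a -> sat (scons y (scons x e)) A ->
       sat (scons y' (scons x e)) A -> y = y') ->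
    exists b, forall y, y ∈ b <->
      exists x, x ∈ a /\ sat (scons y (scons x e)) A.

Definition ZF :=
  extensionality /\ foundation /\ pairing /\ union /\ powerset /\ infinity /\
  separation /\ replacement.

(** * Relations and functions *)

Definition rel f x y := exists z, z ∈ f /\ is_opair z x y.

Definition is_fun f a b :=
  (forall z, z ∈ f ->
     exists x, x ∈ a /\ exists y, y ∈ b /\ is_opair z x y) /\
  (forall x, x ∈ a -> exists y, rel f x y) /\
  (forall x y y', rel f x y -> rel f x y' -> y = y').

Definition fun_on f a := exists b, is_fun f a b.

Definition is_bij f a b :=
  is_fun f a b /\
  (forall x x' y, rel f x y -> rel f x' y -> x = x') /\
  (forall y, y ∈ b -> exists x, rel f x y).

Definition is_image y f a := forall z, z ∈ y <-> exists x, x ∈ a /\ rel f x z.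

(** * Ordinals and cardinals *)

Definition transitive a := forall x, x ∈ a -> subset x a.
(* Adequate in the presence of foundation. *)
Definition is_ord a := transitive a /\ forall x, x ∈ a -> transitive x.
Definition is_nat n := forall a, inductive a -> n ∈ a.
Definition is_omega w := forall n, n ∈ w <-> is_nat n.

Definition is_card k :=
  is_ord k /\ forall a, a ∈ k -> ~ exists f, is_bij f a k.

Definition cofinal_map f a r :=
  is_fun f a r /\
  forall b, b ∈ r -> exists x, x ∈ a /\ exists y, rel f x y /\ (b ∈ y \/ b = y).

Definition regular r :=
  is_card r /\ (forall n, is_nat n -> n ∈ r) /\
  forall a, a ∈ r -> ~ exists f, cofinal_map f a r.

Definition is_sup s a :=
  is_ord s /\ (forall x, x ∈ a -> subset x s) /\
  forall s', is_ord s' -> (forall x, x ∈ a -> subset x s') -> subset s s'.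

(** [v] is V_[h]: [f] below maps each [a <= h] to V_a. *)
Definition is_rank_stage h v :=
  is_ord h /\
  exists f d, is_succ d h /\ fun_on f d /\
    (forall a u, rel f a u ->
       forall x, x ∈ u <-> exists b, b ∈ a /\ exists w, rel f b w /\ subset x w) /\
    rel f h v.

(** * Ultrafilters *)

Definition ultrafilter (U X : V) :=
  X ∈ U /\
  (forall a, a ∈ U -> subset a X) /\
  (forall a, a ∈ U -> exists x, x ∈ a) /\
  (forall a b, a ∈ U -> subset a b -> subset b X -> b ∈ U) /\
  (forall a b c, a ∈ U -> b ∈ U ->
     (forall x, x ∈ c <-> (x ∈ a /\ x ∈ b)) -> c ∈ U) /\
  (forall a b, subset a X ->
     (forall x, x ∈ b <-> (x ∈ X /\ x ∉ a)) -> a ∈ U \/ b ∈ U).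

(** Closure of [U] under intersections of families indexed by [l]. *)
Definition closed_under_inter (U X l : V) :=
  forall f, is_fun f l U ->
  forall c, (forall x, x ∈ c <->
               (x ∈ X /\ forall i a, rel f i a -> x ∈ a)) -> c ∈ U.

Definition sigma_complete (U X : V) :=
  forall w, is_omega w -> closed_under_inter U X w.

(** Families of fewer than [k] members are those indexed by some [l < k]. *)
Definition complete (U X k : V) :=
  forall l, l ∈ k -> closed_under_inter U X l.

Definition is_cp (U X k : V) :=
  is_card k /\ complete U X k /\
  forall k', is_card k' -> complete U X k' -> subset k' k.

Definition decomposable (U r : V) :=
  exists f, fun_on f r /\
    (forall a z, rel f a z -> z ∉ U) /\
    (exists u, u ∈ U /\
       forall x, x ∈ u <-> exists a z, a ∈ r /\ rel f a z /\ x ∈ z) /\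
    (forall b, b ∈ r ->
       forall u, (forall x, x ∈ u <-> exists a z, a ∈ b /\ rel f a z /\ x ∈ z) ->
       u ∉ U).

(** * Elementary embeddings between sets

    Formulas are coded inside the model, in the syntax of [formula]:
    (0,(i,j)), (1,(i,j)), (2,A), (3,(A,B)), (4,A) code [fmem i j], [feq i j],
    [fneg A], [fand A B], [fall A].  When the model is not omega-standard there
    are more codes than external formulas, and elementarity concerns them all. *)

Fixpoint is_num (k : nat) (x : V) : Prop :=
  match k with
  | O => is_empty x
  | S k' => exists y, is_num k' y /\ is_succ x y
  end.

Definition tagged (k : nat) c x := exists m, is_num k m /\ is_opair c m x.
Definition tagged2 (k : nat) c x y := exists z, is_opair z x y /\ tagged k c z.

Definition code_mem c i j := tagged2 0 c i j.
Definition code_eq c i j := tagged2 1 c i j.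
Definition code_neg c a := tagged 2 c a.
Definition code_and c a b := tagged2 3 c a b.
Definition code_all c a := tagged 4 c a.

(* By foundation in the model, the elements of such a set are finite codes. *)
Definition formula_set t :=
  forall c, c ∈ t ->
    (exists i j, is_nat i /\ is_nat j /\ (code_mem c i j \/ code_eq c i j)) \/
    (exists a, a ∈ t /\ code_neg c a) \/
    (exists a b, a ∈ t /\ b ∈ t /\ code_and c a b) \/
    (exists a, a ∈ t /\ code_all c a).

Definition is_code c := exists t, formula_set t /\ c ∈ t.

(** [u] = <x>^t, for a sequence [t] of length at most omega. *)
Definition is_cons u x t :=
  forall w, w ∈ u <->
    ((exists z, is_empty z /\ is_opair w z x) \/
     (exists i i' y, rel t i y /\ is_succ i' i /\ is_opair w i' y)).

Definition assignment e a := exists w, is_omega w /\ is_fun e w a.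

(** [s] is a satisfaction relation over ([a], ∈) for the formulas in [t]. *)
Definition sat_table a t s :=
  forall c e, c ∈ t -> assignment e a ->
    (forall i j, code_mem c i j ->
       (rel s c e <-> exists x y, rel e i x /\ rel e j y /\ x ∈ y)) /\
    (forall i j, code_eq c i j ->
       (rel s c e <-> exists x, rel e i x /\ rel e j x)) /\
    (forall b, code_neg c b -> (rel s c e <-> ~ rel s b e)) /\
    (forall b d, code_and c b d -> (rel s c e <-> (rel s b e /\ rel s d e))) /\
    (forall b, code_all c b ->
       (rel s c e <->
        forall x e', x ∈ a -> is_cons e' x e -> rel s b e')).

Definition sat_in a c e :=
  exists t s, formula_set t /\ c ∈ t /\ sat_table a t s /\ rel s c e.

Definition elementary_embedding j a b :=
  is_fun j a b /\
  forall c e e', is_code c -> assignment e a -> assignment e' b ->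
    (forall i x y, rel e i x -> rel j x y -> rel e' i y) ->
    (sat_in a c e <-> sat_in b c e').

Definition continuous_at j a :=
  exists b s y, is_image s j a /\ rel j a b /\ is_sup y s /\ y = b.
Definition discontinuous_at j a :=
  exists b s y, is_image s j a /\ rel j a b /\ is_sup y s /\ y ∈ b.

Definition type_I_discontinuous_at j (F : V) :=
  exists x, forall a b, a ∈ F -> rel j a b -> x ∈ b.
Definition type_II_continuous_at j (F : V) :=
  exists u s b, is_union u F /\ is_image s j u /\ rel j F b /\ s ∈ b.

(** * Forcing

    A notion of forcing is given by its conditions [P], its ordering [le]
    ([le q p]: [q] is stronger, and both are conditions) and its largest
    condition [one]. *)

Section Forcing.
Variables (P : V -> Prop) (le : V -> V -> Prop) (one : V).

(** The usual recursion, as membership in a set closed under components: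
    equivalent by foundation in the model. *)
Definition is_name x :=
  exists t, x ∈ t /\
    forall y z, y ∈ t -> z ∈ y ->
      exists s p, s ∈ t /\ P p /\ is_opair z s p.

(** [y] is the check name of [x], that is {(check z, one) : z ∈ x}. *)
Definition is_check x y :=
  exists f d, fun_on f d /\ transitive d /\
    (forall u v, rel f u v -> forall w, w ∈ v <->
       exists z z', z ∈ u /\ rel f z z' /\ is_opair w z' one) /\
    rel f x y.

Definition trel s p x y := exists z, is_opair z x y /\ rel s p z.

(** One half of the defining clause of "[p] forces [x = y]", relative to a
    relation [s] deciding equality between components. *)
Definition forces_sub s p x y :=
  forall z r, rel x z r -> forall q, le q p -> le q r ->
  forall q', le q' q -> exists q'', le q'' q' /\
    exists z' r', rel y z' r' /\ le q'' r' /\ trel s q'' z z'.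

Definition forces_eq_table t s :=
  (forall x z r, x ∈ t -> rel x z r -> z ∈ t) /\
  (forall p x y, P p -> x ∈ t -> y ∈ t ->
     (trel s p x y <-> (forces_sub s p x y /\ forces_sub s p y x))).

Definition forces_eq p x y :=
  exists t s, x ∈ t /\ y ∈ t /\ forces_eq_table t s /\ trel s p x y.

Definition forces_mem p x y :=
  forall q, le q p -> exists q', le q' q /\
    exists z r, rel y z r /\ le q' r /\ forces_eq q' x z.

Fixpoint forces p (e : nat -> V) (A : formula) : Prop :=
  match A with
  | fmem i j => forces_mem p (e i) (e j)
  | feq i j => forces_eq p (e i) (e j)
  | fneg B => forall q, le q p -> ~ forces q e B
  | fand B C => forces p e B /\ forces p e C
  | fall B => forall x, is_name x -> forces p (scons x e) B
  end.

(** [p] forces that [x] is not in the ground model. *)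
Definition forces_new p x :=
  forall q y y', le q p -> is_check y y' -> ~ forces_eq q x y'.

End Forcing.

End Sets.

(** Object-language versions of [is_upair], [is_opair], [rel], [is_fun] and
    [cofinal_map]; arguments are de Bruijn indices. *)
Definition F_upair (z x y : nat) :=
  fall (fiff (fmem 0 (S z)) (for_ (feq 0 (S x)) (feq 0 (S y)))).
Definition F_opair (z x y : nat) :=
  fall (fiff (fmem 0 (S z))
             (for_ (F_upair 0 (S x) (S x)) (F_upair 0 (S x) (S y)))).
Definition F_rel (f x y : nat) :=
  fex (fand (fmem 0 (S f)) (F_opair 0 (S x) (S y))).
Definition F_fun (f a b : nat) :=
  fand (fall (fimp (fmem 0 (S f))
          (fex (fand (fmem 0 (S (S a)))
             (fex (fand (fmem 0 (S (S (S b)))) (F_opair 2 1 0)))))))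
 (fand (fall (fimp (fmem 0 (S a)) (fex (F_rel (S (S f)) 1 0))))
       (fall (fall (fall (fimp (F_rel (S (S (S f))) 2 1)
          (fimp (F_rel (S (S (S f))) 2 0) (feq 1 0))))))).
Definition F_cofinal_map (f a r : nat) :=
  fand (F_fun f a r)
       (fall (fimp (fmem 0 (S r))
          (fex (fand (fmem 0 (S (S a)))
             (fex (fand (F_rel (S (S (S f))) 1 0)
                        (for_ (fmem 2 0) (feq 2 0)))))))).

(** * Tree Prikry forcing *)

Section TreePrikry.
Context {V : structure}.
Implicit Types n p q s t u w x z S T : V.
Variables X U : V.

Definition is_seq s := exists n, is_nat n /\ is_fun s n X.

(** [u] = s^<x>, for a finite sequence [s]. *)
Definition is_snoc u s x :=
  exists n, is_nat n /\ fun_on s n /\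
    forall w, w ∈ u <-> (w ∈ s \/ is_opair w n x).

Definition is_seqs T := forall t, t ∈ T <-> is_seq t.

Definition large_tree T :=
  (forall t, t ∈ T -> is_seq t) /\
  (* inclusion of finite sequences is end-extension *)
  (forall t s, t ∈ T -> is_seq s -> subset s t -> s ∈ T) /\
  (exists z, is_empty z /\ z ∈ T) /\
  (forall t, t ∈ T ->
     exists a, a ∈ U /\ forall x, x ∈ a <-> exists u, u ∈ T /\ is_snoc u t x).

Definition tp_cond p :=
  exists s T, is_opair p s T /\ is_seq s /\ large_tree T.

Definition direct_extension q p :=
  exists s T T', is_opair p s T /\ is_opair q s T' /\ subset T' T.

Definition one_point_extension q p :=
  exists s T s' T' x,
    is_opair p s T /\ is_opair q s' T' /\
    (exists z u, is_empty z /\ u ∈ T /\ is_snoc u z x) /\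
    is_snoc s' s x /\
    (forall t, t ∈ T' <-> (is_seq t /\ exists u, u ∈ T /\ is_cons u x t)).

Definition tp_step q p :=
  tp_cond p /\ tp_cond q /\ (direct_extension q p \/ one_point_extension q p).

(** Finitely many steps, in the sense of the model. *)
Definition tp_le q p :=
  tp_cond p /\ tp_cond q /\
  exists n m f, is_nat n /\ is_succ m n /\ fun_on f m /\
    (forall z, is_empty z -> rel f z p) /\ rel f n q /\
    forall i i' a b, i ∈ n -> is_succ i' i -> rel f i a -> rel f i' b ->
      tp_step b a.

Definition is_tp_one p :=
  exists z T, is_empty z /\ is_seqs T /\ is_opair p z T.

(** Some condition forces that there is a cofinal map from [l] to [r] outside
    the ground model. *)
Definition tree_prikry_adds_cofinal (l r : V) :=
  exists one p f l' r',
    is_tp_one one /\ tp_cond p /\ is_name tp_cond f /\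
    is_check one l l' /\ is_check one r r' /\
    forces tp_cond tp_le p (scons f (scons l' (fun _ => r')))
      (F_cofinal_map 0 1 2) /\
    forces_new tp_cond tp_le one p f.

End TreePrikry.

(* Main.v *)
Require Import Defs.
From Stdlib Require Import Classical ClassicalEpsilon FunctionalExtensionality Arith Lia.
From Stdlib Require List.

(** Indecomposability. Let a sequence of sets of length [rho] decompose [U], and send each
    point of the union to the first index at which it is covered. The points sent to [b] or
    above form a member of [U], for every [b] below [rho]. In case (a) take a point [x0] in
    every [j(A)], [A] in [U]. By elementarity [x0] is sent below [j(rho)], hence below some
    [j(b)] since [j] is continuous at [rho]; but [x0] also lies in [j] of the set of points
    sent to [b] or above. In case (b) let [c < j(rho)] be the supremum of the pointwise
    image of [rho]. By elementarity the points sent to [c] or above form a member of [j(U)],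
    which meets the pointwise image of [X]; but [j(x)] is sent to [j] of some ordinal, below
    [c]. Elementarity applies only to a map coded by an element of [V_eta]; as a set of
    ordered pairs it can lie just outside when [eta] is a successor. If [U] does not
    concentrate on [rho], unordered pairs are used instead; otherwise the map is replaced by
    the identity, whose tails are also in [U] since [rho] is regular
    ([embedding_indecomposable]).

    Forcing. Let a condition with stem [s] force [f] to be a cofinal map from [tau] to
    [rho]. For an open set [D] of conditions call a stem good if some tree on it makes [D]
    dense below. If [U]-many one-point extensions of [s] are good, then so is [s], and this
    takes no choice: all the witnessing trees are united ([good_fusion]). Hence, if the
    stems that are good for one of the sets [D b], [b] below [rho], can be uniformized on a
    member of [U], no stem is bad for all [b], as a tree of bad stems would contradict
    density ([stem_decides]). If [tau < rho], let [D b] say that [f] at [x] is at most [b];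
    indecomposability provides the uniformization. If [rho <= tau < cp(U)], let [D b] say
    that it equals [b] and use completeness. Since [tau < cp(U)] the trees for all [x] below
    [tau] can be intersected ([large_amalgam]). The resulting condition bounds [f] below
    [rho] by regularity in the first case, contradicting cofinality; in the second it
    decides all of [f], which is then in the ground model ([no_new_cofinal_map]). If [cp(U)]
    does not exist, [U] is closed under all intersections of well-ordered families, so both
    cases go through for every [tau] ([closed_below_cp]).

    Everything takes place in an arbitrary model [V] of ZF. Separation and replacement are
    available only for first-order predicates, so each predicate used comes with a proof
    that it is definable with parameters; the tactic [definability] finds most of these.
    Extensions of a condition are put into the normal form [below] ([tp_leE]), which makes
    the ordering independent of the internal sequences of steps. Forced statements are
    reduced to forced equality and membership by the usual local rules for connectives.
    Finally, the codes of external formulas have satisfaction relations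
    ([sat_table_exists]), which gives elementarity of [j] for external formulas
    ([elementary]). *)

(** * Definability with parameters *)

Definition up (r : nat -> nat) (n : nat) : nat :=
  match n with O => O | S k => S (r k) end.

Fixpoint frename (r : nat -> nat) (A : formula) : formula :=
  match A with
  | fmem i j => fmem (r i) (r j)
  | feq i j => feq (r i) (r j)
  | fneg B => fneg (frename r B)
  | fand B C => fand (frename r B) (frename r C)
  | fall B => fall (frename (up r) B)
  end.

(** Environments with parameters: even indices hold the arguments of a predicate and
    odd ones its parameters, so that two formulas are brought to common parameters by
    renaming the odd indices. *)
Definition mix {T : Type} (e g : nat -> T) (n : nat) : T :=
  if Nat.even n then e (Nat.div2 n) else g (Nat.div2 n).

Definition etl {T : Type} (e : nat -> T) (n : nat) : T := e (S n).
Arguments etl {T} e n /.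

Lemma even_or_odd n : (exists k, n = 2 * k) \/ (exists k, n = S (2 * k)).
Proof.
  destruct (Nat.Even_or_Odd n) as [[k ->]|[k ->]]; [left|right]; exists k; lia.
Qed.

Lemma even_double k : Nat.even (2 * k) = true.
Proof. apply Nat.even_spec. now exists k. Qed.

Lemma even_double_S k : Nat.even (S (2 * k)) = false.
Proof. rewrite Nat.even_succ, <- Nat.negb_even, even_double. reflexivity. Qed.

Lemma mix_even T (e g : nat -> T) k : mix e g (2 * k) = e k.
Proof. unfold mix. rewrite even_double, Nat.div2_double. reflexivity. Qed.

Lemma mix_odd T (e g : nat -> T) k : mix e g (S (2 * k)) = g k.
Proof. unfold mix. rewrite even_double_S, Nat.div2_succ_double. reflexivity. Qed.

Local Notation operation V := ((nat -> V) -> V).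

Section Definability.
Context {V : structure}.
Implicit Types (e g : nat -> V) (P Q : (nat -> V) -> Prop).

Lemma sat_frename A : forall r e, sat e (frename r A) <-> sat (fun n => e (r n)) A.
Proof.
  induction A as [i j|i j|A IH|A IHA B IHB|A IH]; intros r e; simpl; try tauto.
  - rewrite IH; tauto.
  - rewrite IHA, IHB; tauto.
  - assert (E : forall x, (fun n => scons x e (up r n)) = scons x (fun n => e (r n))).
    { intros x; apply functional_extensionality; intros [|n]; reflexivity. }
    split; intros H x; specialize (H x); [rewrite IH, E in H|rewrite IH, E]; exact H.
Qed.

(** The closure lemmas below are named dp_ for predicates and dt_ for terms. *)
Definition definable P := exists A g, forall e, sat (mix e g) A <-> P e.

(** Stated through the graph, with the value at index 0, so that operations obtained
    from a choice of a set with given elements are covered. *)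
Definition dterm (t : operation V) := definable (fun e => e 0 = t (etl e)).

Lemma dp_iff P Q : (forall e, P e <-> Q e) -> definable P -> definable Q.
Proof.
  intros E (A & g & H). exists A, g. intros e. rewrite H. apply E.
Qed.

Lemma dp_rename (r : nat -> nat) P : definable P -> definable (fun e => P (fun n => e (r n))).
Proof.
  intros (A & g & H).
  exists (frename (fun n => if Nat.even n then 2 * r (Nat.div2 n) else n) A), g.
  intros e. rewrite sat_frename, <- H.
  match goal with |- sat ?a _ <-> sat ?b _ => replace b with a; [tauto|] end.
  apply functional_extensionality; intros n.
  destruct (even_or_odd n) as [[k ->]|[k ->]].
  - now rewrite even_double, Nat.div2_double, !mix_even.
  - now rewrite even_double_S, !mix_odd.
Qed.

Lemma dp_and P Q : definable P -> definable Q -> definable (fun e => P e /\ Q e).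
Proof.
  intros (A & g & HA) (B & h & HB).
  exists (fand (frename (fun n => if Nat.even n then n else S (2 * (2 * Nat.div2 n))) A)
          (frename (fun n => if Nat.even n then n else S (2 * S (2 * Nat.div2 n))) B)),
    (mix g h).
  intros e. cbn [sat]. rewrite !sat_frename, <- HA, <- HB.
  match goal with |- sat ?a _ /\ sat ?b _ <-> sat ?c _ /\ sat ?d _ =>
    replace a with c; [replace b with d; [tauto|]|] end;
  apply functional_extensionality; intros n;
  destruct (even_or_odd n) as [[k ->]|[k ->]];
  rewrite ?even_double, ?even_double_S, ?Nat.div2_double, ?Nat.div2_succ_double,
    ?mix_even; rewrite ?mix_odd, ?mix_even; reflexivity.
Qed.

Lemma dp_not P : definable P -> definable (fun e => ~ P e).
Proof. intros (A & g & H). exists (fneg A), g. intros e. simpl. rewrite H. tauto. Qed.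

Lemma dp_all (P : V -> (nat -> V) -> Prop) :
  definable (fun e => P (e 0) (etl e)) -> definable (fun e => forall x, P x e).
Proof.
  intros (A & g & H).
  exists (fall (frename (fun n => if Nat.even n then Nat.pred n else S n) A)), g.
  intros e. simpl.
  enough (E : forall x, sat (scons x (mix e g))
      (frename (fun n => if Nat.even n then Nat.pred n else S n) A) <-> P x e).
  { split; intros K x; specialize (K x); apply E; exact K. }
  intros x. rewrite sat_frename.
  assert (F : (fun n => scons x (mix e g) (if Nat.even n then Nat.pred n else S n))
              = mix (scons x e) g).
  { apply functional_extensionality; intros n.
    destruct (even_or_odd n) as [[k ->]|[k ->]].
    - rewrite even_double, mix_even. destruct k as [|k]; [reflexivity|].
      replace (Nat.pred (2 * S k)) with (S (2 * k)) by lia.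
      cbn [scons]. apply mix_even.
    - rewrite even_double_S, mix_odd. cbn [scons]. apply mix_odd. }
  rewrite F, H. reflexivity.
Qed.

Lemma dp_mem_var i j : V -> definable (fun e => e i ∈ e j).
Proof.
  intros v. exists (fmem (2 * i) (2 * j)), (fun _ => v).
  intros e. cbn [sat]. rewrite !mix_even. tauto.
Qed.

Lemma dp_eq_var i j : V -> definable (fun e => e i = e j).
Proof.
  intros v. exists (feq (2 * i) (2 * j)), (fun _ => v).
  intros e. cbn [sat]. rewrite !mix_even. tauto.
Qed.

Lemma dt_const (c : V) : dterm (fun _ => c).
Proof.
  exists (feq (2 * 0) (S (2 * 0))), (fun _ => c).
  intros e. cbn [sat]. rewrite mix_even, mix_odd. tauto.
Qed.

Lemma dp_imp P Q : definable P -> definable Q -> definable (fun e => P e -> Q e).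
Proof.
  intros HP HQ. apply (dp_iff (fun e => ~ (P e /\ ~ Q e))).
  - intros e. split; [intros H p; apply NNPP; tauto|tauto].
  - apply dp_not, dp_and; [|apply dp_not]; assumption.
Qed.

Lemma dp_or P Q : definable P -> definable Q -> definable (fun e => P e \/ Q e).
Proof.
  intros HP HQ. apply (dp_iff (fun e => ~ P e -> Q e)).
  - intros e. split; [intros H; destruct (classic (P e)); tauto|tauto].
  - apply dp_imp; [apply dp_not|]; assumption.
Qed.

Lemma dp_equiv P Q : definable P -> definable Q -> definable (fun e => P e <-> Q e).
Proof. intros HP HQ. apply dp_and; apply dp_imp; assumption. Qed.

Lemma dp_ex (P : V -> (nat -> V) -> Prop) :
  definable (fun e => P (e 0) (etl e)) -> definable (fun e => exists x, P x e).
Proof.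
  intros HP. apply (dp_iff (fun e => ~ forall x, ~ P x e)).
  - intros e. split.
    + intros H. apply NNPP. intros K. apply H. intros x p. apply K. now exists x.
    + intros [x p] H. exact (H x p).
  - apply dp_not, dp_all, dp_not, HP.
Qed.

Lemma dt_etl (t : operation V) : dterm t -> dterm (fun e => t (etl e)).
Proof. intros H. exact (dp_rename (fun n => match n with 0 => 0 | S n => S (S n) end) _ H). Qed.

(** Definable terms are substituted by quantifying over their values. *)
Lemma dp_let (P : V -> (nat -> V) -> Prop) (t : operation V) :
  definable (fun e => P (e 0) (etl e)) -> dterm t -> definable (fun e => P (t e) e).
Proof.
  intros HP Ht. apply (dp_iff (fun e => exists x, x = t e /\ P x e)).
  - intros e. split; [intros (x & -> & H); exact H|intros H; now exists (t e)].
  - apply dp_ex, dp_and; assumption.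
Qed.

Lemma dp_app1 (R : V -> Prop) (t : operation V) :
  definable (fun e => R (e 0)) -> dterm t -> definable (fun e => R (t e)).
Proof. exact (dp_let (fun x _ => R x) t). Qed.

Lemma dp_app2 (R : V -> V -> Prop) (t u : operation V) :
  definable (fun e => R (e 0) (e 1)) -> dterm t -> dterm u -> definable (fun e => R (t e) (u e)).
Proof.
  intros HR Ht Hu. apply (dp_let (fun x e => R x (u e))); [|exact Ht].
  apply (dp_let (fun y e => R (e 0) y)); [|exact (dt_etl _ Hu)].
  exact (dp_rename (fun n => match n with 0 => 1 | _ => 0 end) _ HR).
Qed.

Lemma dp_app3 (R : V -> V -> V -> Prop) (t u v : operation V) :
  definable (fun e => R (e 0) (e 1) (e 2)) -> dterm t -> dterm u -> dterm v ->
  definable (fun e => R (t e) (u e) (v e)).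
Proof.
  intros HR Ht Hu Hv. apply (dp_let (fun x e => R x (u e) (v e))); [|exact Ht].
  apply (dp_let (fun y e => R (e 0) y (v (etl e)))); [|exact (dt_etl _ Hu)].
  apply (dp_let (fun z e => R (e 1) (e 0) z)); [|exact (dt_etl _ (dt_etl _ Hv))].
  exact (dp_rename (fun n => match n with 0 => 2 | 1 => 1 | _ => 0 end) _ HR).
Qed.

Lemma dt_var i : V -> dterm (fun e => e i).
Proof. intros v. exact (dp_eq_var 0 (S i) v). Qed.

End Definability.

(** * Elementary set theory in a model of ZF *)

Existing Class ZF.

Lemma ZF_inhabited {V : structure} {HV : @ZF V} : inhabited V.
Proof. destruct HV as (_ & _ & _ & _ & _ & (a & _) & _). exact (inhabits a). Qed.

Definition is_set {V : structure} (P : V -> Prop) := exists b, forall x : V, x ∈ b <-> P x.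

(** Arbitrary unless [is_set P]. All set operations are instances, hence definable by
    [dt_setof]. *)
Definition setof {V : structure} {HV : @ZF V} (P : V -> Prop) : V :=
  epsilon ZF_inhabited (fun b => forall x : V, x ∈ b <-> P x).

Section Atoms.
Context {V : structure} {HV : @ZF V}.
Implicit Types (P Q : (nat -> V) -> Prop) (t u : operation V).

Lemma dp_const (Q : Prop) : @definable V (fun _ => Q).
Proof.
  destruct (@ZF_inhabited V HV) as [v].
  destruct (classic Q) as [q|q].
  - apply (dp_iff (fun e => e 0 = e 0)); [tauto|apply (dp_eq_var 0 0 v)].
  - apply (dp_iff (fun e => ~ e 0 = e 0)); [tauto|apply dp_not, (dp_eq_var 0 0 v)].
Qed.

Lemma dt_index i : @dterm V (fun e => e i).
Proof. destruct (@ZF_inhabited V HV) as [v]. exact (dt_var i v). Qed.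

Lemma dp_mem t u : dterm t -> dterm u -> definable (fun e => t e ∈ u e).
Proof.
  destruct (@ZF_inhabited V HV) as [v].
  apply (dp_app2 (fun x y : V => x ∈ y)), (dp_mem_var 0 1 v).
Qed.

Lemma dp_eq t u : dterm t -> dterm u -> definable (fun e => t e = u e).
Proof.
  destruct (@ZF_inhabited V HV) as [v].
  apply (dp_app2 (fun x y : V => x = y)), (dp_eq_var 0 1 v).
Qed.

End Atoms.

Ltac definable_lemma := fail.

Ltac definable_step :=
  cbv beta; cbn [etl];
  lazymatch goal with
  | |- definable (fun _ => ?Q) => apply (dp_const Q)
  | |- dterm (fun e => e _) => apply dt_index
  | |- dterm (fun _ => ?c) => apply (dt_const c)
  | |- dterm (fun e => ?t (etl e)) => apply (dt_etl (fun e => t e))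
  | |- dterm (fun e => ?t (etl (etl e))) => apply (dt_etl (fun e => t (etl e)))
  | |- dterm (fun e => ?t (etl (etl (etl e)))) => apply (dt_etl (fun e => t (etl (etl e))))
  | |- definable (fun e => _ /\ _) => apply dp_and
  | |- definable (fun e => _ \/ _) => apply dp_or
  | |- definable (fun e => _ <-> _) => apply dp_equiv
  | |- definable (fun e => ~ _) => apply dp_not
  | |- definable (fun e => forall x : carrier _, _) => apply dp_all
  | |- definable (fun e => _ -> _) => apply dp_imp
  | |- definable (fun e => exists x, _) => apply dp_ex
  | |- definable (fun e => _ ∈ _) => apply dp_mem
  | |- definable (fun e => _ = _) => apply dp_eq
  | H : definable (fun e => ?R (e 0)) |- definable (fun e => ?R _) => apply (dp_app1 R _ H)
  | H : definable (fun e => ?R (e 0) (e 1)) |- definable (fun e => ?R _ _) => apply (dp_app2 R _ _ H)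
  | H : definable (fun e => ?R (e 0) (e 1) (e 2)) |- definable (fun e => ?R _ _ _) =>
      apply (dp_app3 R _ _ _ H)
  | |- _ => definable_lemma
  end.
Ltac definability := repeat first [assumption | definable_step].

Section Toolkit.
Context {V : structure} {HV : @ZF V}.
Implicit Types a b c d f i j l m p q r s t u v w x y z : V.

Lemma dp_subset (t u : operation V) : dterm t -> dterm u -> definable (fun e : nat ->
  V => subset (t e) (u e)).
Proof. apply (dp_app2 (fun x y => subset x y)). unfold subset. definability. Qed.

Lemma ext a b : (forall x, x ∈ a <-> x ∈ b) -> a = b.
Proof. destruct HV as (H & _). apply H. Qed.

Lemma setofP P : is_set P -> forall x : V, x ∈ setof P <-> P x.
Proof.
  intros H. unfold setof.
  apply (epsilon_spec ZF_inhabited (fun b => forall x : V, x ∈ b <-> P x) H).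
Qed.

Lemma setof_unique P b : is_set P -> (b = setof P <-> forall x : V, x ∈ b <-> P x).
Proof.
  intros H. split.
  - intros ->. now apply setofP.
  - intros K. apply ext. intros x. now rewrite setofP, K.
Qed.

Lemma dt_setof (P : V -> (nat -> V) -> Prop) :
  (forall e, is_set (fun x => P x e)) -> definable (fun e => P (e 0) (etl e)) ->
  dterm (fun e => setof (fun x => P x e)).
Proof.
  intros H HP. unfold dterm.
  apply (dp_iff (fun e => forall x, x ∈ e 0 <-> P x (etl e))).
  - intros e. symmetry. now apply setof_unique.
  - apply dp_all, dp_equiv; [definability|].
    exact (dp_rename (fun n => match n with 0 => 0 | S n => S (S n) end) _ HP).
Qed.

(** This and [repl_set] restate the axiom schemes for predicates definable with
    parameters; from here on sets are formed without exhibiting formulas. *)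
Lemma sep_set (P : V -> Prop) a : definable (fun e => P (e 0)) -> is_set (fun x => x ∈ a /\ P x).
Proof.
  destruct HV as (_ & _ & _ & _ & _ & _ & H & _). intros (A & g & HA).
  destruct (H (frename (fun n => if Nat.even n then 0 else S (Nat.div2 n)) A) g a) as [b Hb].
  exists b. intros x. rewrite Hb, sat_frename.
  match goal with |- context [sat ?e A] => replace e with (mix (fun _ => x) g) end.
  - rewrite HA. tauto.
  - apply functional_extensionality. intros n.
    destruct (even_or_odd n) as [[k ->]|[k ->]].
    + now rewrite even_double, mix_even.
    + now rewrite even_double_S, mix_odd, Nat.div2_succ_double.
Qed.

Lemma repl_set (R : V -> V -> Prop) a : definable (fun e => R (e 0) (e 1)) ->
  (forall x y y', x ∈ a -> R x y -> R x y' -> y = y') ->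
  is_set (fun y => exists x, x ∈ a /\ R x y).
Proof.
  destruct HV as (_ & _ & _ & _ & _ & _ & _ & H). intros (A & g & HA) HR.
  set (B := frename (fun n => if Nat.even n then match n with 0 => 1 | _ => 0 end
                              else S (S (Nat.div2 n))) A).
  assert (E : forall x y, sat (scons y (scons x g)) B <-> R x y).
  { intros x y. unfold B. rewrite sat_frename.
    match goal with |- context [sat ?e A] =>
      replace e with (mix (fun n => match n with 0 => x | _ => y end) g) end.
    - apply HA.
    - apply functional_extensionality. intros n.
      destruct (even_or_odd n) as [[k ->]|[k ->]].
      + rewrite even_double, mix_even. destruct k; reflexivity.
      + now rewrite even_double_S, mix_odd, Nat.div2_succ_double. }
  destruct (H B g a) as [b Hb].
  - intros x y y' Hx. rewrite !E. now apply HR.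
  - exists b. intros y. rewrite Hb. split; intros (x & Hx & K); exists x; split;
      try assumption; now apply E.
Qed.

Lemma is_set_iff (P Q : V -> Prop) : (forall x, P x <-> Q x) -> is_set P -> is_set Q.
Proof. intros E (b & Hb). exists b. intros x. now rewrite Hb. Qed.

Lemma bounded_set (P : V -> Prop) a :
  definable (fun e => P (e 0)) -> (forall x, P x -> x ∈ a) -> is_set P.
Proof.
  intros HP H. apply (is_set_iff (fun x => x ∈ a /\ P x)); [|now apply sep_set].
  intros x. split; [tauto|auto].
Qed.

(** ** Pairs, unions, powers *)

Definition emp : V := setof (fun _ => False).
Definition pair x y : V := setof (fun w => w = x \/ w = y).
Definition sing x : V := pair x x.
Definition op x y : V := setof (fun w => w = sing x \/ w = pair x y).
Definition bigcup a : V := setof (fun x => exists y, y ∈ a /\ x ∈ y).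
Definition cup a b : V := setof (fun x => x ∈ a \/ x ∈ b).
Definition pow a : V := setof (fun x => subset x a).
Definition suc x : V := cup x (sing x).
Definition times a b : V := setof (fun w => exists x y, x ∈ a /\ y ∈ b /\ w = op x y).

Lemma pair_set x y : is_set (fun w => w = x \/ w = y).
Proof. destruct HV as (_ & _ & H & _). apply (H x y). Qed.
Lemma bigcup_set a : is_set (fun x => exists y, y ∈ a /\ x ∈ y).
Proof. destruct HV as (_ & _ & _ & H & _). apply (H a). Qed.
Lemma pow_set a : is_set (fun x => subset x a).
Proof. destruct HV as (_ & _ & _ & _ & H & _). apply (H a). Qed.

Lemma in_pair w x y : w ∈ pair x y <-> w = x \/ w = y.
Proof. apply setofP, pair_set. Qed.
Lemma in_sing w x : w ∈ sing x <-> w = x.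
Proof. unfold sing. rewrite in_pair. tauto. Qed.
Lemma in_op w x y : w ∈ op x y <-> w = sing x \/ w = pair x y.
Proof. apply setofP, pair_set. Qed.
Lemma in_bigcup x a : x ∈ bigcup a <-> exists y, y ∈ a /\ x ∈ y.
Proof. revert x. apply setofP, bigcup_set. Qed.
Lemma in_pow x a : x ∈ pow a <-> subset x a.
Proof. revert x. apply setofP, pow_set. Qed.
Lemma in_emp x : ~ x ∈ emp.
Proof.
  assert (S : is_set (fun _ : V => False)).
  { destruct ZF_inhabited as [a].
    apply (bounded_set (fun _ => False) a); [definability|tauto]. }
  intros H. exact (proj1 (setofP _ S x) H).
Qed.
Lemma cup_set a b : is_set (fun x => x ∈ a \/ x ∈ b).
Proof.
  apply (is_set_iff (fun x => exists y, y ∈ pair a b /\ x ∈ y)); [|apply bigcup_set].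
  intros x. split.
  - intros (y & Hy & Hx). apply in_pair in Hy. destruct Hy; subst; tauto.
  - intros [H|H]; [exists a|exists b]; rewrite in_pair; tauto.
Qed.
Lemma in_cup x a b : x ∈ cup a b <-> x ∈ a \/ x ∈ b.
Proof. revert x. apply setofP, cup_set. Qed.
Lemma in_suc w x : w ∈ suc x <-> w ∈ x \/ w = x.
Proof. unfold suc. now rewrite in_cup, in_sing. Qed.

Lemma pair_inj x y y' : pair x y = pair x y' -> y = y'.
Proof.
  intros E. assert (H := in_pair y x y). assert (K := in_pair y' x y').
  rewrite E in H. rewrite <- E in K. rewrite in_pair in *. intuition congruence.
Qed.
Lemma sing_pair x y z : sing x = pair y z -> x = y /\ x = z.
Proof.
  intros E. assert (H := in_pair y y z). assert (K := in_pair z y z).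
  rewrite <- E, in_sing in H, K. intuition.
Qed.
Lemma op_inj x y x' y' : op x y = op x' y' -> x = x' /\ y = y'.
Proof.
  intros E.
  assert (X : x = x').
  { assert (H : sing x ∈ op x' y') by (rewrite <- E; apply in_op; tauto).
    apply in_op in H. destruct H as [H|H]; now apply sing_pair in H. }
  subst x'. split; [reflexivity|].
  assert (H : pair x y ∈ op x y') by (rewrite <- E; apply in_op; tauto).
  assert (K : pair x y' ∈ op x y) by (rewrite E; apply in_op; tauto).
  apply in_op in H, K. destruct H as [H|H]; [|now apply pair_inj in H].
  destruct K as [K|K]; [|now apply pair_inj in K].
  symmetry in H, K. apply sing_pair in H, K. intuition congruence.
Qed.

Lemma is_upairE z x y : is_upair z x y <-> z = pair x y.
Proof. symmetry. apply setof_unique, pair_set. Qed.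
Lemma is_opairE z x y : is_opair z x y <-> z = op x y.
Proof.
  symmetry. unfold op. rewrite setof_unique; [|apply pair_set].
  unfold is_opair. split; intros H w; specialize (H w); rewrite !is_upairE in *; exact H.
Qed.
Lemma is_succE y x : is_succ y x <-> y = suc x.
Proof.
  split.
  - intros H. apply ext. intros w. rewrite in_suc. apply H.
  - intros -> w. apply in_suc.
Qed.
Lemma is_emptyE z : is_empty z <-> z = emp.
Proof.
  split.
  - intros H. apply ext. intros w. split; [intros K; now destruct (H w)|].
    intros K. now apply in_emp in K.
  - intros -> w. apply in_emp.
Qed.
Lemma relE f x y : rel f x y <-> op x y ∈ f.
Proof.
  split.
  - intros (z & Hz & H). apply is_opairE in H. now subst.
  - intros H. exists (op x y). split; [exact H|]. now apply is_opairE.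
Qed.

Lemma dt_pair (t u : operation V) : dterm t -> dterm u -> dterm (fun e : nat ->
  V => pair (t e) (u e)).
Proof.
  intros Ht Hu. apply dt_setof; [intros; apply pair_set|]. definability.
Qed.
Lemma dt_op (t u : operation V) : dterm t -> dterm u -> dterm (fun e : nat ->
  V => op (t e) (u e)).
Proof.
  intros Ht Hu. apply dt_setof; [intros; apply pair_set|].
  unfold sing. definability; now apply dt_pair; definability.
Qed.
Lemma dt_bigcup (t : operation V) : dterm t -> dterm (fun e : nat -> V => bigcup (t e)).
Proof. intros Ht. apply dt_setof; [intros; apply bigcup_set|]. definability. Qed.
Lemma dt_pow (t : operation V) : dterm t -> dterm (fun e : nat -> V => pow (t e)).
Proof. intros Ht. apply dt_setof; [intros; apply pow_set|]. apply dp_subset; definability. Qed.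
Lemma dt_cup (t u : operation V) : dterm t -> dterm u -> dterm (fun e : nat ->
  V => cup (t e) (u e)).
Proof. intros Ht Hu. apply dt_setof; [intros; apply cup_set|]. definability. Qed.
Lemma dt_suc (t : operation V) : dterm t -> dterm (fun e : nat -> V => suc (t e)).
Proof. intros Ht. unfold suc, sing. apply dt_cup; [|apply dt_pair]; assumption. Qed.

End Toolkit.

Ltac set_definable := lazymatch goal with
  | |- dterm (fun e => pair _ _) => apply dt_pair
  | |- dterm (fun e => sing _) => unfold sing; apply dt_pair
  | |- dterm (fun e => op _ _) => apply dt_op
  | |- dterm (fun e => bigcup _) => apply dt_bigcup
  | |- dterm (fun e => pow _) => apply dt_pow
  | |- dterm (fun e => cup _ _) => apply dt_cup
  | |- dterm (fun e => suc _) => apply dt_suc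
  | |- definable (fun e => subset _ _) => apply dp_subset
end.
Ltac definable_lemma ::= set_definable.

(** * Functions, natural numbers and ordinals *)

Section Functions.
Context {V : structure} {HV : @ZF V}.
Implicit Types a b c d f h i j l m p q r s t u v w x y z : V.

Lemma in_times w a b : w ∈ times a b <-> exists x y, x ∈ a /\ y ∈ b /\ w = op x y.
Proof.
  revert w. apply setofP. apply (bounded_set _ (pow (pow (cup a b)))).
  - definability.
  - intros w (x & y & Hx & Hy & ->). apply in_pow. intros u Hu. apply in_pow. intros v Hv.
    apply in_cup. apply in_op in Hu. destruct Hu as [->| ->].
    + apply in_sing in Hv. subst. tauto.
    + apply in_pair in Hv. destruct Hv; subst; tauto.
Qed.

Lemma op_in_times x y a b : op x y ∈ times a b <-> x ∈ a /\ y ∈ b.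
Proof.
  rewrite in_times. split.
  - intros (x' & y' & Hx & Hy & E). apply op_inj in E as [-> ->]. tauto.
  - intros [Hx Hy]. now exists x, y.
Qed.

Lemma is_funE f a b : is_fun f a b <->
  (forall z, z ∈ f -> exists x y, x ∈ a /\ y ∈ b /\ z = op x y) /\
  (forall x, x ∈ a -> exists y, op x y ∈ f) /\
  (forall x y y', op x y ∈ f -> op x y' ∈ f -> y = y').
Proof.
  unfold is_fun. setoid_rewrite relE. setoid_rewrite is_opairE.
  split; intros (H1 & H2); (split; [|exact H2]); intros z Hz; destruct (H1 z Hz) as (x & H).
  - destruct H as (Hx & y & H). now exists x, y.
  - destruct H as (y & Hx & H). exists x. eauto.
Qed.

Lemma fun_bounds {f a b x y} : is_fun f a b -> op x y ∈ f -> x ∈ a /\ y ∈ b.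
Proof.
  rewrite is_funE. intros (H & _) K.
  destruct (H _ K) as (x' & y' & Hx & Hy & E). apply op_inj in E as [-> ->]. tauto.
Qed.

Lemma fun_unique {f a b x y y'} : is_fun f a b -> op x y ∈ f -> op x y' ∈ f -> y = y'.
Proof. rewrite is_funE. intros (_ & _ & H). apply H. Qed.

Lemma fun_total {f a b} x : is_fun f a b -> x ∈ a -> exists y, op x y ∈ f.
Proof. rewrite is_funE. intros (_ & H & _). apply H. Qed.

Lemma fun_of_rel (R : V -> V -> Prop) a b :
  definable (fun e => R (e 0) (e 1)) ->
  (forall x, x ∈ a -> exists y, y ∈ b /\ R x y) ->
  (forall x y y', x ∈ a -> R x y -> R x y' -> y = y') ->
  exists f, is_fun f a b /\ forall x y, op x y ∈ f <-> x ∈ a /\ R x y.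
Proof.
  intros HR Htot Huni.
  destruct (sep_set (fun z => exists x y, z = op x y /\ R x y) (times a b)) as [f Hf]; [definability|].
  assert (E : forall x y, op x y ∈ f <-> x ∈ a /\ R x y).
  { intros x y. rewrite Hf, op_in_times. split.
    - intros ((Hx & Hy) & x' & y' & K & HR'). apply op_inj in K as [-> ->]. tauto.
    - intros (Hx & Hy). destruct (Htot x Hx) as (y' & Hy' & HR').
      rewrite (Huni x y y' Hx Hy HR'). split; [tauto|]. now exists x, y'. }
  exists f. split; [|exact E]. apply is_funE. split; [|split].
  - intros z Hz. apply Hf in Hz. destruct Hz as [Hz _]. apply in_times in Hz. exact Hz.
  - intros x Hx. destruct (Htot x Hx) as (y & Hy & K). exists y. now apply E.
  - intros x y y' K K'. apply E in K, K'. apply (Huni x); tauto.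
Qed.

Lemma fun_on_of_rel (R : V -> V -> Prop) a :
  definable (fun e => R (e 0) (e 1)) ->
  (forall x, x ∈ a -> exists y, R x y) ->
  (forall x y y', x ∈ a -> R x y -> R x y' -> y = y') ->
  exists f, fun_on f a /\ forall x y, op x y ∈ f <-> x ∈ a /\ R x y.
Proof.
  intros HR Htot Huni.
  destruct (repl_set R a HR Huni) as [b Hb].
  destruct (fun_of_rel R a b HR) as (f & Hf & E).
  - intros x Hx. destruct (Htot x Hx) as [y Hy]. exists y. split; [|exact Hy].
    apply Hb. now exists x.
  - exact Huni.
  - exists f. split; [now exists b|exact E].
Qed.

Lemma op_in_extension f u v x y :
  op u v ∈ cup f (sing (op x y)) <-> op u v ∈ f \/ (u = x /\ v = y).
Proof.
  rewrite in_cup, in_sing. split; (intros [H|H]; [now left|right]).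
  - now apply op_inj in H.
  - now destruct H; subst.
Qed.

Lemma fun_extend f a b x y : is_fun f a b -> ~ x ∈ a ->
  is_fun (cup f (sing (op x y))) (cup a (sing x)) (cup b (sing y)).
Proof.
  intros Hf Hx. assert (Hf' := Hf). apply is_funE in Hf'. destruct Hf' as (F1 & F2 & F3).
  apply is_funE. split; [|split].
  - intros z Hz. apply in_cup in Hz. rewrite in_sing in Hz. destruct Hz as [Hz| ->].
    + destruct (F1 z Hz) as (u & v & Hu & Hv & ->). exists u, v. rewrite !in_cup. tauto.
    + exists x, y. rewrite !in_cup, !in_sing. tauto.
  - intros u Hu. apply in_cup in Hu. rewrite in_sing in Hu. destruct Hu as [Hu| ->].
    + destruct (F2 u Hu) as [v Hv]. exists v. apply op_in_extension. tauto.
    + exists y. apply op_in_extension. tauto.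
  - assert (N : forall v, ~ op x v ∈ f)
      by (intros v Hv; apply Hx; exact (proj1 (fun_bounds Hf Hv))).
    intros u v v'. rewrite !op_in_extension. intros [H|[-> ->]] [H'|[E ->]];
      try subst u; try reflexivity; [now apply (F3 u)|now apply N in H|now apply N in H'].
Qed.

Lemma fun_sing x y : is_fun (sing (op x y)) (sing x) (sing y).
Proof.
  apply is_funE. split; [|split].
  - intros z Hz. apply in_sing in Hz. exists x, y. rewrite !in_sing. tauto.
  - intros u Hu. apply in_sing in Hu. subst. exists y. now apply in_sing.
  - intros u v v'. rewrite !in_sing. intros E E'. apply op_inj in E, E'. intuition congruence.
Qed.

Lemma fun_codomain f a b c : is_fun f a b -> subset b c -> is_fun f a c.
Proof.
  rewrite !is_funE. intros (H1 & H2 & H3) S. split; [|split; assumption].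
  intros z Hz. destruct (H1 z Hz) as (x & y & Hx & Hy & E). exists x, y. auto.
Qed.

Lemma suc_emp : @suc V HV emp = sing emp.
Proof.
  apply ext. intros w. rewrite in_suc, in_sing. split; [|tauto].
  intros [H|H]; [now apply in_emp in H|exact H].
Qed.

(** ** Foundation and natural numbers *)

Lemma regularity a : (exists x, x ∈ a) -> exists x, x ∈ a /\ forall y, y ∈ x -> ~ y ∈ a.
Proof. destruct HV as (_ & H & _). apply H. Qed.

Lemma mem_irrefl x : ~ x ∈ x.
Proof.
  intros H. destruct (regularity (sing x)) as (y & Hy & K).
  - exists x. now apply in_sing.
  - apply in_sing in Hy. subst. apply (K x H). now apply in_sing.
Qed.

Lemma mem_asym x y : x ∈ y -> ~ y ∈ x.
Proof.
  intros H1 H2. destruct (regularity (pair x y)) as (z & Hz & K).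
  - exists x. apply in_pair. tauto.
  - apply in_pair in Hz. destruct Hz as [->| ->].
    + apply (K y H2). apply in_pair. tauto.
    + apply (K x H1). apply in_pair. tauto.
Qed.

Lemma suc_inj x y : suc x = suc y -> x = y.
Proof.
  intros E. assert (H : x ∈ suc y) by (rewrite <- E; apply in_suc; tauto).
  assert (K : y ∈ suc x) by (rewrite E; apply in_suc; tauto).
  apply in_suc in H, K. destruct H as [H|H]; [|exact H].
  destruct K as [K|K]; [|now symmetry]. now apply mem_asym in H.
Qed.

Lemma inductiveE a : inductive a <-> emp ∈ a /\ forall x, x ∈ a -> suc x ∈ a.
Proof.
  unfold inductive. setoid_rewrite is_emptyE. setoid_rewrite is_succE.
  split; intros (H0 & H); (split; [|intros x Hx]).
  - now destruct H0 as (z & Hz & ->).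
  - now destruct (H x Hx) as (y & Hy & ->).
  - now exists emp.
  - exists (suc x). auto.
Qed.

Lemma dp_is_nat (t : operation V) : dterm t -> definable (fun e => is_nat (t e)).
Proof.
  apply (dp_app1 (fun x => is_nat x)).
  apply (dp_iff (fun e => forall a, emp ∈ a /\ (forall x, x ∈ a -> suc x ∈ a) -> e 0 ∈ a)).
  - intros e. split; intros H a Ha; apply H; now apply inductiveE.
  - definability.
Qed.

Definition omega : V := setof is_nat.

Lemma in_omega x : x ∈ omega <-> is_nat x.
Proof.
  revert x. apply setofP.
  destruct HV as (_ & _ & _ & _ & _ & (a & Ha) & _).
  apply (bounded_set _ a); [apply dp_is_nat; definability|]. intros x H. now apply H.
Qed.

Lemma is_omegaE w : is_omega w <-> w = omega.
Proof.
  split.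
  - intros H. apply ext. intros x. now rewrite in_omega.
  - intros -> x. apply in_omega.
Qed.

Lemma nat_emp : is_nat emp.
Proof. intros a Ha. now apply inductiveE in Ha. Qed.

Lemma nat_suc x : is_nat x -> is_nat (suc x).
Proof. intros H a Ha. assert (K := Ha). apply inductiveE in K. apply K, H, Ha. Qed.

Lemma nat_induction (P : V -> Prop) : definable (fun e => P (e 0)) ->
  P emp -> (forall x, is_nat x -> P x -> P (suc x)) -> forall x, is_nat x -> P x.
Proof.
  intros HP H0 HS x Hx.
  destruct (sep_set P omega HP) as [b Hb].
  assert (K : inductive b).
  { apply inductiveE. split.
    - apply Hb. split; [apply in_omega, nat_emp|exact H0].
    - intros y Hy. apply Hb in Hy. destruct Hy as [Hy1 Hy2]. apply in_omega in Hy1.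
      apply Hb. split; [apply in_omega, nat_suc, Hy1|now apply HS]. }
  apply Hb, Hx, K.
Qed.

Lemma nat_elem x y : is_nat x -> y ∈ x -> is_nat y.
Proof.
  intros Hx. revert y. pattern x. apply nat_induction; [|..|exact Hx].
  - definability; apply dp_is_nat; definability.
  - intros y Hy. now apply in_emp in Hy.
  - intros z Hz IH y Hy. apply in_suc in Hy. destruct Hy as [Hy| ->]; auto.
Qed.

Lemma nat_transitive x : is_nat x -> transitive x.
Proof.
  intros Hx. pattern x. apply nat_induction; [|..|exact Hx]; unfold transitive.
  - definability.
  - intros y Hy. now apply in_emp in Hy.
  - intros z Hz IH y Hy w Hw. apply in_suc. apply in_suc in Hy.
    destruct Hy as [Hy| ->]; [|tauto]. left. now apply (IH y).
Qed.

Lemma nat_cases x : is_nat x -> x = emp \/ exists y, is_nat y /\ x = suc y.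
Proof.
  intros Hx. pattern x. apply nat_induction; [|..|exact Hx].
  - definability; apply dp_is_nat; definability.
  - tauto.
  - intros z Hz _. right. now exists z.
Qed.

Lemma suc_in_suc x y : is_nat y -> x ∈ y -> suc x ∈ suc y.
Proof.
  intros Hy. revert x. pattern y. apply nat_induction; [|..|exact Hy].
  - definability.
  - intros x H. now apply in_emp in H.
  - intros z Hz IH x Hx. apply in_suc in Hx. apply in_suc.
    destruct Hx as [Hx| ->]; [left; auto|right; reflexivity].
Qed.

Lemma emp_in_suc x : is_nat x -> emp ∈ suc x.
Proof.
  intros Hx. pattern x. apply nat_induction; [|..|exact Hx].
  - definability.
  - apply in_suc. tauto.
  - intros z Hz IH. apply in_suc. tauto.
Qed.

(** ** Iteration along a natural number *)

(** Iteration along a natural number of the model, which may be nonstandard; finite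
    sequences of steps of the ordering and concatenation are both of this form. *)
Definition iter (S : V -> V -> V -> Prop) (n : V) a b :=
  exists h, fun_on h (suc n) /\ op emp a ∈ h /\ op n b ∈ h /\
    forall i c d, i ∈ n -> op i c ∈ h -> op (suc i) d ∈ h -> S i c d.

Lemma iter_emp S a b : iter S emp a b <-> a = b.
Proof.
  split.
  - intros (h & [c Hc] & Ha & Hb & _). exact (fun_unique Hc Ha Hb).
  - intros ->. exists (sing (op emp b)). split; [|split; [|split]]; try now apply in_sing.
    + exists (sing b). rewrite suc_emp. apply fun_sing.
    + intros i c d Hi. now apply in_emp in Hi.
Qed.

Lemma iter_suc S n a c : is_nat n ->
  (iter S (suc n) a c <-> exists b, iter S n a b /\ S n b c).
Proof.
  intros Hn. split.
  - intros (h & [r Hr] & Ha & Hc & HS).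
    destruct (fun_total n Hr) as [b Hb]; [apply in_suc; left; apply in_suc; tauto|].
    exists b. split; [|apply HS; [apply in_suc; tauto|exact Hb|exact Hc]].
    destruct (fun_of_rel (fun x y => op x y ∈ h) (suc n) r) as (g & Hg & E).
    + definability.
    + intros x Hx. destruct (fun_total x Hr) as [y Hy]; [apply in_suc; tauto|].
      exists y. split; [now apply (fun_bounds Hr) in Hy|exact Hy].
    + intros x y y' _. apply (fun_unique Hr).
    + exists g. split; [now exists r|]. split; [|split].
      * apply E. split; [now apply emp_in_suc|exact Ha].
      * apply E. split; [apply in_suc; tauto|exact Hb].
      * intros i x y Hi K L. apply E in K, L. apply HS; try tauto; apply in_suc; tauto.
  - intros (b & (h & [r Hr] & Ha & Hb & HS) & K).
    exists (cup h (sing (op (suc n) c))). rewrite !op_in_extension.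
    split; [|split; [tauto|split; [tauto|]]].
    + exists (cup r (sing c)). apply fun_extend; [exact Hr|apply mem_irrefl].
    + intros i x y Hi. rewrite !op_in_extension. intros L L'.
      assert (N : i <> suc n).
      { intros ->. apply in_suc in Hi. destruct Hi as [Hi|Hi].
        - apply (mem_asym _ _ Hi). apply in_suc. tauto.
        - apply (mem_irrefl n). rewrite <- Hi at 2. apply in_suc. tauto. }
      destruct L as [L|[L _]]; [|tauto].
      apply in_suc in Hi. destruct Hi as [Hi| ->].
      * apply HS; try assumption. destruct L' as [L'|[L' _]]; [exact L'|].
        apply suc_inj in L'. subst. now apply mem_irrefl in Hi.
      * rewrite (fun_unique Hr L Hb).
        destruct L' as [L'|[_ ->]]; [|exact K].
        apply (fun_bounds Hr) in L'. now destruct (mem_irrefl (suc n)).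
Qed.

Lemma iter_congr S S' n a b :
  (forall i c d, i ∈ n -> S i c d <-> S' i c d) -> iter S n a b -> iter S' n a b.
Proof.
  intros E (h & H1 & H2 & H3 & H4). exists h. repeat (split; [assumption|]).
  intros i c d Hi K L. apply E; auto.
Qed.

Lemma dp_is_fun (t u v : operation V) : dterm t -> dterm u -> dterm v ->
  definable (fun e => is_fun (t e) (u e) (v e)).
Proof.
  apply (dp_app3 (fun x y z => is_fun x y z)).
  eapply dp_iff; [intros e; symmetry; apply is_funE|]. definability.
Qed.

Lemma dp_fun_on (t u : operation V) : dterm t -> dterm u ->
  definable (fun e => fun_on (t e) (u e)).
Proof.
  apply (dp_app2 (fun x y => fun_on x y)). unfold fun_on. definability. apply dp_is_fun; definability.
Qed.

Lemma dp_transitive (t : operation V) : dterm t -> definable (fun e => transitive (t e)).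
Proof. apply (dp_app1 (fun x => transitive x)). unfold transitive. definability. Qed.

Lemma dp_is_ord (t : operation V) : dterm t -> definable (fun e => is_ord (t e)).
Proof. apply (dp_app1 (fun x => is_ord x)). unfold is_ord, transitive. definability. Qed.

End Functions.

Ltac function_definable := lazymatch goal with
  | |- definable (fun e => is_nat _) => apply dp_is_nat
  | |- definable (fun e => is_ord _) => apply dp_is_ord
  | |- definable (fun e => transitive _) => apply dp_transitive
  | |- definable (fun e => is_fun _ _ _) => apply dp_is_fun
  | |- definable (fun e => fun_on _ _) => apply dp_fun_on
end.
Ltac definable_lemma ::= first [set_definable | function_definable].

Section Induction.
Context {V : structure} {HV : @ZF V}.
Implicit Types a b c d f h i j l m p q r s t u v w x y z : V.

(** The union of the iterated unions of the singleton of [x]. *)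
Lemma transitive_superset x : exists t, x ∈ t /\ transitive t.
Proof.
  set (S := fun _ a b : V => b = bigcup a).
  assert (D : definable (fun e => iter S (e 0) (sing x) (e 1))) by (unfold iter, S; definability).
  assert (E : forall n, is_nat n -> forall y y', iter S n (sing x) y ->
    iter S n (sing x) y' -> y = y').
  { apply (nat_induction (fun n => forall y y', iter S n (sing x) y ->
      iter S n (sing x) y' -> y = y')); [unfold iter, S; definability| |].
    - intros y y'. rewrite !iter_emp. congruence.
    - intros n Hn IH y y'. rewrite !iter_suc by exact Hn.
      intros (b & Hb & ->) (b' & Hb' & ->). now rewrite (IH _ _ Hb Hb'). }
  destruct (repl_set (fun n y => iter S n (sing x) y) omega D) as [a Ha].
  { intros n y y' Hn. apply E. now apply in_omega. }
  exists (bigcup a). split.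
  - apply in_bigcup. exists (sing x). split; [|now apply in_sing].
    apply Ha. exists emp. split; [apply in_omega, nat_emp|now apply iter_emp].
  - intros y Hy z Hz. apply in_bigcup in Hy. destruct Hy as (w & Hw & Hy).
    apply Ha in Hw. destruct Hw as (n & Hn & Hw). apply in_omega in Hn.
    apply in_bigcup. exists (bigcup w). split; [|apply in_bigcup; now exists y].
    apply Ha. exists (suc n). split; [apply in_omega, nat_suc, Hn|].
    apply iter_suc; [exact Hn|]. now exists w.
Qed.

(** Foundation, applied to the counterexamples in a transitive superset. *)
Lemma eps_induction (P : V -> Prop) : definable (fun e => P (e 0)) ->
  (forall x, (forall y, y ∈ x -> P y) -> P x) -> forall x, P x.
Proof.
  intros HP H x. destruct (transitive_superset x) as (t & Hx & Ht).
  destruct (sep_set (fun y => ~ P y) t) as [b Hb]; [definability|].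
  apply NNPP. intros N.
  destruct (regularity b) as (y & Hy & K); [exists x; apply Hb; tauto|].
  apply Hb in Hy. destruct Hy as [Hy Ny]. apply Ny, H. intros z Hz.
  apply NNPP. intros Nz. apply (K z Hz), Hb. split; [|exact Nz]. now apply (Ht y).
Qed.

(** ** Ordinals *)

Lemma ord_elem a x : is_ord a -> x ∈ a -> is_ord x.
Proof. intros [H1 H2] Hx. split; [now apply H2|]. intros y Hy. apply H2. now apply (H1 x). Qed.

Lemma ord_trans a x y : is_ord a -> x ∈ a -> y ∈ x -> y ∈ a.
Proof. intros [H _] Hx. now apply H. Qed.

Lemma ord_trichotomy a b : is_ord a -> is_ord b -> a ∈ b \/ a = b \/ b ∈ a.
Proof.
  intros Ha. revert b. revert Ha. pattern a.
  apply eps_induction; [definability|]. clear a. intros a IHa Ha b.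
  pattern b. apply eps_induction; [definability|]. clear b. intros b IHb Hb.
  apply NNPP. intros N. assert (a = b); [|tauto].
  apply ext. intros x. split; intros Hx.
  - destruct (IHa x Hx (ord_elem _ _ Ha Hx) b Hb) as [H|[->|H]]; [exact H|tauto|].
    destruct N. right. right. now apply (ord_trans a x).
  - destruct (IHb x Hx (ord_elem _ _ Hb Hx)) as [H|[E|H]]; [|subst; tauto|exact H].
    destruct N. left. now apply (ord_trans b x).
Qed.

Lemma ord_subset a b : is_ord a -> is_ord b -> ~ b ∈ a -> subset a b.
Proof.
  intros Ha Hb N x Hx.
  destruct (ord_trichotomy a b Ha Hb) as [H|[->|H]]; [|exact Hx|tauto].
  now apply (ord_trans b a).
Qed.

Lemma ord_least (P : V -> Prop) a : definable (fun e => P (e 0)) -> is_ord a -> P a ->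
  exists m, is_ord m /\ P m /\ subset m a /\ forall x, x ∈ m -> ~ P x.
Proof.
  intros HP. pattern a. apply eps_induction; [definability|]. clear a. intros a IH Ha Pa.
  destruct (classic (exists y, y ∈ a /\ P y)) as [(y & Hy & Py)|N].
  - destruct (IH y Hy (ord_elem _ _ Ha Hy) Py) as (m & Hm & Pm & Hs & K).
    exists m. repeat (split; [assumption|]). split; [|exact K].
    intros z Hz. apply (ord_trans a y); auto.
  - exists a. repeat (split; [assumption|]). split; [now intros x|].
    intros x Hx Px. apply N. now exists x.
Qed.

Lemma ord_suc a : is_ord a -> is_ord (suc a).
Proof.
  intros Ha. split.
  - intros x Hx y Hy. apply in_suc in Hx. apply in_suc. left. destruct Hx as [Hx| ->].
    + now apply (ord_trans a x).
    + exact Hy.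
  - intros x Hx. apply in_suc in Hx. destruct Hx as [Hx| ->]; [|exact (proj1 Ha)].
    exact (proj1 (ord_elem _ _ Ha Hx)).
Qed.

Lemma regular_ord r : regular r -> is_ord r.
Proof. intros [[H _] _]. exact H. Qed.

Lemma regular_unbounded r f a b : regular r -> a ∈ r -> is_fun f a r -> 
  exists c, c ∈ r /\ forall x y, op x y ∈ f -> y ∈ c.
Proof.
  intros Hr Ha Hf. assert (O := regular_ord _ Hr).
  destruct Hr as (_ & _ & H). specialize (H a Ha).
  apply NNPP. intros N. apply H. exists f. split; [exact Hf|].
  intros c Hc. apply NNPP. intros K. apply N. exists c. split; [exact Hc|].
  intros x y Hxy. destruct (fun_bounds Hf Hxy) as [Hx Hy].
  destruct (ord_trichotomy y c) as [L|L]; [now apply (ord_elem r)..|exact L|].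
  destruct K. exists x. split; [exact Hx|]. exists y. split; [now apply relE|].
  destruct L as [->|L]; tauto.
Qed.

(** If [r] were the successor of [b], mapping 0 to [b] would be cofinal. *)
Lemma regular_limit r b : regular r -> b ∈ r -> suc b ∈ r.
Proof.
  intros Hr Hb. assert (O := regular_ord _ Hr).
  destruct (ord_trichotomy (suc b) r) as [L|[L|L]]; [apply ord_suc; now apply (ord_elem r)|exact O|exact L| |].
  - assert (H1 : suc emp ∈ r) by (apply Hr, nat_suc, nat_emp).
    destruct (regular_unbounded r (sing (op emp b)) (suc emp) b) as (c & Hc & K); auto.
    + rewrite suc_emp. apply fun_codomain with (sing b); [apply fun_sing|].
      intros y Hy. apply in_sing in Hy. now subst.
    + assert (Hbc : b ∈ c) by (apply (K emp); now apply in_sing).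
      rewrite <- L in Hc. apply in_suc in Hc. exfalso. destruct Hc as [Hc| ->].
      * now apply mem_asym in Hc.
      * now apply mem_irrefl in Hbc.
  - apply in_suc in L. exfalso. destruct L as [L| ->].
    + now apply mem_asym in L.
    + now apply mem_irrefl in Hb.
Qed.

End Induction.

(** * Finite sequences *)

Section SnocCons.
Context {V : structure} {HV : @ZF V}.
Implicit Types a b c d f h i j l m p q r s t u v w x y z : V.

Definition len s : V := setof (fun i => exists y, op i y ∈ s).
(** Stems grow at the end, by [snoc]; passing to the tree of a one-point extension
    removes the first entry, so trees over it are described with [cons]. *)
Definition snoc s x : V := cup s (sing (op (len s) x)).
Definition cons x t : V :=
  setof (fun w => w = op emp x \/ exists i y, op i y ∈ t /\ w = op (suc i) y).

Lemma len_set s : is_set (fun i => exists y, op i y ∈ s).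
Proof.
  apply (bounded_set _ (bigcup (bigcup s))); [definability|]. intros i (y & H).
  apply in_bigcup. exists (sing i). split; [|now apply in_sing].
  apply in_bigcup. exists (op i y). split; [exact H|]. apply in_op. tauto.
Qed.

Lemma in_len i s : i ∈ len s <-> exists y, op i y ∈ s.
Proof. revert i. apply setofP, len_set. Qed.

Lemma cons_set x t :
  is_set (fun w => w = op emp x \/ exists i y, op i y ∈ t /\ w = op (suc i) y).
Proof.
  destruct (repl_set (fun z w => exists i y, z = op i y /\ w = op (suc i) y) t) as [b Hb].
  - definability.
  - intros z w w' _ (i & y & -> & ->) (i' & y' & E & ->). apply op_inj in E.
    now destruct E; subst.
  - apply (bounded_set _ (cup (sing (op emp x)) b)); [definability|].
    intros w [->|(i & y & H & ->)]; apply in_cup; [left; now apply in_sing|right].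
    apply Hb. exists (op i y). split; [exact H|]. now exists i, y.
Qed.

Lemma in_cons w x t : w ∈ cons x t <->
  w = op emp x \/ exists i y, op i y ∈ t /\ w = op (suc i) y.
Proof. revert w. apply setofP, cons_set. Qed.

Lemma in_snoc w s x : w ∈ snoc s x <-> w ∈ s \/ w = op (len s) x.
Proof. unfold snoc. now rewrite in_cup, in_sing. Qed.

Lemma dt_len (t : operation V) : dterm t -> dterm (fun e => len (t e)).
Proof. intros Ht. apply dt_setof; [intros; apply len_set|]. definability. Qed.

Lemma dt_snoc (t u : operation V) : dterm t -> dterm u -> dterm (fun e => snoc (t e) (u e)).
Proof. intros Ht Hu. unfold snoc. definability; now apply dt_len. Qed.

Lemma dt_cons (t u : operation V) : dterm t -> dterm u -> dterm (fun e => cons (t e) (u e)).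
Proof.
  intros Ht Hu. apply dt_setof; [intros; apply cons_set|]. definability.
Qed.

Lemma is_consE u x t : is_cons u x t <-> u = cons x t.
Proof.
  unfold cons. rewrite setof_unique; [|apply cons_set]. unfold is_cons.
  setoid_rewrite is_emptyE. setoid_rewrite is_opairE. setoid_rewrite relE. setoid_rewrite is_succE.
  assert (E : forall w, ((exists z, z = emp /\ w = op z x) \/
      (exists i i' y, op i y ∈ t /\ i' = suc i /\ w = op i' y)) <->
      (w = op emp x \/ exists i y, op i y ∈ t /\ w = op (suc i) y)).
  { intros w. split.
    - intros [(z & -> & ->)|(i & i' & y & H & -> & ->)]; [now left|right; now exists i, y].
    - intros [->|(i & y & H & ->)]; [left; now exists emp|right; now exists i, (suc i), y]. }
  setoid_rewrite E. reflexivity.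
Qed.

Lemma op_in_cons_emp x t y : op emp y ∈ cons x t <-> y = x.
Proof.
  rewrite in_cons. split; [|intros ->; tauto].
  intros [H|(i & z & _ & H)]; apply op_inj in H; [tauto|]. destruct H as [H _].
  exfalso. apply (in_emp i). rewrite H. apply in_suc. tauto.
Qed.

Lemma op_in_cons_suc x t i y : op (suc i) y ∈ cons x t <-> op i y ∈ t.
Proof.
  rewrite in_cons. split.
  - intros [H|(j & z & K & H)]; apply op_inj in H; destruct H as [H ->].
    + exfalso. apply (in_emp i). rewrite <- H. apply in_suc. tauto.
    + now apply suc_inj in H; subst.
  - intros H. right. now exists i, y.
Qed.

Lemma fun_len s a b : is_fun s a b -> len s = a.
Proof.
  intros H. apply ext. intros i. rewrite in_len. split.
  - intros (y & K). now apply (fun_bounds H) in K.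
  - exact (fun_total i H).
Qed.

End SnocCons.

Section Sequences.
Context {V : structure} {HV : @ZF V} (X : V).
Implicit Types a b c d f h i j l m p q r s t u v w x y z : V.

Local Notation seq := (is_seq X).

Lemma dp_is_seq (t : operation V) : dterm t -> definable (fun e => is_seq X (t e)).
Proof. apply (dp_app1 (fun x => is_seq X x)). unfold is_seq. definability. Qed.

Lemma seq_len s : seq s -> is_nat (len s) /\ is_fun s (len s) X.
Proof. intros (n & Hn & H). now rewrite (fun_len _ _ _ H). Qed.

Lemma len_emp : @len V HV emp = emp.
Proof.
  apply ext. intros i. rewrite in_len. split; [intros (y & H)|intros H]; now apply in_emp in H.
Qed.

Lemma seq_emp : seq emp.
Proof.
  exists emp. split; [apply nat_emp|]. apply is_funE. split; [|split].
  - intros z H. now apply in_emp in H.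
  - intros z H. now apply in_emp in H.
  - intros x y y' H. now apply in_emp in H.
Qed.

Lemma seq_elem s w : seq s -> w ∈ s -> exists i y, i ∈ len s /\ y ∈ X /\ w = op i y.
Proof. intros H. apply seq_len in H as [_ H]. apply is_funE in H. apply H. Qed.

Lemma seq_snoc_fun s x : seq s -> x ∈ X -> is_fun (snoc s x) (suc (len s)) X.
Proof.
  intros Hs Hx. apply fun_codomain with (cup X (sing x)).
  - apply fun_extend; [now apply seq_len|apply mem_irrefl].
  - intros y Hy. apply in_cup in Hy. rewrite in_sing in Hy. destruct Hy; now subst.
Qed.

Lemma seq_snoc s x : seq s -> x ∈ X -> seq (snoc s x).
Proof.
  intros Hs Hx. exists (suc (len s)). split; [|now apply seq_snoc_fun].
  apply nat_suc. now apply seq_len.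
Qed.

Lemma len_snoc s x : seq s -> x ∈ X -> len (snoc s x) = suc (len s).
Proof. intros Hs Hx. apply (fun_len _ _ X). now apply seq_snoc_fun. Qed.

Lemma snoc_new s y : seq s -> ~ op (len s) y ∈ s.
Proof.
  intros Hs H. destruct (seq_len _ Hs) as [_ Hf].
  apply (fun_bounds Hf) in H. now apply (mem_irrefl (len s)).
Qed.

Lemma is_snocE u s x : seq s -> (is_snoc u s x <-> u = snoc s x).
Proof.
  intros Hs. destruct (seq_len _ Hs) as [Hn Hf]. split.
  - intros (n & _ & [c Hc] & H). apply ext. intros w.
    rewrite H, in_snoc, is_opairE, (fun_len _ _ _ Hc). tauto.
  - intros ->. exists (len s). split; [exact Hn|]. split; [now exists X|].
    intros w. rewrite in_snoc, is_opairE. tauto.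
Qed.

Lemma snoc_value s x y : seq s -> x ∈ X -> op (len s) y ∈ snoc s x -> y = x.
Proof.
  intros Hs Hx H. apply in_snoc in H. destruct H as [H|H].
  - now apply snoc_new in H.
  - now apply op_inj in H.
Qed.

Lemma snoc_seq_val s x : seq s -> seq (snoc s x) -> x ∈ X.
Proof.
  intros Hs H. assert (K : op (len s) x ∈ snoc s x) by (apply in_snoc; tauto).
  destruct (seq_len _ H) as [_ Hf]. now apply (fun_bounds Hf) in K.
Qed.

Lemma seq_induction (P : V -> Prop) : definable (fun e => P (e 0)) -> P emp ->
  (forall s x, seq s -> x ∈ X -> P s -> P (snoc s x)) -> forall s, seq s -> P s.
Proof.
  intros HP H0 HS s (n & Hn & Hs). revert s Hs. pattern n.
  apply nat_induction; [definability| | |exact Hn].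
  - intros s Hs. replace s with (@emp V HV); [exact H0|]. apply ext. intros w.
    split; intros H; [now apply in_emp in H|]. apply is_funE in Hs.
    destruct (proj1 Hs w H) as (x & y & K & _). now apply in_emp in K.
  - clear n Hn. intros n Hn IH s Hs.
    destruct (fun_of_rel (fun i y => op i y ∈ s) n X) as (r & Fr & E).
    { definability. }
    { intros i Hi. destruct (fun_total i Hs) as [y Hy]; [apply in_suc; tauto|].
      exists y. split; [now apply (fun_bounds Hs) in Hy|exact Hy]. }
    { intros i y y' _. apply (fun_unique Hs). }
    destruct (fun_total n Hs) as [x Hx]; [apply in_suc; tauto|].
    replace s with (snoc r x).
    + apply HS; [now exists n| |now apply IH]. now apply (fun_bounds Hs) in Hx.
    + apply ext. intros w. rewrite in_snoc, (fun_len _ _ _ Fr). split.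
      * intros [H| ->]; [|exact Hx]. assert (F := Fr). apply is_funE in F.
        destruct (proj1 F w H) as (i & y & _ & _ & ->). now apply E in H.
      * intros H. assert (F := Hs). apply is_funE in F.
        destruct (proj1 F w H) as (i & y & Hi & _ & ->). apply in_suc in Hi.
        destruct Hi as [Hi| ->]; [left; now apply E|right].
        now rewrite (fun_unique Hs H Hx).
Qed.

(** ** Prefixing *)

Lemma len_cons x t : seq t -> len (cons x t) = suc (len t).
Proof.
  intros Ht. destruct (seq_len _ Ht) as [Hn Hf]. apply ext. intros i. rewrite in_len. split.
  - intros (y & H). apply in_cons in H. destruct H as [H|(j & z & K & H)];
      apply op_inj in H; destruct H as [-> ->].
    + now apply emp_in_suc.
    + apply suc_in_suc; [exact Hn|]. now apply (fun_bounds Hf) in K.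
  - intros H. assert (Hi : is_nat i) by (apply (nat_elem (suc (len t))); [now apply nat_suc|exact H]).
    destruct (nat_cases _ Hi) as [->|(j & Hj & ->)].
    + exists x. now apply op_in_cons_emp.
    + apply in_suc in H. assert (K : j ∈ len t).
      { destruct H as [H|H].
        - apply (nat_transitive (len t) Hn (suc j)); [exact H|]. apply in_suc. tauto.
        - rewrite <- H. apply in_suc. tauto. }
      destruct (fun_total _ Hf K) as [y Hy]. exists y. now apply op_in_cons_suc.
Qed.

Lemma cons_emp x : cons x emp = snoc emp x.
Proof.
  apply ext. intros w. rewrite in_cons, in_snoc, len_emp. split.
  - intros [->|(i & y & H & _)]; [tauto|now apply in_emp in H].
  - intros [H| ->]; [now apply in_emp in H|tauto].
Qed.

Lemma cons_snoc x t y : seq t -> cons x (snoc t y) = snoc (cons x t) y.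
Proof.
  intros Ht. apply ext. intros w. rewrite in_snoc, !in_cons, len_cons by exact Ht. split.
  - intros [H|(i & z & H & ->)]; [tauto|]. apply in_snoc in H.
    destruct H as [H|H]; [left; right; now exists i, z|right].
    apply op_inj in H. destruct H; now subst.
  - intros [[H|(i & z & H & ->)]| ->]; [tauto| |]; right.
    + exists i, z. split; [apply in_snoc; tauto|reflexivity].
    + exists (len t), y. split; [apply in_snoc; tauto|reflexivity].
Qed.

Lemma seq_cons x t : x ∈ X -> seq t -> seq (cons x t).
Proof.
  intros Hx Ht. pattern t. apply seq_induction; [| | |exact Ht].
  - apply dp_is_seq. apply dt_cons; definability.
  - rewrite cons_emp. apply seq_snoc; [apply seq_emp|exact Hx].
  - intros s y Hs Hy IH. rewrite cons_snoc by exact Hs. now apply seq_snoc.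
Qed.

Lemma cons_inj x t y u : seq t -> seq u -> cons x t = cons y u -> x = y /\ t = u.
Proof.
  intros Ht Hu E. split.
  - apply (op_in_cons_emp y u). rewrite <- E. now apply op_in_cons_emp.
  - apply ext. intros w. split; intros H.
    + destruct (seq_elem _ _ Ht H) as (i & z & _ & _ & ->).
      apply (op_in_cons_suc y). rewrite <- E. now apply op_in_cons_suc.
    + destruct (seq_elem _ _ Hu H) as (i & z & _ & _ & ->).
      apply (op_in_cons_suc x). rewrite E. now apply op_in_cons_suc.
Qed.

Lemma seq_cases t : seq t -> t = emp \/ exists x r, x ∈ X /\ seq r /\ t = cons x r.
Proof.
  intros Ht. pattern t. apply seq_induction; [| | |exact Ht].
  - definability; try apply dp_is_seq; try apply dt_cons; definability.
  - tauto.
  - intros s y Hs Hy [->|(x & r & Hx & Hr & ->)]; right.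
    + exists y, emp. split; [exact Hy|]. split; [apply seq_emp|]. now rewrite cons_emp.
    + exists x, (snoc r y). split; [exact Hx|]. split; [now apply seq_snoc|].
      now rewrite cons_snoc.
Qed.

(** ** Concatenation *)

Definition cat_rel s t u :=
  seq t /\ iter (fun i a b => exists x, op i x ∈ t /\ b = snoc a x) (len t) s u.

Lemma cat_rel_emp s u : cat_rel s emp u <-> u = s.
Proof.
  unfold cat_rel. rewrite len_emp, iter_emp. split; [intros [_ H]; now symmetry|].
  intros ->. split; [apply seq_emp|reflexivity].
Qed.

Lemma cat_rel_snoc s t x u : seq t -> x ∈ X ->
  (cat_rel s (snoc t x) u <-> exists v, cat_rel s t v /\ u = snoc v x).
Proof.
  intros Ht Hx. unfold cat_rel. rewrite len_snoc, iter_suc; try assumption; [|now apply seq_len].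
  assert (N : forall i y, i ∈ len t -> op i y ∈ snoc t x <-> op i y ∈ t).
  { intros i y Hi. rewrite in_snoc. split; [|tauto]. intros [H|H]; [exact H|].
    apply op_inj in H. destruct H; subst. now apply mem_irrefl in Hi. }
  split.
  - intros (_ & v & Hv & y & Hy & ->). apply snoc_value in Hy; try assumption. subst y.
    exists v. split; [|reflexivity]. split; [exact Ht|].
    revert Hv. apply iter_congr. intros i a b Hi.
    split; intros (y & Hy & ->); exists y; (split; [now apply N|reflexivity]).
  - intros (v & (_ & Hv) & ->). split; [now apply seq_snoc|]. exists v. split.
    + revert Hv. apply iter_congr. intros i a b Hi.
      split; intros (y & Hy & ->); exists y; (split; [now apply N|reflexivity]).
    + exists x. split; [apply in_snoc; tauto|reflexivity].
Qed.

Lemma dp_cat_rel (s t u : operation V) : dterm s -> dterm t -> dterm u ->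
  definable (fun e => cat_rel (s e) (t e) (u e)).
Proof.
  apply (dp_app3 (fun x y z => cat_rel x y z)). unfold cat_rel, iter.
  repeat first [progress definability|apply dp_is_seq|apply dt_len|apply dt_snoc].
Qed.

Lemma cat_rel_total s t : seq t -> exists u, cat_rel s t u.
Proof.
  intros Ht. pattern t. apply seq_induction; [| | |exact Ht].
  - definability. apply dp_cat_rel; definability.
  - exists s. now apply cat_rel_emp.
  - intros r x Hr Hx (u & Hu). exists (snoc u x). apply cat_rel_snoc; try assumption.
    now exists u.
Qed.

Lemma cat_rel_unique s t u u' : cat_rel s t u -> cat_rel s t u' -> u = u'.
Proof.
  intros H. assert (Ht := proj1 H). revert u u' H. pattern t.
  apply seq_induction; [| | |exact Ht].
  - definability; apply dp_cat_rel; definability.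
  - intros u u'. rewrite !cat_rel_emp. congruence.
  - intros r x Hr Hx IH u u'. rewrite !cat_rel_snoc by assumption.
    intros (v & Hv & ->) (v' & Hv' & ->). now rewrite (IH v v').
Qed.

(** The union of the singleton of the result: this form is total and definable. *)
Definition concat s t : V := bigcup (setof (fun u => cat_rel s t u)).

Lemma cat_rel_set s t : is_set (fun u => cat_rel s t u).
Proof.
  destruct (classic (exists u, cat_rel s t u)) as [(u & H)|N].
  - apply (bounded_set _ (sing u)); [apply dp_cat_rel; definability|].
    intros v Hv. apply in_sing. now apply (cat_rel_unique s t).
  - apply (bounded_set _ emp); [apply dp_cat_rel; definability|].
    intros v Hv. destruct N. now exists v.
Qed.

Lemma dt_concat (s t : operation V) : dterm s -> dterm t -> dterm (fun e => concat (s e) (t e)).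
Proof.
  intros Hs Ht. unfold concat. apply dt_bigcup. apply dt_setof; [intros; apply cat_rel_set|].
  apply dp_cat_rel; definability.
Qed.

Lemma concat_spec s t u : cat_rel s t u -> concat s t = u.
Proof.
  intros H. unfold concat. apply ext. intros w. rewrite in_bigcup. split.
  - intros (y & Hy & Hw). apply (setofP _ (cat_rel_set s t)) in Hy.
    now rewrite (cat_rel_unique _ _ _ _ H Hy).
  - intros Hw. exists u. split; [|exact Hw]. exact (proj2 (setofP _ (cat_rel_set s t) u) H).
Qed.

Lemma concat_emp s : concat s emp = s.
Proof. apply concat_spec. now apply cat_rel_emp. Qed.

Lemma concat_snoc s t x : seq t -> x ∈ X -> concat s (snoc t x) = snoc (concat s t) x.
Proof.
  intros Ht Hx. destruct (cat_rel_total s t Ht) as [u Hu]. rewrite (concat_spec _ _ _ Hu).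
  apply concat_spec. apply cat_rel_snoc; try assumption. now exists u.
Qed.

End Sequences.

Ltac sequence_definable := lazymatch goal with
  | |- dterm (fun e => len _) => apply dt_len
  | |- dterm (fun e => snoc _ _) => apply dt_snoc
  | |- dterm (fun e => cons _ _) => apply dt_cons
  | |- dterm (fun e => concat _ _ _) => apply dt_concat
  | |- definable (fun e => is_seq _ _) => apply dp_is_seq
end.
Ltac definable_lemma ::= first [set_definable | function_definable | sequence_definable].

Section Concatenation.
Context {V : structure} {HV : @ZF V} (X : V).
Implicit Types a b c d f h i j l m p q r s t u v w x y z : V.

Local Notation seq := (is_seq X).
Local Notation concat := (concat X).

Lemma concat_seq s t : seq s -> seq t -> seq (concat s t).
Proof.
  intros Hs Ht. pattern t. apply (seq_induction X); [definability| | |exact Ht].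
  - now rewrite concat_emp.
  - intros r x Hr Hx IH. rewrite concat_snoc by assumption. now apply seq_snoc.
Qed.

Lemma concat_emp_l t : seq t -> concat emp t = t.
Proof.
  intros Ht. pattern t. apply (seq_induction X); [definability| | |exact Ht].
  - now rewrite concat_emp.
  - intros r x Hr Hx IH. rewrite concat_snoc by assumption. now rewrite IH.
Qed.

Lemma concat_assoc s t r : seq t -> seq r -> concat s (concat t r) = concat (concat s t) r.
Proof.
  intros Ht Hr. pattern r. apply (seq_induction X); [definability| | |exact Hr].
  - now rewrite !concat_emp.
  - intros v x Hv Hx IH. rewrite !concat_snoc; try assumption; [|now apply concat_seq].
    now rewrite IH.
Qed.

Lemma concat_cons s x t : x ∈ X -> seq t -> concat s (cons x t) = concat (snoc s x) t.
Proof.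
  intros Hx Ht. pattern t. apply (seq_induction X); [definability| | |exact Ht].
  - rewrite cons_emp, concat_snoc, !concat_emp; [reflexivity|apply seq_emp|exact Hx].
  - intros v y Hv Hy IH. rewrite (cons_snoc X), !concat_snoc; try assumption.
    + now rewrite IH.
    + now apply seq_cons.
Qed.

Lemma subset_snoc s t x : seq s -> seq t -> x ∈ X -> subset s (snoc t x) ->
  subset s t \/ s = snoc t x.
Proof.
  intros Hs Ht Hx H.
  destruct (seq_len _ _ Hs) as [Hn Fs]. destruct (seq_len _ _ Ht) as [Hm Ft].
  destruct (classic (op (len t) x ∈ s)) as [K|K].
  - right. apply ext. intros w. split; [apply H|]. intros Hw. apply in_snoc in Hw.
    destruct Hw as [Hw| ->]; [|exact K].
    destruct (seq_elem _ _ _ Ht Hw) as (i & y & Hi & _ & ->).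
    destruct (fun_total i Fs) as [y' Hy'].
    { apply (fun_bounds Fs) in K. apply (nat_transitive _ Hn (len t)); tauto. }
    assert (L := H _ Hy'). apply in_snoc in L. destruct L as [L|L].
    + now rewrite (fun_unique Ft Hw L).
    + apply op_inj in L. destruct L; subst. now apply mem_irrefl in Hi.
  - left. intros w Hw. assert (L := H _ Hw). apply in_snoc in L.
    destruct L as [L| ->]; [exact L|]. tauto.
Qed.

Lemma subset_emp s : subset s emp -> s = emp.
Proof.
  intros H. apply ext. intros w. split; [apply H|]. intros K. now apply in_emp in K.
Qed.

End Concatenation.

(** * The tree Prikry ordering *)

Section BasicPredicates.
Context {V : structure} {HV : @ZF V}.
Implicit Types a b c d f h i j l m p q r s t u v w x y z : V.

Lemma dp_is_opair (t u v : operation V) : dterm t -> dterm u -> dterm v ->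
  definable (fun e => is_opair (t e) (u e) (v e)).
Proof.
  intros. apply (dp_iff (fun e => t e = op (u e) (v e))); [|definability].
  intros e. now rewrite is_opairE.
Qed.

Lemma dp_is_cons (t u v : operation V) : dterm t -> dterm u -> dterm v ->
  definable (fun e => is_cons (t e) (u e) (v e)).
Proof.
  intros. apply (dp_iff (fun e => t e = cons (u e) (v e))); [|definability].
  intros e. now rewrite is_consE.
Qed.

Lemma dp_is_succ (t u : operation V) : dterm t -> dterm u ->
  definable (fun e => is_succ (t e) (u e)).
Proof.
  intros. apply (dp_iff (fun e => t e = suc (u e))); [|definability].
  intros e. now rewrite is_succE.
Qed.

Lemma dp_is_empty (t : operation V) : dterm t -> definable (fun e => is_empty (t e)).
Proof.
  intros. apply (dp_iff (fun e => t e = emp)); [|definability].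
  intros e. now rewrite is_emptyE.
Qed.

Lemma dp_rel (t u v : operation V) : dterm t -> dterm u -> dterm v ->
  definable (fun e => rel (t e) (u e) (v e)).
Proof.
  intros. apply (dp_iff (fun e => op (u e) (v e) ∈ t e)); [|definability].
  intros e. now rewrite relE.
Qed.

Definition cap a b : V := setof (fun x => x ∈ a /\ x ∈ b).

Lemma cap_set a b : is_set (fun x => x ∈ a /\ x ∈ b).
Proof. apply sep_set. definability. Qed.

Lemma in_cap x a b : x ∈ cap a b <-> x ∈ a /\ x ∈ b.
Proof. revert x. apply setofP, cap_set. Qed.

Lemma dt_cap (t u : operation V) : dterm t -> dterm u -> dterm (fun e => cap (t e) (u e)).
Proof. intros Ht Hu. apply dt_setof; [intros; apply cap_set|]. definability. Qed.

End BasicPredicates.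

Ltac predicate_definable := lazymatch goal with
  | |- dterm (fun e => cap _ _) => apply dt_cap
  | |- definable (fun e => is_opair _ _ _) => apply dp_is_opair
  | |- definable (fun e => is_cons _ _ _) => apply dp_is_cons
  | |- definable (fun e => is_succ _ _) => apply dp_is_succ
  | |- definable (fun e => is_empty _) => apply dp_is_empty
  | |- definable (fun e => rel _ _ _) => apply dp_rel
end.
Ltac definable_lemma ::= first [set_definable | function_definable | sequence_definable | predicate_definable].

Section Order.
Context {V : structure} {HV : @ZF V} (X U : V) (HU : ultrafilter U X).
Implicit Types a b c d f h i j l m p q r s t u v w x y z T : V.

Local Notation seq := (is_seq X).
Local Notation concat := (concat X).
Local Notation large := (large_tree X U).
Local Notation cond := (tp_cond X U).
Local Notation le := (tp_le X U).

Lemma U_subset a x : a ∈ U -> x ∈ a -> x ∈ X.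
Proof. destruct HU as (_ & H & _). intros Ha. now apply H. Qed.

Lemma U_inhabited a : a ∈ U -> exists x, x ∈ a.
Proof. apply HU. Qed.

Lemma U_up a b : a ∈ U -> subset a b -> subset b X -> b ∈ U.
Proof. destruct HU as (_ & _ & _ & H & _). apply H. Qed.

Lemma U_cap a b : a ∈ U -> b ∈ U -> cap a b ∈ U.
Proof.
  destruct HU as (_ & _ & _ & _ & H & _). intros Ha Hb. apply (H a b); try assumption.
  intros x. apply in_cap.
Qed.

Lemma U_split (P : V -> Prop) : definable (fun e => P (e 0)) ->
  exists a, a ∈ U /\ ((forall x, x ∈ a <-> x ∈ X /\ P x) \/ (forall x, x ∈ a <-> x ∈ X /\ ~ P x)).
Proof.
  intros HP. destruct (sep_set P X HP) as [a Ha].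
  destruct (sep_set (fun x => ~ P x) X) as [b Hb]; [now apply dp_not|].
  destruct HU as (_ & _ & _ & _ & _ & H). destruct (H a b) as [K|K].
  - intros x Hx. now apply Ha.
  - intros x. rewrite Hb, Ha. tauto.
  - exists a. tauto.
  - exists b. tauto.
Qed.

Lemma dp_large (t : operation V) : dterm t -> definable (fun e => large (t e)).
Proof. apply (dp_app1 (fun x => large x)). unfold large_tree, is_snoc. definability. Qed.

Lemma dp_cond (t : operation V) : dterm t -> definable (fun e => cond (t e)).
Proof. apply (dp_app1 (fun x => cond x)). unfold tp_cond. definability; apply dp_large; definability. Qed.

Lemma dp_tp_step (t u : operation V) : dterm t -> dterm u ->
  definable (fun e => tp_step X U (t e) (u e)).
Proof.
  apply (dp_app2 (fun x y => tp_step X U x y)).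
  unfold tp_step, direct_extension, one_point_extension, is_snoc.
  definability; apply dp_cond; definability.
Qed.

(** Closure under initial segments only has to be checked one step at a time, and it
    is enough that the set of successors contains a member of [U]. *)
Lemma large_intro T :
  (forall t, t ∈ T -> seq t) ->
  (forall t x, seq t -> x ∈ X -> snoc t x ∈ T -> t ∈ T) ->
  emp ∈ T ->
  (forall t, t ∈ T -> exists a, a ∈ U /\ forall x, x ∈ a -> snoc t x ∈ T) ->
  large T.
Proof.
  intros H1 H2 H3 H4. split; [exact H1|]. split; [|split].
  - intros t s Ht. assert (Hst := H1 _ Ht). revert s. revert Ht. pattern t.
    apply (seq_induction X); [definability| | |exact Hst].
    + intros _ s _ Hs. now rewrite (subset_emp _ Hs).
    + clear t Hst. intros t x Hst Hx IH Ht s Hs K.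
      destruct (subset_snoc _ _ _ _ Hs Hst Hx K) as [L| ->]; [|exact Ht].
      apply IH; try assumption. now apply (H2 t x).
  - exists emp. split; [now apply is_emptyE|exact H3].
  - intros t Ht. destruct (H4 t Ht) as (a & Ha & K).
    destruct (sep_set (fun x => snoc t x ∈ T) X) as [b Hb]; [definability|].
    exists b. split.
    + apply (U_up a); [exact Ha| |].
      * intros x Hx. apply Hb. split; [now apply (U_subset a)|auto].
      * intros x Hx. now apply Hb in Hx.
    + intros x. rewrite Hb. split.
      * intros [Hx L]. exists (snoc t x). split; [exact L|]. apply (is_snocE X); auto.
      * intros (u & Hu & L). apply (is_snocE X) in L; [|auto]. subst u.
        split; [|exact Hu]. apply (snoc_seq_val X t); auto.
Qed.

Lemma large_seq T t : large T -> t ∈ T -> seq t.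
Proof. intros H. apply H. Qed.

Lemma large_emp T : large T -> emp ∈ T.
Proof. intros (_ & _ & (z & Hz & K) & _). apply is_emptyE in Hz. now subst. Qed.

Lemma large_prefix T t s : large T -> t ∈ T -> seq s -> subset s t -> s ∈ T.
Proof. intros (_ & H & _) Ht. now apply H. Qed.

Lemma large_snoc T t x : large T -> seq t -> snoc t x ∈ T -> t ∈ T.
Proof.
  intros H Ht K. apply (large_prefix T (snoc t x)); try assumption.
  intros w Hw. apply in_snoc. tauto.
Qed.

Lemma large_snoc_val T t x : large T -> t ∈ T -> snoc t x ∈ T -> x ∈ X.
Proof. intros H Ht K. apply (snoc_seq_val X t); now apply (large_seq T). Qed.

Lemma large_succ T t : large T -> t ∈ T ->
  exists a, a ∈ U /\ forall x, x ∈ a <-> x ∈ X /\ snoc t x ∈ T.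
Proof.
  intros H Ht. assert (K := H). destruct K as (_ & _ & _ & K).
  destruct (K t Ht) as (a & Ha & L). exists a. split; [exact Ha|].
  assert (Hst := large_seq _ _ H Ht).
  intros x. rewrite L. split.
  - intros (u & Hu & E). apply (is_snocE X) in E; [|exact Hst]. subst u.
    split; [now apply (large_snoc_val T t)|exact Hu].
  - intros (_ & Hu). exists (snoc t x). split; [exact Hu|]. now apply (is_snocE X).
Qed.

Lemma large_cap T T' : large T -> large T' -> large (cap T T').
Proof.
  intros H H'. apply large_intro.
  - intros t Ht. apply in_cap in Ht. now apply (large_seq T).
  - intros t x Ht Hx K. apply in_cap in K. apply in_cap.
    split; [apply (large_snoc T t x)|apply (large_snoc T' t x)]; tauto.
  - apply in_cap. split; now apply large_emp.
  - intros t Ht. apply in_cap in Ht. destruct Ht as [Ht Ht'].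
    destruct (large_succ T t H Ht) as (a & Ha & K).
    destruct (large_succ T' t H' Ht') as (b & Hb & K').
    exists (cap a b). split; [now apply U_cap|]. intros x Hx. apply in_cap in Hx.
    apply in_cap. rewrite K, K' in Hx. tauto.
Qed.

Definition seqs : V := setof (is_seq X).

Lemma in_seqs t : t ∈ seqs <-> seq t.
Proof.
  revert t. apply setofP. apply (bounded_set _ (pow (times omega X))); [definability|].
  intros t Ht. apply in_pow. intros w Hw.
  destruct (seq_elem _ _ _ Ht Hw) as (i & y & Hi & Hy & ->).
  apply op_in_times. split; [|exact Hy]. apply in_omega.
  apply (nat_elem (len t)); [|exact Hi]. now apply (seq_len X).
Qed.

Lemma large_seqs : large seqs.
Proof.
  apply large_intro.
  - intros t. apply in_seqs.
  - intros t x Ht _ _. now apply in_seqs.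
  - apply in_seqs, seq_emp.
  - intros t Ht. exists X. split; [apply HU|]. intros x Hx. apply in_seqs.
    apply seq_snoc; [now apply in_seqs|exact Hx].
Qed.

Definition subtree T t : V := setof (fun r => seq r /\ concat t r ∈ T).

Lemma in_subtree r T t : r ∈ subtree T t <-> seq r /\ concat t r ∈ T.
Proof.
  revert r. apply setofP. apply (bounded_set _ seqs); [definability|].
  intros r [Hr _]. now apply in_seqs.
Qed.

Lemma dt_subtree (t u : operation V) : dterm t -> dterm u -> dterm (fun e => subtree (t e) (u e)).
Proof.
  intros Ht Hu. apply dt_setof; [|definability].
  intros e. apply (bounded_set _ seqs); [definability|]. intros r [Hr _]. now apply in_seqs.
Qed.

Lemma subtree_emp T : large T -> subtree T emp = T.
Proof.
  intros H. apply ext. intros r. rewrite in_subtree. split.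
  - intros [Hr K]. now rewrite (concat_emp_l X) in K.
  - intros Hr. assert (Hs := large_seq _ _ H Hr). now rewrite (concat_emp_l X).
Qed.

Lemma large_subtree T t : large T -> t ∈ T -> large (subtree T t).
Proof.
  intros H Ht. assert (Hst := large_seq _ _ H Ht). apply large_intro.
  - intros r Hr. now apply in_subtree in Hr.
  - intros r x Hr Hx K. apply in_subtree in K. destruct K as [_ K].
    rewrite concat_snoc in K by assumption. apply in_subtree. split; [exact Hr|].
    apply (large_snoc T _ x); try assumption. now apply concat_seq.
  - apply in_subtree. rewrite concat_emp. split; [apply seq_emp|exact Ht].
  - intros r Hr. apply in_subtree in Hr. destruct Hr as [Hr K].
    destruct (large_succ T _ H K) as (a & Ha & L). exists a. split; [exact Ha|].
    intros x Hx. apply L in Hx. destruct Hx as [Hx Hx']. apply in_subtree.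
    split; [now apply seq_snoc|]. now rewrite concat_snoc.
Qed.

Lemma cond_op s T : cond (op s T) <-> seq s /\ large T.
Proof.
  split.
  - intros (s' & T' & E & H). apply is_opairE in E. apply op_inj in E as [-> ->]. exact H.
  - intros H. exists s, T. split; [now apply is_opairE|exact H].
Qed.

Lemma cond_inv p : cond p -> exists s T, p = op s T /\ seq s /\ large T.
Proof. intros (s & T & E & H). apply is_opairE in E. now exists s, T. Qed.

Lemma tp_le_iter q p : le q p <->
  cond p /\ cond q /\ exists n, is_nat n /\ iter (fun _ a b => tp_step X U b a) n p q.
Proof.
  unfold tp_le, iter. setoid_rewrite relE. setoid_rewrite is_succE. setoid_rewrite is_emptyE.
  split; intros (Hp & Hq & K); split; try assumption; (split; [assumption|]).
  - destruct K as (n & m & f & Hn & -> & Hf & H0 & H1 & H2).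
    exists n. split; [exact Hn|]. exists f. eauto 8.
  - destruct K as (n & Hn & f & Hf & H0 & H1 & H2).
    exists n, (suc n), f. split; [exact Hn|]. split; [reflexivity|]. split; [exact Hf|].
    split; [now intros z ->|]. split; [exact H1|]. intros k k' a b Hk ->. now apply H2.
Qed.

(** The effect of any number of steps: follow a branch [t] of the tree, then shrink
    what is left of the tree. *)
Definition below q p := cond p /\ cond q /\
  exists s T s' T' t, p = op s T /\ q = op s' T' /\ t ∈ T /\ s' = concat s t /\
    forall r, r ∈ T' -> concat t r ∈ T.

Lemma dp_below (t u : operation V) : dterm t -> dterm u -> definable (fun e => below (t e) (u e)).
Proof.
  apply (dp_app2 (fun x y => below x y)). unfold below. definability; apply dp_cond; definability.
Qed.

Lemma below_op s T s' T' : below (op s' T') (op s T) <->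
  seq s /\ large T /\ seq s' /\ large T' /\
  exists t, t ∈ T /\ s' = concat s t /\ forall r, r ∈ T' -> concat t r ∈ T.
Proof.
  unfold below. rewrite !cond_op. split.
  - intros ((H1 & H2) & (H3 & H4) & s0 & T0 & s1 & T1 & t & E & E' & K).
    apply op_inj in E as [-> ->]. apply op_inj in E' as [-> ->].
    repeat (split; [assumption|]). now exists t.
  - intros (H1 & H2 & H3 & H4 & t & K). split; [now split|]. split; [now split|].
    exists s, T, s', T', t. tauto.
Qed.

Lemma below_refl p : cond p -> below p p.
Proof.
  intros H. destruct (cond_inv _ H) as (s & T & -> & Hs & HT). apply below_op.
  repeat (split; [assumption|]). exists emp. split; [now apply large_emp|].
  rewrite concat_emp. split; [reflexivity|]. intros r Hr.
  rewrite (concat_emp_l X); [exact Hr|]. now apply (large_seq T).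
Qed.

Lemma below_trans p q r : below q p -> below r q -> below r p.
Proof.
  intros H K. destruct (cond_inv _ (proj1 H)) as (s & T & -> & Hs & HT).
  destruct (cond_inv _ (proj1 (proj2 H))) as (s' & T' & -> & Hs' & HT').
  destruct (cond_inv _ (proj1 (proj2 K))) as (s'' & T'' & -> & Hs'' & HT'').
  apply below_op in H, K.
  destruct H as (_ & _ & _ & _ & t & Ht & -> & L).
  destruct K as (_ & _ & _ & _ & t' & Ht' & -> & L').
  assert (St := large_seq _ _ HT Ht). assert (St' := large_seq _ _ HT' Ht').
  apply below_op. repeat (split; [assumption|]). exists (concat t t').
  split; [now apply L|]. split; [symmetry; now apply concat_assoc|].
  intros v Hv. assert (Sv := large_seq _ _ HT'' Hv).
  rewrite <- (concat_assoc X) by assumption. now apply L, L'.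
Qed.

Lemma below_step q p : tp_step X U q p -> below q p.
Proof.
  intros (Hp & Hq & [H|H]).
  - destruct H as (s & T & T' & E & E' & K). apply is_opairE in E, E'. subst.
    apply cond_op in Hp as [Hs HT]. apply cond_op in Hq as [_ HT'].
    apply below_op. repeat (split; [assumption|]). exists emp.
    split; [now apply large_emp|]. rewrite concat_emp. split; [reflexivity|].
    intros r Hr. rewrite (concat_emp_l X); [now apply K|]. now apply (large_seq T').
  - destruct H as (s & T & s' & T' & x & E & E' & (z & u & Hz & Hu & Ez) & Es & K).
    apply is_opairE in E, E'. subst.
    apply cond_op in Hp as [Hs HT]. apply cond_op in Hq as [Hs' HT'].
    apply is_emptyE in Hz. subst z. apply (is_snocE X) in Ez; [|apply seq_emp]. subst u.
    apply (is_snocE X) in Es; [|exact Hs]. subst s'.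
    assert (Hx : x ∈ X) by (apply (snoc_seq_val X s); assumption).
    apply below_op. repeat (split; [assumption|]). exists (snoc emp x).
    split; [exact Hu|]. split; [rewrite concat_snoc, concat_emp; auto using seq_emp|].
    intros r Hr. apply K in Hr. destruct Hr as (Sr & u & Hu' & E).
    apply is_consE in E. subst u.
    rewrite <- (concat_cons X), (concat_emp_l X); try assumption. now apply seq_cons.
Qed.

Lemma tp_step_one_point s T x : seq s -> large T -> snoc emp x ∈ T ->
  tp_step X U (op (snoc s x) (subtree T (snoc emp x))) (op s T).
Proof.
  intros Hs HT Hx. assert (Hxx : x ∈ X) by (apply (large_snoc_val T emp); auto using large_emp).
  split; [now apply cond_op|]. split.
  - apply cond_op. split; [now apply seq_snoc|now apply large_subtree].
  - right. exists s, T, (snoc s x), (subtree T (snoc emp x)), x.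
    split; [now apply is_opairE|]. split; [now apply is_opairE|]. split; [|split].
    + exists emp, (snoc emp x). split; [now apply is_emptyE|]. split; [exact Hx|].
      apply (is_snocE X); [apply seq_emp|reflexivity].
    + now apply (is_snocE X).
    + intros t. rewrite in_subtree. split; intros [Ht K]; (split; [exact Ht|]).
      * exists (cons x t). split; [|now apply is_consE].
        rewrite <- (concat_cons X), (concat_emp_l X) in K; try assumption. now apply seq_cons.
      * destruct K as (u & Hu & E). apply is_consE in E. subst u.
        rewrite <- (concat_cons X), (concat_emp_l X); try assumption. now apply seq_cons.
Qed.

Lemma subtree_snoc T t x : large T -> t ∈ T -> x ∈ X -> snoc t x ∈ T ->
  subtree (subtree T t) (snoc emp x) = subtree T (snoc t x).
Proof.
  intros HT Ht Hx K. assert (Hst := large_seq _ _ HT Ht). apply ext. intros r.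
  rewrite !in_subtree. split.
  - intros (Hr & _ & L). split; [exact Hr|].
    rewrite <- (concat_cons X), (concat_emp_l X), (concat_cons X) in L; try assumption.
    now apply seq_cons.
  - intros (Hr & L). split; [exact Hr|]. rewrite <- (concat_cons X) in L by assumption.
    rewrite <- (concat_cons X), (concat_emp_l X); try assumption; [|now apply seq_cons].
    split; [now apply seq_cons|exact L].
Qed.

Lemma iter_below n p q : is_nat n -> cond p ->
  iter (fun _ a b => tp_step X U b a) n p q -> below q p.
Proof.
  intros Hn Hp. revert q. pattern n. apply nat_induction; [| | |exact Hn].
  - unfold iter. repeat first [progress definability|apply dp_tp_step|apply dp_below].
  - intros q H. apply iter_emp in H. subst. now apply below_refl.
  - intros m Hm IH q H. apply iter_suc in H; [|exact Hm].
    destruct H as (r & Hr & K). apply below_trans with r; [now apply IH|now apply below_step].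
Qed.

Lemma iter_subtree s T t : seq s -> large T -> t ∈ T ->
  exists n, is_nat n /\ iter (fun _ a b => tp_step X U b a) n (op s T) (op (concat s t) (subtree T t)).
Proof.
  intros Hs HT Ht. assert (Hst := large_seq _ _ HT Ht). revert Ht. pattern t.
  apply (seq_induction X); [| | |exact Hst].
  - unfold iter. repeat first [progress definability|apply dp_tp_step|apply dt_subtree].
  - intros _. exists emp. split; [apply nat_emp|]. apply iter_emp.
    now rewrite concat_emp, subtree_emp.
  - clear t Hst. intros t x Hst Hx IH Htx.
    assert (Ht : t ∈ T) by now apply (large_snoc T t x).
    destruct (IH Ht) as (n & Hn & K). exists (suc n). split; [now apply nat_suc|].
    apply iter_suc; [exact Hn|]. exists (op (concat s t) (subtree T t)). split; [exact K|].
    rewrite concat_snoc, <- subtree_snoc by assumption. apply tp_step_one_point.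
    + now apply concat_seq.
    + now apply large_subtree.
    + apply in_subtree. split; [apply seq_snoc; auto using seq_emp|].
      now rewrite concat_snoc, concat_emp by auto using seq_emp.
Qed.

(** Steps compose to [below]; conversely the one-point extensions along [t] can all be
    performed first, in the large tree, and followed by a single direct extension. *)
Lemma tp_leE q p : le q p <-> below q p.
Proof.
  rewrite tp_le_iter. split.
  - intros (Hp & _ & n & Hn & H). now apply (iter_below n).
  - intros H. split; [apply H|]. split; [apply H|].
    destruct (cond_inv _ (proj1 H)) as (s & T & -> & Hs & HT).
    destruct (cond_inv _ (proj1 (proj2 H))) as (s' & T' & -> & Hs' & HT').
    apply below_op in H. destruct H as (_ & _ & _ & _ & t & Ht & -> & K).
    destruct (iter_subtree s T t Hs HT Ht) as (n & Hn & L).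
    exists (suc n). split; [now apply nat_suc|]. apply iter_suc; [exact Hn|].
    exists (op (concat s t) (subtree T t)). split; [exact L|].
    split; [apply cond_op; split; [exact Hs'|now apply large_subtree]|].
    split; [now apply cond_op|]. left. exists (concat s t), (subtree T t), T'.
    split; [now apply is_opairE|]. split; [now apply is_opairE|].
    intros r Hr. apply in_subtree. split; [now apply (large_seq T')|auto].
Qed.

Lemma dp_le (t u : operation V) : dterm t -> dterm u -> definable (fun e => le (t e) (u e)).
Proof.
  intros Ht Hu. apply (dp_iff (fun e => below (t e) (u e))).
  - intros e. now rewrite tp_leE.
  - now apply dp_below.
Qed.

Lemma le_refl p : cond p -> le p p.
Proof. rewrite tp_leE. apply below_refl. Qed.

Lemma le_trans p q r : le q p -> le r q -> le r p.
Proof. rewrite !tp_leE. apply below_trans. Qed.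

Lemma le_cond_l q p : le q p -> cond q.
Proof. intros H. apply H. Qed.

Lemma cond_set : is_set cond.
Proof.
  apply (bounded_set _ (times seqs (pow seqs))); [apply dp_cond; definability|].
  intros p Hp. destruct (cond_inv _ Hp) as (s & T & -> & Hs & HT).
  apply op_in_times. split; [now apply in_seqs|]. apply in_pow. intros t Ht.
  apply in_seqs. now apply (large_seq T).
Qed.

Lemma is_tp_oneE one : is_tp_one X one -> one = op emp seqs.
Proof.
  intros (z & T & Hz & HT & E). apply is_emptyE in Hz. apply is_opairE in E. subst.
  f_equal. apply ext. intros t. rewrite in_seqs. apply HT.
Qed.

Lemma le_one p : cond p -> le p (op emp seqs).
Proof.
  intros Hp. destruct (cond_inv _ Hp) as (s & T & -> & Hs & HT).
  apply tp_leE, below_op. split; [apply seq_emp|]. split; [apply large_seqs|].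
  repeat (split; [assumption|]). exists s. split; [now apply in_seqs|].
  split; [symmetry; now apply (concat_emp_l X)|]. intros r Hr. apply in_seqs, concat_seq; [exact Hs|].
  now apply (large_seq T).
Qed.

End Order.

(** * Forcing *)

Section Checks.
Context {V : structure} {HV : @ZF V} (one : V).
Implicit Types a b c d f h i j l m p q r s t u v w x y z : V.

(** The component [z] of [op z r] is three membership steps below [x]. *)
Lemma name_induction (Q : V -> Prop) : definable (fun e => Q (e 0)) ->
  (forall x, (forall z r, op z r ∈ x -> Q z) -> Q x) -> forall x, Q x.
Proof.
  intros HQ H x.
  enough (K : Q x /\ forall y, y ∈ x -> Q y /\ forall w, w ∈ y -> Q w) by tauto.
  pattern x. apply eps_induction; [definability|]. clear x. intros x IH. split.
  - apply H. intros z r Hzr. destruct (IH _ Hzr) as (_ & K).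
    destruct (K (sing z)) as (_ & L); [apply in_op; tauto|]. apply L. now apply in_sing.
  - intros y Hy. destruct (IH y Hy) as (Qy & K). split; [exact Qy|].
    intros w Hw. now apply K.
Qed.

Local Notation isck := (is_check one).

Lemma is_checkE x y : isck x y <->
  exists f d, fun_on f d /\ transitive d /\
    (forall u v, op u v ∈ f -> forall w, w ∈ v <->
       exists z z', z ∈ u /\ op z z' ∈ f /\ w = op z' one) /\ op x y ∈ f.
Proof. unfold is_check. setoid_rewrite relE. setoid_rewrite is_opairE. reflexivity. Qed.

Lemma dp_is_check (t u : operation V) : dterm t -> dterm u ->
  definable (fun e => isck (t e) (u e)).
Proof. apply (dp_app2 (fun x y => isck x y)). unfold is_check. definability. Qed.

Lemma check_unique x y y' : isck x y -> isck x y' -> y = y'.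
Proof.
  rewrite !is_checkE. intros (f & d & [b Hf] & Hd & K & Hx) (f' & d' & [b' Hf'] & Hd' & K' & Hx').
  enough (E : forall x, forall y y', op x y ∈ f -> op x y' ∈ f' -> y = y')
    by exact (E x y y' Hx Hx').
  clear x y y' Hx Hx'. apply (eps_induction (fun x => forall y y',
    op x y ∈ f -> op x y' ∈ f' -> y = y')); [definability|].
  intros x IH y y' Hx Hx'. apply ext. intros w. rewrite (K _ _ Hx), (K' _ _ Hx').
  assert (Dx : x ∈ d) by now apply (fun_bounds Hf) in Hx.
  assert (Dx' : x ∈ d') by now apply (fun_bounds Hf') in Hx'.
  split; intros (z & z' & Hz & L & ->); exists z, z'; (split; [exact Hz|]);
    (split; [|reflexivity]).
  - destruct (fun_total z Hf') as [z'' Hz'']; [now apply (Hd' x)|].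
    now rewrite (IH z Hz _ _ L Hz'').
  - destruct (fun_total z Hf) as [z'' Hz'']; [now apply (Hd x)|].
    now rewrite <- (IH z Hz _ _ Hz'' L).
Qed.

Lemma check_elem x y w : isck x y ->
  (w ∈ y <-> exists z z', z ∈ x /\ isck z z' /\ w = op z' one).
Proof.
  intros H. assert (H' := H). apply is_checkE in H'. destruct H' as (f & d & [b Hf] & Hd & K & Hx).
  assert (C : forall z z', op z z' ∈ f -> isck z z').
  { intros z z' Hz. apply is_checkE. exists f, d.
    split; [now exists b|]. now split; [|split]. }
  rewrite (K _ _ Hx w). split; intros (z & z' & Hz & L & ->); exists z, z';
    (split; [exact Hz|]); (split; [|reflexivity]).
  - now apply C.
  - destruct (fun_total z Hf) as [z'' Hz''].
    { apply (Hd x); [|exact Hz]. now apply (fun_bounds Hf) in Hx. }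
    now rewrite (check_unique z z' z'' L (C _ _ Hz'')).
Qed.

Lemma check_mem x y z : isck x y -> z ∈ x -> exists z', isck z z'.
Proof.
  intros H Hz. apply is_checkE in H. destruct H as (f & d & [b Hf] & Hd & K & Hx).
  destruct (fun_total z Hf) as [z'' Hz''].
  { apply (Hd x); [|exact Hz]. now apply (fun_bounds Hf) in Hx. }
  exists z''. apply is_checkE. exists f, d. split; [now exists b|]. now split; [|split].
Qed.

(** At a minimal counterexample [y] every element has a check name. Check functions on
    different domains agree, so the relation of being a check name is a check function
    on the elements that have one, and it can be extended at [y]. *)
Lemma check_exists x : exists y, isck x y.
Proof.
  destruct (transitive_superset x) as (d & Hx & Hd).
  destruct (sep_set (fun u => exists v, isck u v) d) as [g Hg]; [definability; apply dp_is_check; definability|].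
  apply NNPP. intros N.
  destruct (sep_set (fun u => ~ exists v, isck u v) d) as [b Hb]; [definability; apply dp_is_check; definability|].
  destruct (regularity b) as (y & Hy & K); [exists x; now apply Hb|].
  apply Hb in Hy. destruct Hy as [Hy Ny]. apply Ny.
  assert (Gy : forall z, z ∈ y -> z ∈ g).
  { intros z Hz. apply Hg. split; [now apply (Hd y)|]. apply NNPP. intros L.
    apply (K z Hz). apply Hb. split; [now apply (Hd y)|exact L]. }
  destruct (repl_set (fun z w => exists z', isck z z' /\ w = op z' one) y) as [v0 Hv0].
  { definability; apply dp_is_check; definability. }
  { intros z w w' _ (z' & L & ->) (z'' & L' & ->).
    now rewrite (check_unique _ _ _ L L'). }
  (* The check function on the elements of d that have a check name, extended at y. *)
  destruct (fun_on_of_rel (fun u v => (u <> y /\ isck u v) \/ (u = y /\ v = v0)) (cup g (sing y)))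
    as (f & Hf & Ef).
  { definability; apply dp_is_check; definability. }
  { intros u Hu. destruct (classic (u = y)) as [->|Nu]; [exists v0; tauto|].
    apply in_cup in Hu. rewrite in_sing in Hu. destruct Hu as [Hu|Hu]; [|tauto].
    apply Hg in Hu. destruct Hu as (_ & v & Hv). exists v. tauto. }
  { intros u v v' _ [[H1 H2]|[H1 H2]] [[H1' H2']|[H1' H2']]; try tauto; [|congruence].
    now apply (check_unique u). }
  exists v0. apply is_checkE. exists f, (cup g (sing y)).
  assert (Ggood : forall z u, z ∈ u -> u ∈ g -> z ∈ g /\ z <> y).
  { intros z u Hz Hu. apply Hg in Hu. destruct Hu as (Du & v & Hv).
    destruct (check_mem _ _ _ Hv Hz) as [z' Hz'].
    split; [apply Hg; split; [now apply (Hd u)|now exists z']|].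
    intros ->. apply Ny. now exists z'. }
  split; [exact Hf|]. split; [|split].
  - intros u Hu z Hz. apply in_cup. left. apply in_cup in Hu. rewrite in_sing in Hu.
    destruct Hu as [Hu| ->]; [now apply (Ggood z u)|auto].
  - intros u v Huv w. apply Ef in Huv. destruct Huv as (Du & [[Nu Cu]|[-> ->]]).
    + apply in_cup in Du. rewrite in_sing in Du. destruct Du as [Du|Du]; [|tauto].
      rewrite (check_elem u v w Cu).
      split; intros (z & z' & Hz & L & ->); exists z, z'; (split; [exact Hz|]);
        (split; [|reflexivity]); destruct (Ggood z u Hz Du).
      * apply Ef. split; [apply in_cup; tauto|tauto].
      * apply Ef in L. tauto.
    + rewrite Hv0. split.
      * intros (z & Hz & z' & L & ->). exists z, z'. split; [exact Hz|].
        split; [|reflexivity]. apply Ef. split; [apply in_cup; left; auto|].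
        left. split; [|exact L]. intros ->. now apply mem_irrefl in Hz.
      * intros (z & z' & Hz & L & ->). exists z. split; [exact Hz|]. exists z'.
        split; [|reflexivity]. apply Ef in L. destruct L as (_ & [[_ L]|[-> _]]); [exact L|].
        now apply mem_irrefl in Hz.
  - apply Ef. split; [apply in_cup; right; now apply in_sing|tauto].
Qed.

Definition check x : V := epsilon ZF_inhabited (fun y => isck x y).

Lemma check_spec x : isck x (check x).
Proof. apply (epsilon_spec ZF_inhabited (fun y => isck x y)), check_exists. Qed.

Lemma check_eq x y : isck x y <-> y = check x.
Proof.
  split; [|intros ->; apply check_spec]. intros H. apply (check_unique x); [exact H|apply check_spec].
Qed.

Lemma dt_check (t : operation V) : dterm t -> dterm (fun e => check (t e)).
Proof.
  intros Ht. unfold dterm. apply (dp_iff (fun e => isck (t (etl e)) (e 0))).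
  - intros e. apply check_eq.
  - apply dp_is_check; definability.
Qed.

Lemma in_check w x : w ∈ check x <-> exists z, z ∈ x /\ w = op (check z) one.
Proof.
  rewrite (check_elem x (check x) w (check_spec x)). split.
  - intros (z & z' & Hz & L & ->). apply check_eq in L. subst. now exists z.
  - intros (z & Hz & ->). exists z, (check z). split; [exact Hz|]. split; [apply check_spec|reflexivity].
Qed.

End Checks.

Section Forcing.
Context {V : structure} {HV : @ZF V} (P : V -> Prop) (le : V -> V -> Prop) (one : V).
Implicit Types a b c d f h l m p q r s t u v w x y z : V.
Context (P_set : is_set P) (dpP : definable (fun e => P (e 0))) (dple : definable (fun e => le (e 0) (e 1)))
  (le_refl : forall p, P p -> le p p)
  (le_trans : forall p q r, le q p -> le r q -> le r p)
  (le_l : forall q p, le q p -> P q)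
  (le_one : forall p, P p -> le p one).

Local Notation nm := (is_name P).
Local Notation EQ := (forces_eq P le).
Local Notation MEM := (forces_mem P le).

Lemma is_nameE x : nm x <->
  exists t, x ∈ t /\ forall y z, y ∈ t -> z ∈ y -> exists s p, s ∈ t /\ P p /\ z = op s p.
Proof. unfold is_name. setoid_rewrite is_opairE. reflexivity. Qed.

Lemma dp_is_name (t : operation V) : dterm t -> definable (fun e => nm (t e)).
Proof. apply (dp_app1 (fun x => nm x)). unfold is_name. definability. Qed.

Lemma name_elem x z : nm x -> z ∈ x -> exists s p, nm s /\ P p /\ z = op s p.
Proof.
  rewrite is_nameE. intros (t & Hx & H) Hz. destruct (H x z Hx Hz) as (s & p & Hs & Hp & ->).
  exists s, p. split; [|tauto]. apply is_nameE. now exists t.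
Qed.

Lemma name_comp x z r : nm x -> op z r ∈ x -> nm z /\ P r.
Proof.
  intros Hx H. destruct (name_elem _ _ Hx H) as (s & p & Hs & Hp & E).
  apply op_inj in E as [-> ->]. tauto.
Qed.

(** Abstracting [E] lets the clause be compared for two tables, and for the forcing
    relation. *)
Definition sub_clause (E : V -> V -> V -> Prop) p x y :=
  forall z r, op z r ∈ x -> forall q, le q p -> le q r ->
  forall q', le q' q -> exists q'', le q'' q' /\
    exists z' r', op z' r' ∈ y /\ le q'' r' /\ E q'' z z'.

Definition in_table s p x y := op p (op x y) ∈ s.

Lemma trelE s p x y : trel s p x y <-> in_table s p x y.
Proof.
  unfold trel, in_table. setoid_rewrite is_opairE. setoid_rewrite relE.
  split; [intros (z & -> & H); exact H|eauto].
Qed.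

Lemma forces_subE s p x y : forces_sub le s p x y <-> sub_clause (in_table s) p x y.
Proof. unfold forces_sub, sub_clause, in_table. setoid_rewrite trelE. setoid_rewrite relE. reflexivity. Qed.

Lemma sub_clause_mono (E E' : V -> V -> V -> Prop) p x y :
  (forall q z z' r r', P q -> op z r ∈ x -> op z' r' ∈ y -> E q z z' -> E' q z z') ->
  sub_clause E p x y -> sub_clause E' p x y.
Proof.
  intros HE H z r Hz q H1 H2 q' H3.
  destruct (H z r Hz q H1 H2 q' H3) as (q'' & H4 & z' & r' & H5 & H6 & H7).
  exists q''. split; [exact H4|]. exists z', r'. split; [exact H5|]. split; [exact H6|].
  apply (HE q'' z z' r r'); try assumption. now apply (le_l q'' q').
Qed.

Definition eq_table t s :=
  (forall x z r, x ∈ t -> op z r ∈ x -> z ∈ t) /\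
  (forall p x y, P p -> x ∈ t -> y ∈ t ->
     (in_table s p x y <->
      sub_clause (in_table s) p x y /\ sub_clause (in_table s) p y x)).

Lemma forces_eqE p x y : EQ p x y <->
  exists t s, x ∈ t /\ y ∈ t /\ eq_table t s /\ in_table s p x y.
Proof.
  unfold forces_eq, forces_eq_table, eq_table, in_table. setoid_rewrite trelE. 
  setoid_rewrite relE. setoid_rewrite forces_subE. reflexivity.
Qed.

Lemma dp_forces_eq (t u v : operation V) : dterm t -> dterm u -> dterm v ->
  definable (fun e => EQ (t e) (u e) (v e)).
Proof.
  apply (dp_app3 (fun x y z => EQ x y z)).
  unfold forces_eq, forces_eq_table, forces_sub, trel. definability.
Qed.

(** The clause is monotone in the table, so the union of all sets contained in their
    own image is a fixed point, that is, a table. *)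
Lemma eq_table_exists t : (forall x z r, x ∈ t -> op z r ∈ x -> z ∈ t) ->
  exists s, eq_table t s.
Proof.
  intros Ht. destruct P_set as [PP HPP].
  set (post := fun c => forall p x y, op p (op x y) ∈ c -> P p /\ x ∈ t /\ y ∈ t /\
    sub_clause (in_table c) p x y /\ sub_clause (in_table c) p y x).
  destruct (sep_set (fun w => exists c, w ∈ c /\ post c) (times PP (times t t))) as [s Hs].
  { unfold post, sub_clause, in_table. definability. }
  assert (Sc : forall c p x y, post c -> in_table c p x y -> in_table s p x y).
  { intros c p x y Hc H. apply Hs. split; [|now exists c].
    destruct (Hc p x y H) as (H1 & H2 & H3 & _).
    apply op_in_times. split; [now apply HPP|]. now apply op_in_times. }
  assert (Ps : post s).
  { intros p x y H. apply Hs in H. destruct H as (_ & c & H & Hc).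
    destruct (Hc p x y H) as (H1 & H2 & H3 & H4 & H5).
    repeat (split; [assumption|]).
    split; [revert H4|revert H5]; apply sub_clause_mono; intros; now apply (Sc c). }
  exists s. split; [exact Ht|]. intros p x y Hp Hx Hy. split.
  - intros H. now apply Ps.
  - intros (H1 & H2). apply (Sc (cup s (sing (op p (op x y))))).
    + assert (M : forall q z z' (r r' : V), in_table s q z z' ->
        in_table (cup s (sing (op p (op x y)))) q z z').
      { intros q z z' _ _ K. apply in_cup. now left. }
      intros p' x' y' K. apply in_cup in K. destruct K as [K|K].
      * destruct (Ps p' x' y' K) as (K1 & K2 & K3 & K4 & K5).
        repeat (split; [assumption|]).
        split; [revert K4|revert K5]; apply sub_clause_mono; intros; now apply (M q z z' r r').
      * apply in_sing in K. apply op_inj in K as [-> K]. apply op_inj in K as [-> ->].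
        repeat (split; [assumption|]).
        split; [revert H1|revert H2]; apply sub_clause_mono; intros; now apply (M q z z' r r').
    + apply in_cup. right. now apply in_sing.
Qed.

Lemma eq_table_sym t s p x y : eq_table t s -> P p -> x ∈ t -> y ∈ t ->
  in_table s p x y -> in_table s p y x.
Proof.
  intros (_ & H) Hp Hx Hy K. apply H; try assumption. apply H in K; try assumption. tauto.
Qed.

(** The two halves of the clause are exchanged with [x] and [y], so induction on [x]
    alone suffices. *)
Lemma eq_table_unique t s t' s' : eq_table t s -> eq_table t' s' ->
  forall x y p, P p -> x ∈ t -> x ∈ t' -> y ∈ t -> y ∈ t' ->
  (in_table s p x y <-> in_table s' p x y).
Proof.
  intros H H' x. pattern x. apply name_induction; [unfold in_table; definability|].
  clear x. intros x IH y p Hp Hx Hx' Hy Hy'.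
  assert (K := H). assert (K' := H'). destruct K as (C & D), K' as (C' & D').
  assert (S1 : forall q z z' r r', P q -> op z r ∈ x -> op z' r' ∈ y ->
    (in_table s q z z' <-> in_table s' q z z')).
  { intros q z z' r r' Hq Hz Hz'. apply (IH z r); try assumption; eauto. }
  assert (S2 : forall q z z' r r', P q -> op z r ∈ y -> op z' r' ∈ x ->
    (in_table s q z z' <-> in_table s' q z z')).
  { intros q z z' r r' Hq Hz Hz'. assert (L := S1 q z' z r' r Hq Hz' Hz).
    split; intros M.
    - apply (eq_table_sym t' s'); eauto. apply L. apply (eq_table_sym t s); eauto.
    - apply (eq_table_sym t s); eauto. apply L. apply (eq_table_sym t' s'); eauto. }
  rewrite D, D' by assumption.
  split; intros (L1 & L2); (split; [revert L1|revert L2]); apply sub_clause_mono;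
    intros q z z' r r' Hq Hz Hz'; first [solve [apply (S1 q z z' r r'); assumption]
                              |apply (S2 q z z' r r'); assumption].
Qed.

Lemma EQ_unfold p x y : nm x -> nm y -> P p ->
  (EQ p x y <-> sub_clause EQ p x y /\ sub_clause EQ p y x).
Proof.
  rewrite !is_nameE. intros (tx & Hx & Cx) (ty & Hy & Cy) Hp.
  set (t := cup tx ty).
  assert (C : forall u z r, u ∈ t -> op z r ∈ u -> z ∈ t).
  { intros u z r Hu Hz. apply in_cup in Hu. apply in_cup. destruct Hu as [Hu|Hu].
    - left. destruct (Cx _ _ Hu Hz) as (z' & r' & K & _ & E). now apply op_inj in E as [-> _].
    - right. destruct (Cy _ _ Hu Hz) as (z' & r' & K & _ & E). now apply op_inj in E as [-> _]. }
  destruct (eq_table_exists t C) as (s & Hs).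
  assert (E : forall q u v, P q -> u ∈ t -> v ∈ t -> (EQ q u v <-> in_table s q u v)).
  { intros q u v Hq Hu Hv. rewrite forces_eqE. split.
    - intros (t' & s' & Hu' & Hv' & Hs' & K).
      now apply (eq_table_unique t s t' s').
    - intros K. now exists t, s. }
  assert (Tx : x ∈ t) by (apply in_cup; tauto). assert (Ty : y ∈ t) by (apply in_cup; tauto).
  rewrite E by assumption. rewrite (proj2 Hs p x y) by assumption.
  split; intros (L1 & L2); (split; [revert L1|revert L2]); apply sub_clause_mono;
    intros q z z' r r' Hq Hz Hz'; apply E; eauto.
Qed.

Lemma EQ_mono q p x y : nm x -> nm y -> P p -> le q p -> EQ p x y -> EQ q x y.
Proof.
  intros Hx Hy Hp Hq. rewrite !EQ_unfold; eauto.
  intros (H & K). split; intros z r Hz q1 L1; [apply (H z r Hz q1)|apply (K z r Hz q1)]; eauto.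
Qed.

Lemma EQ_local p x y : nm x -> nm y -> P p ->
  (forall q, le q p -> exists r, le r q /\ EQ r x y) -> EQ p x y.
Proof.
  intros Hx Hy Hp H. apply EQ_unfold; try assumption.
  split; intros z r Hz q L1 L2 q' L3.
  - destruct (H q') as (r1 & M1 & M2); [eauto|]. apply EQ_unfold in M2; eauto.
    destruct (proj1 M2 z r Hz r1) with (q' := r1) as (q'' & N1 & N2); eauto.
  - destruct (H q') as (r1 & M1 & M2); [eauto|]. apply EQ_unfold in M2; eauto.
    destruct (proj2 M2 z r Hz r1) with (q' := r1) as (q'' & N1 & N2); eauto.
Qed.

Lemma EQ_sym p x y : nm x -> nm y -> P p -> EQ p x y -> EQ p y x.
Proof. intros Hx Hy Hp. rewrite !EQ_unfold by assumption. tauto. Qed.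

Lemma EQ_refl x : nm x -> forall p, P p -> EQ p x x.
Proof.
  pattern x. apply name_induction.
  - definability; first [apply dp_is_name|apply dp_forces_eq]; definability.
  - clear x. intros x IH Hx p Hp. apply EQ_unfold; try assumption.
    enough (sub_clause EQ p x x) by tauto.
    intros z r Hz q L1 L2 q' L3. assert (Hq' : P q') by eauto.
    exists q'. split; [auto|]. exists z, r. split; [exact Hz|]. split; [eauto|].
    apply (IH z r); try assumption. now apply (name_comp x z r).
Qed.

(** In the second half of the clause the components come in the opposite order;
    symmetry brings them back to the order of the induction hypothesis. *)
Lemma EQ_trans x : nm x -> forall y w p, nm y -> nm w -> P p ->
  EQ p x y -> EQ p y w -> EQ p x w.
Proof.
  pattern x. apply name_induction.
  - definability; first [apply dp_is_name|apply dp_forces_eq]; definability.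
  - clear x. intros x IH Hx y w p Hy Hw Hp.
    rewrite !EQ_unfold by assumption. intros (H1 & H2) (K1 & K2). split.
    + intros z r Hz q L1 L2 q' L3.
      destruct (H1 z r Hz q L1 L2 q' L3) as (q1 & M1 & z1 & r1 & M2 & M3 & M4).
      destruct (K1 z1 r1 M2 q1) with (q' := q1) as (q2 & N1 & z2 & r2 & N2 & N3 & N4); eauto.
      exists q2. split; [eauto|]. exists z2, r2. split; [exact N2|]. split; [exact N3|].
      destruct (name_comp _ _ _ Hx Hz), (name_comp _ _ _ Hy M2), (name_comp _ _ _ Hw N2).
      apply (IH z r) with (y := z1); eauto using EQ_mono.
    + intros z r Hz q L1 L2 q' L3.
      destruct (K2 z r Hz q L1 L2 q' L3) as (q1 & M1 & z1 & r1 & M2 & M3 & M4).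
      destruct (H2 z1 r1 M2 q1) with (q' := q1) as (q2 & N1 & z2 & r2 & N2 & N3 & N4); eauto.
      exists q2. split; [eauto|]. exists z2, r2. split; [exact N2|]. split; [exact N3|].
      destruct (name_comp _ _ _ Hw Hz), (name_comp _ _ _ Hy M2), (name_comp _ _ _ Hx N2).
      apply EQ_sym; eauto. apply (IH z2 r2) with (y := z1); eauto using EQ_mono, EQ_sym.
Qed.

Lemma MEM_iff p x y : MEM p x y <-> forall q, le q p -> exists q', le q' q /\
    exists z r, op z r ∈ y /\ le q' r /\ EQ q' x z.
Proof. unfold forces_mem. setoid_rewrite relE. reflexivity. Qed.

Lemma MEM_mono q p x y : le q p -> MEM p x y -> MEM q x y.
Proof. intros Hq H q' Hq'. apply H. eauto. Qed.

Lemma MEM_local p x y : (forall q, le q p -> exists r, le r q /\ MEM r x y) -> MEM p x y.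
Proof.
  intros H q Hq. destruct (H q Hq) as (r & Hr & K). destruct (K r) as (q' & Hq' & L); [eauto|].
  exists q'. split; [eauto|exact L].
Qed.

Lemma MEM_subst p x y x' y' : nm x -> nm y -> nm x' -> nm y' -> P p ->
  EQ p x x' -> EQ p y y' -> MEM p x y -> MEM p x' y'.
Proof.
  intros Hx Hy Hx' Hy' Hp Ex Ey. rewrite !MEM_iff. intros H q Hq.
  destruct (H q Hq) as (q1 & H1 & z & r & H2 & H3 & H4).
  apply EQ_unfold in Ey; try assumption.
  destruct (proj1 Ey z r H2 q1) with (q' := q1) as (q2 & N1 & z' & r' & N2 & N3 & N4); eauto.
  exists q2. split; [eauto|]. exists z', r'. split; [exact N2|]. split; [exact N3|].
  destruct (name_comp _ _ _ Hy H2), (name_comp _ _ _ Hy' N2).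
  assert (P q2) by eauto. assert (P q1) by eauto.
  apply EQ_trans with (y := x); try assumption.
  - apply EQ_sym; try assumption. apply (EQ_mono q2 p); eauto.
  - apply EQ_trans with (y := z); try assumption. apply (EQ_mono q2 q1); eauto.
Qed.

Lemma MEM_comp q z r y : nm y -> op z r ∈ y -> le q r -> MEM q z y.
Proof.
  intros Hy Hz Hq. apply MEM_iff. intros q' Hq'. exists q'. split; [eauto|].
  exists z, r. split; [exact Hz|]. split; [eauto|]. apply EQ_refl; [|eauto].
  now apply (name_comp y z r).
Qed.

(** Extensionality in the extension. *)
Lemma MEM_ext p x y : nm x -> nm y -> P p ->
  (forall w q, nm w -> le q p -> (MEM q w x <-> MEM q w y)) -> EQ p x y.
Proof.
  intros Hx Hy Hp H. apply EQ_unfold; try assumption.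
  split; intros z r Hz q L1 L2 q' L3.
  - destruct (name_comp _ _ _ Hx Hz) as [Nz _].
    assert (K := proj1 (H z q Nz L1) (MEM_comp q z r x Hx Hz L2)).
    rewrite MEM_iff in K. now apply K.
  - destruct (name_comp _ _ _ Hy Hz) as [Nz _].
    assert (K := proj2 (H z q Nz L1) (MEM_comp q z r y Hy Hz L2)).
    rewrite MEM_iff in K. now apply K.
Qed.

(** ** The forcing relation for formulas *)

Local Notation fc := (forces P le).
Implicit Types (A B : formula) (e : nat -> V).

Definition nenv e := forall i, nm (e i).

Lemma nenv_scons x e : nm x -> nenv e -> nenv (scons x e).
Proof. intros Hx He [|i]; [exact Hx|apply He]. Qed.

Lemma forces_mono A : forall e q p, nenv e -> P p -> le q p -> fc p e A -> fc q e A.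
Proof.
  induction A as [i j|i j|A IH|A IHA B IHB|A IH]; intros e q p He Hp Hq; simpl.
  - now apply MEM_mono.
  - now apply EQ_mono.
  - intros H r Hr. apply H. eauto.
  - intros [H K]. eauto.
  - intros H x Hx. apply (IH _ q p); auto using nenv_scons.
Qed.

(** A statement forced densely below [p] is forced by [p]. This yields the rules for
    implication, disjunction and existence. *)
Lemma forces_local A : forall e p, nenv e -> P p ->
  (forall q, le q p -> exists r, le r q /\ fc r e A) -> fc p e A.
Proof.
  induction A as [i j|i j|A IH|A IHA B IHB|A IH]; intros e p He Hp; simpl.
  - apply MEM_local.
  - now apply EQ_local.
  - intros H q Hq K. destruct (H q Hq) as (r & Hr & L).
    apply (L r); [eauto|]. apply (forces_mono _ _ r q); eauto.
  - intros H. split; [apply IHA|apply IHB]; try assumption; intros q Hq;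
      destruct (H q Hq) as (r & Hr & L1 & L2); eauto.
  - intros H x Hx. apply IH; auto using nenv_scons. intros q Hq.
    destruct (H q Hq) as (r & Hr & L). eauto.
Qed.

Lemma forces_subst A : forall e e' p, nenv e -> nenv e' -> P p ->
  (forall i, EQ p (e i) (e' i)) -> fc p e A -> fc p e' A.
Proof.
  induction A as [i j|i j|A IH|A IHA B IHB|A IH]; intros e e' p He He' Hp E; simpl.
  - now apply MEM_subst.
  - intros H. apply EQ_trans with (y := e i); auto using EQ_sym.
    apply EQ_trans with (y := e j); auto.
  - intros H q Hq K. apply (H q Hq). apply (IH e'); eauto. intros i.
    apply EQ_sym; eauto. apply (EQ_mono q p); eauto.
  - intros [H K]. eauto.
  - intros H x Hx. apply (IH (scons x e)); auto using nenv_scons.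
    intros [|i]; simpl; auto using EQ_refl.
Qed.

Lemma forces_imp A B e p : nenv e -> P p ->
  (fc p e (fimp A B) <-> forall q, le q p -> fc q e A -> fc q e B).
Proof.
  intros He Hp. unfold fimp. simpl. split.
  - intros H q Hq HA. apply forces_local; eauto. intros r Hr. apply NNPP. intros N.
    apply (H r); [eauto|]. split; [apply (forces_mono _ _ r q); eauto|].
    intros r' Hr' K. apply N. now exists r'.
  - intros H q Hq (HA & HB). apply (HB q); [eauto|]. now apply H.
Qed.

Lemma forces_or A B e p : nenv e -> P p ->
  (fc p e (for_ A B) <-> forall q, le q p -> exists r, le r q /\ (fc r e A \/ fc r e B)).
Proof.
  intros He Hp. unfold for_. simpl. split.
  - intros H q Hq. apply NNPP. intros N. apply (H q Hq).
    split; intros r Hr K; apply N; exists r; tauto.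
  - intros H q Hq (HA & HB). destruct (H q Hq) as (r & Hr & [K|K]); [apply (HA r)|apply (HB r)];
      assumption.
Qed.

Lemma forces_ex A e p : nenv e -> P p ->
  (fc p e (fex A) <->
   forall q, le q p -> exists r x, le r q /\ nm x /\ fc r (scons x e) A).
Proof.
  intros He Hp. unfold fex. simpl. split.
  - intros H q Hq. apply NNPP. intros N. apply (H q Hq).
    intros x Hx r Hr K. apply N. now exists r, x.
  - intros H q Hq K. destruct (H q Hq) as (r & x & Hr & Hx & L). exact (K x Hx r Hr L).
Qed.

Lemma forces_iff A B e p : nenv e -> P p ->
  (fc p e (fiff A B) <-> forall q, le q p -> (fc q e A <-> fc q e B)).
Proof.
  intros He Hp. unfold fiff. cbn [forces]. rewrite !forces_imp by assumption.
  split; [intros (H & K) q Hq; split; auto|].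
  intros H. split; intros q Hq; apply (H q Hq).
Qed.

(** ** Check names *)

Local Notation check := (check one).

Lemma check_name x : P one -> nm (check x).
Proof.
  intros H1. destruct (transitive_superset x) as (d & Hx & Hd).
  destruct (repl_set (fun u v => v = check u) d) as [t Ht].
  - definability. apply dt_check; definability.
  - intros; congruence.
  - apply is_nameE. exists t. split; [apply Ht; now exists x|].
    intros y z Hy Hz. apply Ht in Hy. destruct Hy as (u & Hu & ->).
    apply in_check in Hz. destruct Hz as (v & Hv & ->). exists (check v), one.
    split; [|tauto]. apply Ht. exists v. split; [|reflexivity]. now apply (Hd u).
Qed.

Context (P_one : P one).

Lemma MEM_check q w x : MEM q w (check x) <->
  forall r, le r q -> exists r' z, le r' r /\ z ∈ x /\ EQ r' w (check z).
Proof.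
  rewrite MEM_iff. split; intros H r Hr.
  - destruct (H r Hr) as (r' & Hr' & z & o & Hz & _ & K).
    apply in_check in Hz. destruct Hz as (z' & Hz' & E). apply op_inj in E as [-> _].
    now exists r', z'.
  - destruct (H r Hr) as (r' & z & Hr' & Hz & K). exists r'. split; [exact Hr'|].
    exists (check z), one. split; [apply in_check; now exists z|]. split; [eauto|exact K].
Qed.

Lemma MEM_check_intro q z x : P q -> z ∈ x -> MEM q (check z) (check x).
Proof.
  intros Hq Hz. apply MEM_check. intros r Hr. exists r, z. split; [eauto|].
  split; [exact Hz|]. apply EQ_refl; [now apply check_name|eauto].
Qed.

Lemma EQ_check_inj x : forall y q, P q -> EQ q (check x) (check y) -> x = y.
Proof.
  pattern x. apply eps_induction.
  - definability; apply dp_forces_eq; definability; apply dt_check; definability.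
  - clear x. intros x IH y q Hq E. assert (N := fun z => check_name z P_one).
    apply ext. intros z. split; intros Hz.
    + assert (K : MEM q (check z) (check y)).
      { apply (MEM_subst q (check z) (check x)); auto using EQ_refl, MEM_check_intro. }
      rewrite MEM_check in K. destruct (K q) as (r & z' & Hr & Hz' & L); [auto|].
      rewrite (IH z Hz z' r); eauto.
    + assert (K : MEM q (check z) (check x)).
      { apply (MEM_subst q (check z) (check y)); auto using EQ_refl, EQ_sym, MEM_check_intro. }
      rewrite MEM_check in K. destruct (K q) as (r & z' & Hr & Hz' & L); [auto|].
      rewrite <- (IH z' Hz' z r); eauto. apply EQ_sym; eauto.
Qed.

Lemma MEM_check_elim q z x : P q -> MEM q (check z) (check x) -> z ∈ x.
Proof.
  intros Hq. rewrite MEM_check. intros H. destruct (H q) as (r & z' & Hr & Hz & E); [auto|].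
  apply EQ_check_inj in E; [now subst|eauto].
Qed.

(** ** Forced pairs *)

Definition forced_pair q z x y := forall w r, nm w -> le r q ->
  (MEM r w z <-> forall r1, le r1 r -> exists r2, le r2 r1 /\ (EQ r2 w x \/ EQ r2 w y)).

Definition forced_opair q z x y := forall w r, nm w -> le r q ->
  (MEM r w z <-> forall r1, le r1 r ->
     exists r2, le r2 r1 /\ (forced_pair r2 w x x \/ forced_pair r2 w x y)).

Definition forced_rel q f x y := forall q1, le q1 q ->
  exists r z, le r q1 /\ nm z /\ MEM r z f /\ forced_opair r z x y.

Lemma forces_upairE e q i j k : nenv e -> P q ->
  (fc q e (F_upair i j k) <-> forced_pair q (e i) (e j) (e k)).
Proof.
  intros He Hq. unfold F_upair, forced_pair. cbn [forces].
  split; intros H w; [intros r Hw Hr|intros Hw].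
  - specialize (H w Hw). rewrite forces_iff in H by auto using nenv_scons.
    specialize (H r Hr). rewrite forces_or in H by eauto using nenv_scons. exact H.
  - rewrite forces_iff by auto using nenv_scons. intros r Hr.
    rewrite forces_or by eauto using nenv_scons. now apply H.
Qed.

Lemma forces_opairE e q i j k : nenv e -> P q ->
  (fc q e (F_opair i j k) <-> forced_opair q (e i) (e j) (e k)).
Proof.
  intros He Hq. unfold F_opair, forced_opair. cbn [forces].
  assert (K : forall w r, nm w -> P r -> forall a b : nat,
    fc r (scons w e) (F_upair 0 (S a) (S b)) <-> forced_pair r w (e a) (e b)).
  { intros w r Hw Hr a b. apply (forces_upairE (scons w e)); auto using nenv_scons. }
  split; intros H w; [intros r Hw Hr|intros Hw].
  - specialize (H w Hw). rewrite forces_iff in H by auto using nenv_scons.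
    specialize (H r Hr). rewrite forces_or in H by eauto using nenv_scons.
    cbn [forces scons] in H. rewrite H.
    split; intros L r1 Hr1; destruct (L r1 Hr1) as (r2 & Hr2 & M); exists r2;
      (split; [exact Hr2|]); assert (P r2) by eauto; rewrite !K in *; assumption.
  - rewrite forces_iff by auto using nenv_scons. intros r Hr.
    rewrite forces_or by eauto using nenv_scons. cbn [forces scons]. rewrite H by assumption.
    split; intros L r1 Hr1; destruct (L r1 Hr1) as (r2 & Hr2 & M); exists r2;
      (split; [exact Hr2|]); assert (P r2) by eauto; rewrite !K in *; assumption.
Qed.

Lemma forces_relE e q i j k : nenv e -> P q ->
  (fc q e (F_rel i j k) <-> forced_rel q (e i) (e j) (e k)).
Proof.
  intros He Hq. unfold F_rel, forced_rel. rewrite forces_ex by assumption.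
  split; intros H q1 Hq1; destruct (H q1 Hq1) as (r & z & Hr & Hz & K); exists r, z.
  - destruct K as [K1 K2]. apply forces_opairE in K2; eauto using nenv_scons.
  - split; [exact Hr|]. split; [exact Hz|]. split; [apply K|].
    apply forces_opairE; eauto using nenv_scons. apply K.
Qed.

Lemma forced_opair_subst q z x y x' y' : nm z -> nm x -> nm y -> nm x' -> nm y' -> P q ->
  EQ q x x' -> EQ q y y' -> forced_opair q z x y -> forced_opair q z x' y'.
Proof.
  intros Hz Hx Hy Hx' Hy' Hq E E' H.
  assert (N : forall x y, nm x -> nm y -> nenv (scons z (scons x (fun _ => y)))).
  { intros u v Hu Hv. apply nenv_scons; [exact Hz|]. apply nenv_scons; [exact Hu|].
    intros i. exact Hv. }
  apply (forces_opairE (scons z (scons x' (fun _ => y'))) q 0 1 2); auto.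
  apply (forces_subst _ (scons z (scons x (fun _ => y)))); auto.
  - intros [|[|i]]; simpl; auto using EQ_refl.
  - apply (forces_opairE (scons z (scons x (fun _ => y))) q 0 1 2); auto.
Qed.

Lemma forced_rel_subst q f x y x' : nm f -> nm x -> nm y -> nm x' -> P q ->
  EQ q x x' -> forced_rel q f x y -> forced_rel q f x' y.
Proof.
  intros Hf Hx Hy Hx' Hq E H q1 Hq1. destruct (H q1 Hq1) as (r & z & Hr & Hz & K1 & K2).
  exists r, z. repeat (split; [assumption|]). apply (forced_opair_subst r z x y); eauto.
  - apply (EQ_mono r q); eauto.
  - apply EQ_refl; eauto.
Qed.

Lemma EQ_iff q x y : nm x -> nm y -> P q ->
  (EQ q x y <-> forall w r, nm w -> le r q -> (MEM r w x <-> MEM r w y)).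
Proof.
  intros Hx Hy Hq. split; [|now apply MEM_ext].
  intros E w r Hw Hr. assert (Hr' : P r) by eauto.
  assert (E' : EQ r x y) by (apply (EQ_mono r q); eauto).
  split; apply MEM_subst; auto using EQ_refl, EQ_sym.
Qed.

Local Hint Resolve check_name : core.

Lemma MEM_check_pair q w x y : MEM q w (check (pair x y)) <->
  forall r, le r q -> exists r', le r' r /\ (EQ r' w (check x) \/ EQ r' w (check y)).
Proof.
  rewrite MEM_check. split; intros H r Hr.
  - destruct (H r Hr) as (r' & z & Hr' & Hz & E). exists r'. split; [exact Hr'|].
    apply in_pair in Hz. destruct Hz; subst; tauto.
  - destruct (H r Hr) as (r' & Hr' & [E|E]); [exists r', x|exists r', y]; rewrite in_pair; tauto.
Qed.

Lemma forced_pair_check q z x y : nm z -> P q ->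
  (forced_pair q z (check x) (check y) <-> EQ q z (check (pair x y))).
Proof.
  intros Hz Hq. rewrite EQ_iff by auto. unfold forced_pair.
  split; intros H w r Hw Hr; specialize (H w r Hw Hr); rewrite MEM_check_pair in *; exact H.
Qed.

Lemma MEM_check_op q w x y : nm w -> P q -> (MEM q w (check (op x y)) <->
  forall r, le r q -> exists r', le r' r /\
    (forced_pair r' w (check x) (check x) \/ forced_pair r' w (check x) (check y))).
Proof.
  intros Hw Hq. rewrite MEM_check. split; intros H r Hr.
  - destruct (H r Hr) as (r' & z & Hr' & Hz & E). exists r'. split; [exact Hr'|].
    assert (P r') by eauto. rewrite !forced_pair_check by assumption.
    apply in_op in Hz. destruct Hz; subst; tauto.
  - destruct (H r Hr) as (r' & Hr' & K). assert (P r') by eauto.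
    rewrite !forced_pair_check in K by assumption.
    destruct K; [exists r', (sing x)|exists r', (pair x y)]; rewrite in_op; tauto.
Qed.

Lemma forced_opair_check q z x y : nm z -> P q ->
  (forced_opair q z (check x) (check y) <-> EQ q z (check (op x y))).
Proof.
  intros Hz Hq. rewrite EQ_iff by auto. unfold forced_opair.
  split; intros H w r Hw Hr; specialize (H w r Hw Hr); rewrite MEM_check_op in * by eauto; exact H.
Qed.

(** The first component is already determined by the singleton in the pair. *)
Lemma forced_opair_fst q z x y x' b : nm z -> nm y -> P q ->
  forced_opair q z (check x) y -> EQ q z (check (op x' b)) -> x = x'.
Proof.
  intros Hz Hy Hq H E. apply in_sing.
  assert (K : MEM q (check (sing x')) z).
  { apply (MEM_subst q (check (sing x')) (check (op x' b))); auto using EQ_refl, EQ_sym.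
    apply MEM_check_intro; [exact Hq|]. apply in_op. tauto. }
  rewrite (H (check (sing x')) q) in K by auto. destruct (K q) as (r & Hr & L); auto.
  assert (Pr : P r) by eauto. apply (MEM_check_elim r); [exact Pr|].
  destruct L as [L|L]; rewrite (L (check x) r) by auto; intros r1 Hr1; exists r1;
    (split; [eauto|left; apply EQ_refl; eauto]).
Qed.

Lemma forced_rel_check q f x y : nm f -> P q ->
  (forced_rel q f (check x) (check y) <-> MEM q (check (op x y)) f).
Proof.
  intros Hf Hq. split.
  - intros H. apply MEM_local. intros q1 Hq1.
    destruct (H q1 Hq1) as (r & z & Hr & Hz & K1 & K2). exists r. split; [exact Hr|].
    assert (P r) by eauto. apply forced_opair_check in K2; auto.
    apply (MEM_subst r z f); auto using EQ_refl.
  - intros H q1 Hq1. exists q1, (check (op x y)). split; [eauto|]. split; [auto|].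
    split; [now apply (MEM_mono q1 q)|]. apply forced_opair_check; eauto.
    apply EQ_refl; eauto.
Qed.

(** ** Forced cofinal maps between ground model ordinals *)

Section CofinalMap.
Context p f (a b : V) (Hf : nm f) (Hp : P p)
  (Hcof : fc p (scons f (scons (check a) (fun _ => check b))) (F_cofinal_map 0 1 2)).

Let env : nat -> V := scons f (scons (check a) (fun _ => check b)).

Lemma env_names : nenv env.
Proof.
  apply nenv_scons; [exact Hf|]. apply nenv_scons; [auto|]. intros i. auto.
Qed.

Lemma forced_elements z q : nm z -> le q p -> MEM q z f ->
  exists r x y, le r q /\ x ∈ a /\ y ∈ b /\ EQ r z (check (op x y)).
Proof.
  intros Hz Hq H. assert (N := env_names). destruct Hcof as ((C & _) & _).
  specialize (C z Hz). rewrite forces_imp in C by auto using nenv_scons.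
  specialize (C q Hq H). assert (Pq : P q) by eauto.
  rewrite forces_ex in C by auto using nenv_scons.
  destruct (C q) as (r & x & Hr & Hx & K1 & K2); [auto|]. clear C.
  cbn in K1. rewrite MEM_check in K1. destruct (K1 r) as (r1 & x' & Hr1 & Hx' & E); [eauto|].
  assert (Pr : P r) by eauto.
  rewrite forces_ex in K2 by auto using nenv_scons.
  destruct (K2 r1) as (r2 & y & Hr2 & Hy & L1 & L2); [auto|]. clear K1 K2.
  cbn in L1. rewrite MEM_check in L1. destruct (L1 r2) as (r3 & y' & Hr3 & Hy' & E'); [eauto|].
  assert (Pr2 : P r2) by eauto. assert (Pr3 : P r3) by eauto.
  exists r3, x', y'. split; [eauto|]. split; [exact Hx'|]. split; [exact Hy'|].
  apply forced_opair_check; auto. apply (forced_opair_subst r3 z x y); auto.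
  - apply (EQ_mono r3 r1); eauto.
  - apply forces_opairE in L2; auto 6 using nenv_scons.
    cbn in L2. intros w s Hw Hs. apply L2; eauto.
Qed.

(** Totality gives a pair with first component [check x] but an arbitrary name as
    second one; the bound on the range gives a pair of check names. Their first
    components agree. *)
Lemma forced_value x q : x ∈ a -> le q p ->
  exists r y, le r q /\ y ∈ b /\ MEM r (check (op x y)) f.
Proof.
  intros Hx Hq. assert (N := env_names). destruct Hcof as ((_ & C & _) & _).
  specialize (C (check x) (check_name x P_one)). rewrite forces_imp in C by auto using nenv_scons.
  assert (Pq : P q) by eauto.
  specialize (C q Hq (MEM_check_intro q x a Pq Hx)).
  rewrite forces_ex in C by auto using nenv_scons.
  destruct (C q) as (r & y & Hr & Hy & K); [auto|]. clear C. assert (Pr : P r) by eauto.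
  apply forces_relE in K; auto using nenv_scons.
  destruct (K r) as (r1 & z & Hr1 & Hz & L1 & L2); [auto|]. cbn in L1, L2.
  destruct (forced_elements z r1) as (r2 & x' & y' & Hr2 & Hx' & Hy' & E); eauto.
  assert (Pr1 : P r1) by eauto. assert (Pr2 : P r2) by eauto.
  exists r2, y'. split; [eauto|]. split; [exact Hy'|].
  assert (x = x') as ->.
  { apply (forced_opair_fst r2 z x y x' y'); auto.
    intros w s Hw Hs. apply L2; eauto. }
  apply (MEM_subst r2 z f); auto using EQ_refl. now apply (MEM_mono r2 r1).
Qed.

Lemma forced_functional x y y' q : nm x -> nm y -> nm y' -> le q p ->
  forced_rel q f x y -> forced_rel q f x y' -> EQ q y y'.
Proof.
  intros Hx Hy Hy' Hq K K'. assert (N := env_names). destruct Hcof as ((_ & _ & C) & _).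
  specialize (C x Hx y Hy y' Hy'). rewrite forces_imp in C by auto 6 using nenv_scons.
  assert (Pq : P q) by eauto.
  specialize (C q Hq). rewrite forces_imp in C by auto 6 using nenv_scons.
  rewrite !forces_relE in C by auto 6 using nenv_scons.
  apply (C K q); [auto|]. apply forces_relE; auto 6 using nenv_scons.
Qed.

Lemma forced_value_unique x y y' q : le q p ->
  MEM q (check (op x y)) f -> MEM q (check (op x y')) f -> y = y'.
Proof.
  intros Hq K K'. assert (Pq : P q) by eauto. apply (EQ_check_inj y y' q Pq).
  apply (forced_functional (check x)); auto; now apply forced_rel_check.
Qed.

Lemma forced_cofinal c q : c ∈ b -> le q p ->
  exists r x y, le r q /\ x ∈ a /\ y ∈ b /\ MEM r (check (op x y)) f /\ (c ∈ y \/ c = y).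
Proof.
  intros Hc Hq. assert (N := env_names). destruct Hcof as (_ & C).
  specialize (C (check c) (check_name c P_one)). rewrite forces_imp in C by auto using nenv_scons.
  assert (Pq : P q) by eauto.
  specialize (C q Hq (MEM_check_intro q c b Pq Hc)).
  rewrite forces_ex in C by auto using nenv_scons.
  destruct (C q) as (r & x & Hr & Hx & K1 & K2); [auto|]. clear C.
  cbn in K1. rewrite MEM_check in K1. destruct (K1 r) as (r1 & x' & Hr1 & Hx' & E); [eauto|].
  assert (Pr : P r) by eauto.
  rewrite forces_ex in K2 by auto using nenv_scons.
  destruct (K2 r1) as (r2 & y & Hr2 & Hy & L1 & L2); [auto|]. clear K1 K2.
  assert (Pr2 : P r2) by eauto. assert (Pr1 : P r1) by eauto.
  apply forces_relE in L1; auto 6 using nenv_scons. cbn in L1.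
  rewrite forces_or in L2 by auto 6 using nenv_scons.
  destruct (L2 r2) as (r3 & Hr3 & D); [auto|]. cbn in D. clear L2.
  destruct (forced_value x' r3) as (r4 & y' & Hr4 & Hy' & M); eauto 6.
  assert (Pr3 : P r3) by eauto. assert (Pr4 : P r4) by eauto.
  assert (Ey : EQ r4 y (check y')).
  { apply (forced_functional (check x')); auto; [eauto 8| |now apply forced_rel_check].
    apply (forced_rel_subst r4 f x); auto.
    - apply (EQ_mono r4 r1); eauto 6.
    - intros s Hs. apply L1. eauto. }
  exists r4, x', y'. split; [eauto 6|]. repeat (split; [assumption|]).
  destruct D as [D|D]; [left|right].
  - apply (MEM_check_elim r4); [exact Pr4|]. apply (MEM_subst r4 (check c) y); auto using EQ_refl.
    now apply (MEM_mono r4 r3).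
  - apply (EQ_check_inj c y' r4 Pr4). apply EQ_trans with (y := y); auto.
    apply (EQ_mono r4 r3); eauto.
Qed.

(** Every element of [f] is forced to be the check name of a pair of ground model
    elements, and its second component is the value forced by [q]. *)
Lemma forced_ground g q : is_fun g a b -> le q p ->
  (forall x y, op x y ∈ g -> MEM q (check (op x y)) f) -> EQ q f (check g).
Proof.
  intros Hg Hq H. assert (Pq : P q) by eauto. apply MEM_ext; auto. intros w r Hw Hr.
  split; intros K; apply MEM_local; intros r1 Hr1.
  - destruct (forced_elements w r1) as (r2 & x & y & Hr2 & Hx & Hy & E);
      [exact Hw|eauto|now apply (MEM_mono r1 r)|].
    assert (Pr2 : P r2) by eauto. exists r2. split; [exact Hr2|].
    destruct (fun_total _ Hg Hx) as [y' Hy'].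
    assert (y = y') as ->.
    { apply (forced_value_unique x y y' r2); [eauto 6| |].
      - apply (MEM_subst r2 w f); auto using EQ_refl. apply (MEM_mono r2 r); eauto.
      - apply (MEM_mono r2 q); eauto. }
    apply (MEM_subst r2 (check (op x y')) (check g)); auto using EQ_refl, EQ_sym, MEM_check_intro.
  - rewrite MEM_check in K. destruct (K r1 Hr1) as (r2 & z & Hr2 & Hz & E).
    assert (Pr2 : P r2) by eauto. exists r2. split; [exact Hr2|].
    assert (Hg' := Hg). apply is_funE in Hg'.
    destruct (proj1 Hg' z Hz) as (x & y & _ & _ & ->).
    apply (MEM_subst r2 (check (op x y)) f); auto using EQ_refl, EQ_sym.
    apply (MEM_mono r2 q); eauto 6.
Qed.

End CofinalMap.

End Forcing.

(** * Deciding statements without changing the stem *)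

Section Prikry.
Context {V : structure} {HV : @ZF V} (X U : V) (HU : ultrafilter U X).
Implicit Types a b c d f h i j l m p q r s t u v w x y z T : V.

Local Notation seq := (is_seq X).
Local Notation concat := (concat X).
Local Notation large := (large_tree X U).
Local Notation cond := (tp_cond X U).
Local Notation le := (tp_le X U).

Lemma le_stem q s T : le q (op s T) <-> seq s /\ large T /\
  exists t T', q = op (concat s t) T' /\ large T' /\ t ∈ T /\ forall r, r ∈ T' -> concat t r ∈ T.
Proof.
  rewrite (tp_leE X U HU). split.
  - intros H. destruct (cond_inv _ _ _ (proj1 (proj2 H))) as (s' & T' & -> & Hs' & HT').
    apply below_op in H. destruct H as (Hs & HT & _ & _ & t & Ht & -> & K).
    repeat (split; [assumption|]). exists t, T'. tauto.
  - intros (Hs & HT & t & T' & -> & HT' & Ht & K). apply below_op.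
    repeat (split; [assumption|]). split; [apply concat_seq; [exact Hs|]; now apply (large_seq X U T)|].
    split; [exact HT'|]. now exists t.
Qed.

(** Used whenever a tree assembled from others is replaced by one of its constituents. *)
Lemma le_stem_compat q s T T' t T1 : seq s -> large T -> large T' ->
  q = op (concat s t) T1 -> large T1 -> t ∈ T -> t ∈ T' -> (forall r, r ∈ T1 -> concat t r ∈ T) ->
  exists r, le r q /\ le r (op s T').
Proof.
  intros Hs HT HT' -> HT1 Ht Ht' K. assert (Hst := large_seq _ _ _ _ HT Ht).
  exists (op (concat s t) (cap T1 (subtree X T' t))).
  assert (L : large (cap T1 (subtree X T' t))) by (apply (large_cap X U HU); [exact HT1|now apply large_subtree]).
  split.
  - apply le_stem. split; [now apply concat_seq|]. split; [exact HT1|].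
    exists emp, (cap T1 (subtree X T' t)). rewrite concat_emp. split; [reflexivity|].
    split; [exact L|]. split; [now apply (large_emp X U)|].
    intros r Hr. apply in_cap in Hr. rewrite (concat_emp_l X); [tauto|].
    now apply (large_seq X U T1).
  - apply le_stem. split; [exact Hs|]. split; [exact HT'|].
    exists t, (cap T1 (subtree X T' t)). split; [reflexivity|]. split; [exact L|].
    split; [exact Ht'|]. intros r Hr. apply in_cap in Hr. destruct Hr as [_ Hr].
    now apply in_subtree in Hr.
Qed.

Lemma le_direct s T T' : seq s -> large T -> large T' -> subset T' T -> le (op s T') (op s T).
Proof.
  intros Hs HT HT' H. apply le_stem. repeat (split; [assumption|]).
  exists emp, T'. rewrite concat_emp. split; [reflexivity|]. split; [exact HT'|].
  split; [now apply (large_emp X U)|]. intros r Hr. rewrite (concat_emp_l X); [auto|].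
  now apply (large_seq X U T').
Qed.

Definition dense (D : V -> V -> Prop) b q := forall r, le r q -> exists r', le r' r /\ D b r'.
Definition good (D : V -> V -> Prop) b s := exists T, large T /\ dense D b (op s T).

Section Stem.
Context (D : V -> V -> Prop) (dpD : definable (fun e => D (e 0) (e 1))).

Lemma dp_dense (t u : operation V) : dterm t -> dterm u ->
  definable (fun e => dense D (t e) (u e)).
Proof.
  apply (dp_app2 (fun x y => dense D x y)). unfold dense.
  repeat first [progress definability|apply dp_le; [exact HU|..]].
Qed.

Lemma dp_good (t u : operation V) : dterm t -> dterm u -> definable (fun e => good D (t e) (u e)).
Proof.
  apply (dp_app2 (fun x y => good D x y)). unfold good.
  repeat first [progress definability|apply dp_large|apply dp_dense].
Qed.

(** In place of choosing a tree for each [snoc s x], all the witnessing trees are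
    united; below each branch of the union one of them can be intersected back in. *)
Lemma good_fusion b s a : seq s -> a ∈ U -> (forall x, x ∈ a -> good D b (snoc s x)) ->
  good D b s.
Proof.
  intros Hs Ha Hgood.
  (* The union over all [x] and all trees witnessing that [snoc s x] is good. *)
  destruct (sep_set (fun t => t = emp \/ exists x r T, x ∈ X /\ t = cons x r /\ large T /\
      dense D b (op (snoc s x) T) /\ r ∈ T) (seqs X)) as [T HT].
  { repeat first [progress definability|apply dp_large|apply dp_dense]. }
  assert (inT : forall x r T', x ∈ X -> large T' -> dense D b (op (snoc s x) T') -> r ∈ T' ->
    cons x r ∈ T).
  { intros x r T' Hx HT' Hd Hr. apply HT. split.
    - apply in_seqs, seq_cons; [exact Hx|]. now apply (large_seq X U T').
    - right. now exists x, r, T'. }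
  assert (LT : large T).
  { apply (large_intro X U HU).
    - intros t Ht. apply HT in Ht. destruct Ht as [Ht _]. now apply in_seqs.
    - intros t y Ht Hy K. apply HT in K. destruct K as [_ [K|(x & r & T' & Hx & E & HT' & Hd & Hr)]].
      + exfalso. assert (K' : op (len t) y ∈ snoc t y) by (apply in_snoc; tauto).
        rewrite K in K'. now apply in_emp in K'.
      + assert (Sr := large_seq _ _ _ _ HT' Hr).
        destruct (seq_cases X t Ht) as [->|(x' & r' & Hx' & Hr' & ->)].
        * apply HT. split; [apply in_seqs, seq_emp|tauto].
        * rewrite <- (cons_snoc X) in E by exact Hr'.
          apply (cons_inj X) in E; [|now apply seq_snoc|exact Sr]. destruct E as [-> <-].
          apply (inT x r' T'); try assumption. now apply (large_snoc X U T' r' y).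
    - apply HT. split; [apply in_seqs, seq_emp|tauto].
    - intros t Ht. apply HT in Ht. destruct Ht as [_ [->|(x & r & T' & Hx & -> & HT' & Hd & Hr)]].
      + exists a. split; [exact Ha|]. intros x Hx. rewrite <- cons_emp.
        destruct (Hgood x Hx) as (T' & HT' & Hd). apply (inT x emp T'); try assumption.
        * now apply (U_subset X U HU a).
        * now apply (large_emp X U).
      + destruct (large_succ X U T' r HT' Hr) as (c & Hc & K). exists c. split; [exact Hc|].
        intros y Hy. apply K in Hy. rewrite <- (cons_snoc X); [|now apply (large_seq X U T')].
        now apply (inT x _ T'). }
  exists T. split; [exact LT|].
  assert (Branch : forall q x r T1, q = op (concat s (cons x r)) T1 -> large T1 -> x ∈ X -> seq r ->
    cons x r ∈ T -> (forall v, v ∈ T1 -> concat (cons x r) v ∈ T) -> exists q', le q' q /\ D b q').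
  { intros q x r T1 E HT1 Hx Sr Hxr K. assert (Hxr' := Hxr).
    apply HT in Hxr'. destruct Hxr' as [_ [F|(x' & r' & T' & Hx' & F & HT' & Hd & Hr')]].
    - exfalso. assert (K' : op emp x ∈ cons x r) by now apply op_in_cons_emp.
      rewrite F in K'. now apply in_emp in K'.
    - apply (cons_inj X) in F; [|exact Sr|now apply (large_seq X U T')].
      destruct F as [<- <-].
      assert (Sx : seq (snoc s x)) by now apply seq_snoc.
      assert (K1 : le (op (concat (snoc s x) r) (cap T1 (subtree X T' r))) q).
      { rewrite <- (concat_cons X) by assumption. subst q. apply le_direct; try assumption.
        - apply concat_seq; [exact Hs|]. now apply seq_cons.
        - apply (large_cap X U HU); [exact HT1|now apply large_subtree].
        - intros v Hv. now apply in_cap in Hv. }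
      destruct (Hd (op (concat (snoc s x) r) (cap T1 (subtree X T' r)))) as (q' & L1 & L2).
      { apply le_stem. repeat (split; [assumption|]). exists r, (cap T1 (subtree X T' r)).
        split; [reflexivity|]. split; [apply (large_cap X U HU); [exact HT1|now apply large_subtree]|].
        split; [exact Hr'|]. intros v Hv. apply in_cap in Hv. destruct Hv as [_ Hv].
        now apply in_subtree in Hv. }
      exists q'. split; [|exact L2]. now apply (le_trans X U HU) with (op (concat (snoc s x) r) (cap T1 (subtree X T' r))). }
  intros q Hq. apply le_stem in Hq. destruct Hq as (_ & _ & t & T1 & -> & HT1 & Ht & K).
  destruct (seq_cases X t) as [->|(x & r & Hx & Hr & ->)]; [now apply (large_seq X U T)| |].
  - destruct (large_succ X U T1 emp HT1) as (c & Hc & L); [now apply (large_emp X U)|].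
    destruct (U_inhabited X U HU c Hc) as (x & Hx). apply L in Hx. destruct Hx as [Hx Hx'].
    assert (Sx : seq (snoc emp x)) by (apply seq_snoc; [apply seq_emp|exact Hx]).
    assert (HxT : cons x emp ∈ T).
    { rewrite cons_emp. rewrite <- (concat_emp_l X (snoc emp x)) by exact Sx. now apply K. }
    destruct (Branch (op (concat s (cons x emp)) (subtree X T1 (snoc emp x))) x emp (subtree X T1 (snoc emp x)))
      as (q' & L1 & L2); try assumption; try reflexivity.
    + now apply large_subtree.
    + apply seq_emp.
    + intros v Hv. apply in_subtree in Hv. destruct Hv as [Sv Hv]. apply K in Hv.
      rewrite (concat_emp_l X) in Hv; [now rewrite cons_emp|now apply concat_seq].
    + exists q'. split; [|exact L2]. apply (le_trans X U HU) with (2 := L1).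
      apply le_stem. rewrite concat_emp. split; [exact Hs|]. split; [exact HT1|].
      exists (snoc emp x), (subtree X T1 (snoc emp x)). rewrite cons_emp. split; [reflexivity|].
      split; [now apply large_subtree|]. split; [exact Hx'|]. intros v Hv. now apply in_subtree in Hv.
  - now apply (Branch _ x r T1).
Qed.

(** If [s] is bad for every [b] below [rho], then [U]-many of its one-point extensions
    are bad, for otherwise [Hadd] and [good_fusion] would make [s] good. Thus there is
    a large tree of bad stems, but some extension within this tree is in one of the
    sets [D b]. *)
Lemma stem_decides rho s T :
  (forall b q r, D b q -> le r q -> D b r) ->
  (forall s c, seq s -> c ∈ U -> (forall x, x ∈ c <-> x ∈ X /\ exists b, b ∈ rho /\ good D b (snoc s x)) ->
     exists b c', b ∈ rho /\ c' ∈ U /\ forall x, x ∈ c' -> good D b (snoc s x)) ->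
  seq s -> large T ->
  (forall q, le q (op s T) -> exists r b, le r q /\ b ∈ rho /\ D b r) ->
  exists b, b ∈ rho /\ good D b s.
Proof.
  intros Hopen Hadd Hs HT Hdense. apply NNPP. intros Nbad.
  set (bad := fun s => ~ exists b, b ∈ rho /\ good D b s).
  assert (dpbad : definable (fun e => bad (e 0))) by (unfold bad; definability; apply dp_good; definability).
  assert (Step : forall s, seq s -> bad s -> exists c, c ∈ U /\ forall x, x ∈ c <-> x ∈ X /\ bad (snoc s x)).
  { intros s' Hs' Hb.
    destruct (U_split X U HU (fun x => bad (snoc s' x))) as (c & Uc & [Hc|Hc]); [definability|now exists c|].
    exfalso. apply Hb. destruct (Hadd s' c Hs' Uc) as (b & d & Hbr & Hd & L).
    - intros x. rewrite Hc. unfold bad. split; intros [Hx M]; (split; [exact Hx|]).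
      + now apply NNPP in M.
      + tauto.
    - exists b. split; [exact Hbr|]. now apply (good_fusion b s' d). }
  destruct (sep_set (fun t => forall u, seq u -> subset u t -> bad (concat s u)) (seqs X)) as [T' HT'];
    [definability|].
  assert (LT : large T').
  { apply (large_intro X U HU).
    - intros t Ht. apply HT' in Ht. now apply in_seqs.
    - intros t x Ht Hx K. apply HT' in K. apply HT'. split; [now apply in_seqs|].
      intros u Hu L. apply K; [exact Hu|]. intros w Hw. apply in_snoc. left. now apply L.
    - apply HT'. split; [apply in_seqs, seq_emp|]. intros u Hu L.
      rewrite (subset_emp u L), concat_emp. exact Nbad.
    - intros t Ht. apply HT' in Ht. destruct Ht as [Ht K]. apply in_seqs in Ht.
      destruct (Step (concat s t)) as (c & Hc & L).
      + now apply concat_seq.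
      + apply K; [exact Ht|]. now intros w.
      + exists c. split; [exact Hc|]. intros x Hx. apply L in Hx. destruct Hx as [Hx B].
        apply HT'. split; [apply in_seqs; now apply seq_snoc|]. intros u Hu M.
        destruct (subset_snoc X u t x Hu Ht Hx M) as [M'| ->]; [now apply K|].
        now rewrite concat_snoc. }
  assert (LC : large (cap T T')) by now apply (large_cap X U HU).
  destruct (Hdense (op s (cap T T'))) as (r & b & Hr & Hb & Db).
  { apply le_direct; try assumption. intros t Ht. now apply in_cap in Ht. }
  apply le_stem in Hr. destruct Hr as (_ & _ & t & T1 & -> & HT1 & Ht & _).
  apply in_cap in Ht. destruct Ht as [_ Ht]. apply HT' in Ht. destruct Ht as [Ht K].
  apply in_seqs in Ht. apply (K t Ht); [now intros w|].
  exists b. split; [exact Hb|]. exists T1. split; [exact HT1|].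
  intros q Hq. exists q. split; [apply (le_refl X U HU)|now apply (Hopen b _ q Db)].
  now apply (le_cond_l X U q (op (concat s t) T1)).
Qed.

End Stem.

(** Direct extensions, one for each element of [a], are amalgamated canonically: the
    successors admitted for [i] are those admitted by some tree related to [i]. *)
Lemma large_amalgam a (R : V -> V -> Prop) T : definable (fun e => R (e 0) (e 1)) ->
  closed_under_inter U X a -> large T ->
  (forall i, i ∈ a -> exists T', R i T') ->
  (forall i T', i ∈ a -> R i T' -> large T') ->
  exists T1, large T1 /\ subset T1 T /\
    forall t i, t ∈ T1 -> i ∈ a -> exists T', R i T' /\ t ∈ T'.
Proof.
  intros dpR Hcl HT Hex Hlarge.
  destruct (sep_set (fun t => forall i, i ∈ a -> exists T', R i T' /\ t ∈ T') T) as [T1 HT1]; [definability|].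
  exists T1. split; [|split].
  - apply (large_intro X U HU).
    + intros t Ht. apply HT1 in Ht. now apply (large_seq X U T).
    + intros t x Ht Hx K. apply HT1 in K. destruct K as [K1 K2]. apply HT1.
      split; [now apply (large_snoc X U T t x)|]. intros i Hi.
      destruct (K2 i Hi) as (T' & HR & L). exists T'. split; [exact HR|].
      apply (large_snoc X U T' t x); try assumption. now apply (Hlarge i).
    + apply HT1. split; [now apply (large_emp X U)|]. intros i Hi.
      destruct (Hex i Hi) as (T' & HR). exists T'. split; [exact HR|].
      apply (large_emp X U). now apply (Hlarge i).
    + intros t Ht. apply HT1 in Ht. destruct Ht as [Ht K].
      destruct (large_succ X U T t HT Ht) as (c & Hc & Lc).
      destruct (fun_of_rel (fun i w => forall x, x ∈ w <-> x ∈ X /\ exists T', R i T' /\ snoc t x ∈ T') a U)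
        as (f & Hf & Ef).
      * definability.
      * intros i Hi. destruct (sep_set (fun x => exists T', R i T' /\ snoc t x ∈ T') X) as [w Hw]; [definability|].
        exists w. split; [|exact Hw]. destruct (K i Hi) as (T' & HR & Ht').
        destruct (large_succ X U T' t (Hlarge i T' Hi HR) Ht') as (d & Hd & Ld).
        apply (U_up X U HU d); [exact Hd| |intros x Hx; now apply Hw in Hx].
        intros x Hx. apply Ld in Hx. apply Hw. split; [tauto|]. exists T'. tauto.
      * intros i w w' _ H H'. apply ext. intros x. now rewrite H, H'.
      * destruct (sep_set (fun x => forall i w, rel f i w -> x ∈ w) X) as [d Hd]; [definability|].
        assert (Ud : d ∈ U) by now apply (Hcl f Hf).
        exists (cap c d). split; [now apply (U_cap X U HU)|]. intros x Hx.
        apply in_cap in Hx. destruct Hx as [Hx Hx']. apply Lc in Hx. apply Hd in Hx'.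
        apply HT1. split; [tauto|]. intros i Hi.
        destruct (fun_total _ Hf Hi) as [w Hw].
        assert (Hxw : x ∈ w) by (apply (proj2 Hx' i); now apply relE).
        apply Ef in Hw. destruct Hw as [_ Hw]. now apply Hw in Hxw.
  - intros t Ht. now apply HT1 in Ht.
  - intros t i Ht Hi. apply HT1 in Ht. now apply Ht.
Qed.

End Prikry.

(** * Cofinal sequences in the extension *)

Section CofinalSequences.
Context {V : structure} {HV : @ZF V} (X U : V) (HU : ultrafilter U X).
Implicit Types a b c d f g h i j l m p q r s t u v w x y z T : V.

Local Notation cond := (tp_cond X U).
Local Notation le := (tp_le X U).
Local Notation one := (op emp (seqs X)).

(** If some well-ordered family has its intersection outside [U], the least length of
    such a family is the completeness of [U]. Otherwise there is no completeness, and
    the conclusion holds for every ordinal. *)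
Lemma closed_below_cp tau : is_ord tau ->
  (forall k, is_cp U X k -> tau ∈ k) ->
  forall l, l ∈ tau \/ l = tau -> closed_under_inter U X l.
Proof.
  intros Ht Hcp l Hl.
  assert (Ol : is_ord l) by (destruct Hl as [Hl| ->]; [now apply (ord_elem tau)|exact Ht]).
  apply NNPP. intros N.
  destruct (ord_least (fun l => ~ closed_under_inter U X l) l) as (m & Om & Nm & _ & Hm);
    [unfold closed_under_inter; definability|exact Ol|exact N|].
  assert (K : is_cp U X m); [|].
  - split; [|split].
    + split; [exact Om|]. intros a Ha (f & Hf & _ & Hsurj). apply Nm.
      assert (Ca : closed_under_inter U X a) by (apply NNPP; now apply Hm).
      intros g Hg c Hc.
      destruct (fun_of_rel (fun i u => exists j, op i j ∈ f /\ op j u ∈ g) a U) as (h & Hh & Eh).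
      * definability.
      * intros i Hi. destruct (fun_total _ Hf Hi) as [j Hj].
        destruct (fun_bounds Hf Hj) as [_ Mj].
        destruct (fun_total _ Hg Mj) as [u Hu]. exists u.
        split; [now apply (fun_bounds Hg) in Hu|]. now exists j.
      * intros i u u' _ (j & H1 & H2) (j' & H1' & H2').
        rewrite (fun_unique Hf H1' H1) in H2'.
        exact (fun_unique Hg H2 H2').
      * apply (Ca h Hh). intros x. rewrite Hc. split; intros [Hx L]; (split; [exact Hx|]).
        -- intros i u Hiu. apply relE, Eh in Hiu. destruct Hiu as (_ & j & _ & Hju).
           apply (L j). now apply relE.
        -- intros j u Hju. apply relE in Hju.
           destruct (Hsurj j) as (i & Hij); [now apply (fun_bounds Hg) in Hju|].
           apply relE in Hij. apply (L i). apply relE, Eh.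
           split; [now apply (fun_bounds Hf) in Hij|]. now exists j.
    + intros a Ha. apply NNPP. now apply Hm.
    + intros k [Ok _] Hk. apply ord_subset; try assumption. intros L. now apply Nm, Hk.
  - apply Hcp in K. apply (Hm l); [|exact N].
    destruct Hl as [Hl| ->]; [|exact K]. now apply (ord_trans m tau).
Qed.

Lemma cond_one : cond one.
Proof. apply cond_op. split; [apply seq_emp|now apply large_seqs]. Qed.

Lemma cond_definable : definable (fun e => cond (e 0)).
Proof. apply dp_cond. definability. Qed.

Lemma le_definable : definable (fun e => le (e 0) (e 1)).
Proof. apply dp_le; [exact HU|definability..]. Qed.

Local Notation tp_forcing thm := (thm cond le one (cond_set X U) cond_definable le_definable
  (le_refl X U HU) (le_trans X U HU) (le_cond_l X U) (le_one X U HU) cond_one).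

Section Decision.
Context p f (tau rho : V) (Hf : is_name cond f) (Hp : cond p)
  (Hcof : forces cond le p (scons f (scons (check one tau) (fun _ => check one rho)))
            (F_cofinal_map 0 1 2)).
Context (Orho : is_ord rho) (Hclosed : closed_under_inter U X tau).

Definition forced_at q x y := forces_mem cond le q (check one (op x y)) f.

Context (near : V -> V -> Prop) (dpnear : definable (fun e => near (e 0) (e 1)))
  (near_refl : forall b, near b b).

(** [near y b] is [y <= b] when bounds on the forced values suffice and [y = b] when
    the values can be decided. *)
Definition decides x b q := exists y, y ∈ rho /\ near y b /\ forced_at q x y.

Context (Huniform : forall x s c, is_seq X s -> c ∈ U ->
  (forall z, z ∈ c <-> z ∈ X /\ exists b, b ∈ rho /\ good X U (decides x) b (snoc s z)) ->
  exists b c', b ∈ rho /\ c' ∈ U /\ forall z, z ∈ c' -> good X U (decides x) b (snoc s z)).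

Lemma dp_decides : definable (fun e => decides (e 0) (e 1) (e 2)).
Proof.
  assert (C := cond_definable). assert (L := le_definable).
  assert (E : definable (fun e => forces_eq cond le (e 0) (e 1) (e 2))) by (apply dp_forces_eq; definability).
  unfold decides, forced_at, forces_mem. repeat first [progress definability|apply dt_check].
Qed.

Lemma forced_at_mono q r x y : le r q -> forced_at q x y -> forced_at r x y.
Proof. apply MEM_mono. exact (le_trans X U HU). Qed.

(** For each [x] take the least [b] for which the stem of [p] is good, and amalgamate
    the trees. *)
Lemma decide_all : exists g q, is_fun g tau rho /\ le q p /\
  forall x b, op x b ∈ g -> dense X U (decides x) b q.
Proof.
  destruct (cond_inv _ _ _ Hp) as (s & T & E & Hs & HT).
  assert (dpD := dp_decides).
  assert (dpG : definable (fun e => good X U (decides (e 0)) (e 1) s)).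
  { assert (L := le_definable). unfold good, dense. repeat first [progress definability|apply dp_large]. }
  assert (Hgood : forall x, x ∈ tau -> exists b, b ∈ rho /\ good X U (decides x) b s).
  { intros x Hx. apply (stem_decides X U HU _) with (T := T); try assumption.
    - exact (dp_app3 _ _ _ _ dpD (dt_const x) (dt_index 0) (dt_index 1)).
    - intros b q r (y & Hy & Hn & K) Hr. exists y. split; [exact Hy|]. split; [exact Hn|].
      now apply (forced_at_mono q).
    - intros s' c. apply Huniform.
    - intros q Hq. rewrite <- E in Hq.
      destruct (tp_forcing forced_value p f tau rho Hf Hp Hcof x q Hx Hq) as (r & y & Hr & Hy & K).
      exists r, y. split; [exact Hr|]. split; [exact Hy|]. now exists y. }
  destruct (fun_of_rel (fun x b => b ∈ rho /\ good X U (decides x) b s /\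
    forall b', b' ∈ b -> ~ good X U (decides x) b' s) tau rho) as (g & Hg & Eg).
  - repeat apply dp_and; [definability|exact dpG|]. apply dp_all, dp_imp; [definability|]. apply dp_not.
    exact (dp_app2 (fun x b => good X U (decides x) b s) _ _ dpG (dt_index 1) (dt_index 0)).
  - intros x Hx. destruct (Hgood x Hx) as (b0 & Hb0 & K0).
    destruct (ord_least (fun b => good X U (decides x) b s) b0) as (b & Ob & Kb & Sb & Lb).
    + exact (dp_app2 (fun x b => good X U (decides x) b s) _ _ dpG (dt_const x) (dt_index 0)).
    + now apply (ord_elem rho).
    + exact K0.
    + assert (b ∈ rho).
      { destruct (ord_trichotomy b rho Ob Orho) as [H|[->|H]]; [exact H| |].
        - apply Sb in Hb0. now apply mem_irrefl in Hb0.
        - apply Sb in H. now apply mem_asym in H. }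
      exists b. tauto.
  - intros x b b' _ (Hb & Kb & Lb) (Hb' & Kb' & Lb').
    destruct (ord_trichotomy b b') as [H|[H|H]]; [now apply (ord_elem rho)..| |exact H|].
    + now apply Lb' in H.
    + now apply Lb in H.
  - destruct (large_amalgam X U HU tau (fun x T' => exists b, op x b ∈ g /\
      large_tree X U T' /\ dense X U (decides x) b (op s T')) T) as (T1 & HT1 & Sub & HT1'); auto.
    + assert (L := le_definable). unfold dense. repeat first [progress definability|apply dp_large].
    + intros x Hx. destruct (fun_total _ Hg Hx) as [b Hb]. assert (K := Hb).
      apply Eg in K. destruct K as (_ & _ & (T' & HT' & Hd) & _). exists T', b. tauto.
    + intros x T' _ (b & _ & H & _). exact H.
    + exists g, (op s T1). split; [exact Hg|]. split; [rewrite E; now apply le_direct|].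
      intros x b Hxb q Hq. assert (Pq := le_cond_l _ _ _ _ Hq).
      assert (Hq' := Hq). apply (le_stem X U HU) in Hq'. destruct Hq' as (_ & _ & t & T2 & Eq & HT2 & Ht & K).
      destruct (HT1' t x Ht) as (T' & (b' & Hb' & HT' & Hd) & Ht').
      { now apply (fun_bounds Hg) in Hxb. }
      rewrite (fun_unique Hg Hb' Hxb) in Hd.
      destruct (le_stem_compat X U HU q s T1 T' t T2) as (r & Hr & Hr'); try assumption.
      destruct (Hd r Hr') as (r' & L & M). exists r'. split; [|exact M].
      now apply (le_trans X U HU) with r.
Qed.

End Decision.

(** The sets of all [x] with [G b x] increase with [b]; if none of them is in [U],
    they decompose [U]. *)
Lemma indecomposable_uniform rho (G : V -> V -> Prop) c : definable (fun e => G (e 0) (e 1)) ->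
  ~ decomposable U rho ->
  (forall a b x, a ∈ b -> b ∈ rho -> G a x -> G b x) ->
  c ∈ U -> (forall x, x ∈ c <-> x ∈ X /\ exists b, b ∈ rho /\ G b x) ->
  exists b c', b ∈ rho /\ c' ∈ U /\ forall x, x ∈ c' -> G b x.
Proof.
  intros dpG Hind Hmono Uc Hc. apply NNPP. intros N. apply Hind.
  destruct (fun_on_of_rel (fun b z => forall x, x ∈ z <-> x ∈ X /\ G b x) rho) as (f & Hf & Ef).
  - definability.
  - intros b _. apply sep_set. exact (dp_app2 G _ _ dpG (dt_const b) (dt_index 0)).
  - intros b z z' _ H H'. apply ext. intros x. now rewrite H, H'.
  - exists f. split; [exact Hf|]. split; [|split].
    + intros b z Hbz Hz. apply relE, Ef in Hbz. destruct Hbz as [Hb K]. apply N.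
      exists b, z. split; [exact Hb|]. split; [exact Hz|]. intros x Hx. now apply K.
    + exists c. split; [exact Uc|]. intros x. rewrite Hc. split.
      * intros (Hx & b & Hb & K). destruct Hf as [d Hf].
        destruct (fun_total _ Hf Hb) as [z Hz]. exists b, z.
        split; [exact Hb|]. split; [now apply relE|]. apply Ef in Hz. now apply Hz.
      * intros (b & z & Hb & Hz & Hx). apply relE, Ef in Hz. destruct Hz as [_ Hz].
        apply Hz in Hx. split; [tauto|]. exists b. tauto.
    + intros b Hb u Hu Uu. apply N. exists b, u. split; [exact Hb|]. split; [exact Uu|].
      intros x Hx. apply Hu in Hx. destruct Hx as (a & z & Ha & Hz & Hx).
      apply relE, Ef in Hz. destruct Hz as [_ Hz]. apply Hz in Hx. apply (Hmono a b); tauto.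
Qed.

(** If none of the sets of all [x] with [G b x] is in [U], their complements are, and
    so is the intersection of the complements, which is disjoint from [c]. *)
Lemma complete_uniform rho (G : V -> V -> Prop) c : definable (fun e => G (e 0) (e 1)) ->
  closed_under_inter U X rho ->
  c ∈ U -> (forall x, x ∈ c <-> x ∈ X /\ exists b, b ∈ rho /\ G b x) ->
  exists b c', b ∈ rho /\ c' ∈ U /\ forall x, x ∈ c' -> G b x.
Proof.
  intros dpG Hcl Uc Hc. apply NNPP. intros N.
  assert (dpG' : forall b, definable (fun e => G b (e 0)))
    by (intros b; exact (dp_app2 G _ _ dpG (dt_const b) (dt_index 0))).
  destruct (fun_of_rel (fun b z => forall x, x ∈ z <-> x ∈ X /\ ~ G b x) rho U) as (f & Hf & Ef).
  - definability.
  - intros b Hb. destruct (U_split X U HU (fun x => G b x)) as (z & Uz & [Hz|Hz]); [apply dpG'| |now exists z].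
    destruct N. exists b, z. split; [exact Hb|]. split; [exact Uz|]. intros x Hx. now apply Hz.
  - intros b z z' _ H H'. apply ext. intros x. now rewrite H, H'.
  - destruct (sep_set (fun x => forall i a, rel f i a -> x ∈ a) X) as [d Hd]; [definability; apply dp_rel; definability|].
    assert (Ud : d ∈ U) by now apply (Hcl f Hf).
    destruct (U_inhabited X U HU _ (U_cap X U HU _ _ Uc Ud)) as (x & Hx).
    apply in_cap in Hx. destruct Hx as [Hx Hx']. apply Hc in Hx. apply Hd in Hx'.
    destruct Hx as (_ & b & Hb & K). destruct (fun_total _ Hf Hb) as [z Hz].
    assert (Hxz : x ∈ z) by (apply (proj2 Hx' b); now apply relE).
    apply Ef in Hz. destruct Hz as [_ Hz]. now apply Hz in Hxz.
Qed.

Lemma dense_weaken (D D' : V -> V -> Prop) b b' q :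
  (forall r, D b r -> D' b' r) -> dense X U D b q -> dense X U D' b' q.
Proof. intros H K r Hr. destruct (K r Hr) as (r' & L & M). exists r'. auto. Qed.

Theorem no_new_cofinal_map tau rho : regular rho -> ~ decomposable U rho -> is_ord tau ->
  (forall l, l ∈ tau \/ l = tau -> closed_under_inter U X l) ->
  ~ tree_prikry_adds_cofinal X U tau rho.
Proof.
  intros Hrho Hind Ht Hcl (o & p & f & l' & r' & Ho & Hp & Hf & Hl & Hr & Hcof & Hnew).
  apply (is_tp_oneE X) in Ho. subst o. apply check_eq in Hl, Hr. subst l' r'.
  assert (Orho := regular_ord _ Hrho).
  assert (Unique := tp_forcing forced_value_unique p f tau rho Hf Hp Hcof).
  assert (Cofinal := tp_forcing forced_cofinal p f tau rho Hf Hp Hcof).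
  assert (Ground := tp_forcing forced_ground p f tau rho Hf Hp Hcof).
  assert (dpgood : forall near x s, definable (fun e => near (e 0) (e 1)) ->
    definable (fun e => good X U (decides f rho near x) (e 0) (snoc s (e 1)))).
  { intros near x s Hnear. assert (D := dp_decides f rho near Hnear).
    apply (dp_good X U HU (decides f rho near x)); [|definability..].
    exact (dp_app3 _ _ _ _ D (dt_const x) (dt_index 0) (dt_index 1)). }
  destruct (classic (tau ∈ rho)) as [Hlt|Hge].
  - set (near := fun y b : V => y ∈ b \/ y = b).
    assert (dpn : definable (fun e => near (e 0) (e 1))) by (unfold near; definability).
    destruct (decide_all p f tau rho Hf Hp Hcof Orho (Hcl tau (or_intror eq_refl)) near dpn)
      as (g & q & Hg & Hq & K).
    + intros b. now right.
    + intros x s c Hs Uc Hc.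
      apply (indecomposable_uniform rho (fun b z => good X U (decides f rho near x) b (snoc s z)) c); auto.
      intros a b z Hab Hb (T & HT & Hd). exists T. split; [exact HT|]. revert Hd.
      apply dense_weaken. intros r (y & Hy & Hn & M). exists y. split; [exact Hy|].
      split; [|exact M]. left. destruct Hn as [Hn| ->]; [|exact Hab].
      apply (ord_trans b a); try assumption. now apply (ord_elem rho).
    + destruct (regular_unbounded rho g tau rho Hrho Hlt Hg) as (c & Hc & Bound).
      destruct (Cofinal c q Hc Hq) as (r & x & y & Hr & Hx & Hy & M & Hcy).
      destruct (fun_total _ Hg Hx) as [b Hb].
      destruct (K x b Hb r Hr) as (r' & Hr' & y' & Hy' & Hn & M').
      assert (y = y') as <-.
      { apply (Unique x y y' r'); [|now apply (forced_at_mono f r)|exact M'].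
        apply (le_trans X U HU) with r; [|exact Hr']. now apply (le_trans X U HU) with q. }
      assert (Oc := ord_elem _ _ Orho Hc). assert (Hbc := Bound x b Hb).
      assert (Hyc : y ∈ c) by (destruct Hn as [Hn| ->]; [now apply (ord_trans c b)|exact Hbc]).
      destruct Hcy as [Hcy| ->]; [now apply mem_asym in Hcy|now apply mem_irrefl in Hyc].
  - set (near := fun y b : V => y = b).
    assert (dpn : definable (fun e => near (e 0) (e 1))) by (unfold near; definability).
    destruct (decide_all p f tau rho Hf Hp Hcof Orho (Hcl tau (or_intror eq_refl)) near dpn)
      as (g & q & Hg & Hq & K).
    + intros b. reflexivity.
    + intros x s c Hs Uc Hc.
      apply (complete_uniform rho (fun b z => good X U (decides f rho near x) b (snoc s z)) c); auto.
      apply Hcl. destruct (ord_trichotomy rho tau Orho Ht) as [H|[H|H]]; tauto.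
    + apply (Hnew q g (check one g) Hq); [apply check_spec|].
      apply (Ground g q Hg Hq). intros x b Hb.
      apply MEM_local; [exact (le_refl X U HU)|exact (le_trans X U HU)|exact (le_cond_l X U)|].
      intros r Hr. destruct (K x b Hb r Hr) as (r' & Hr' & y & _ & -> & M). now exists r'.
Qed.

End CofinalSequences.

(** * Elementary embeddings and external formulas *)

Section Elementarity.
Context {V : structure} {HV : @ZF V}.
Implicit Types (a b c d h p q r s t u v w x y z : V) (A B C : formula).

Fixpoint num (n : nat) : V := match n with O => emp | S k => suc (num k) end.

Lemma is_numE k x : is_num k x <-> x = num k.
Proof.
  revert x. induction k as [|k IH]; intros x; simpl; [apply is_emptyE|]. split.
  - intros (y & Hy & H). apply IH in Hy. apply is_succE in H. now subst.
  - intros ->. exists (num k). split; [now apply IH|now apply is_succE].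
Qed.

Lemma num_nat n : is_nat (num n).
Proof. induction n; simpl; [apply nat_emp|now apply nat_suc]. Qed.

Lemma num_inj m : forall n, num m = num n -> m = n.
Proof.
  assert (N : forall x, suc x <> emp).
  { intros x H. apply (in_emp x). rewrite <- H. apply in_suc. tauto. }
  induction m as [|m IH]; intros [|n] H; simpl in H; [reflexivity| | |].
  - now destruct (N (num n)).
  - now destruct (N (num m)).
  - f_equal. apply IH. now apply suc_inj.
Qed.

Lemma taggedE k c x : tagged k c x <-> c = op (num k) x.
Proof.
  unfold tagged. split.
  - intros (m & Hm & H). apply is_numE in Hm. apply is_opairE in H. now subst.
  - intros ->. exists (num k). split; [now apply is_numE|now apply is_opairE].
Qed.

Lemma tagged2E k c x y : tagged2 k c x y <-> c = op (num k) (op x y).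
Proof.
  unfold tagged2. split.
  - intros (z & Hz & H). apply is_opairE in Hz. apply taggedE in H. now subst.
  - intros ->. exists (op x y). split; [now apply is_opairE|now apply taggedE].
Qed.

Fixpoint code A : V :=
  match A with
  | fmem i j => op (num 0) (op (num i) (num j))
  | feq i j => op (num 1) (op (num i) (num j))
  | fneg B => op (num 2) (code B)
  | fand B C => op (num 3) (op (code B) (code C))
  | fall B => op (num 4) (code B)
  end.

Lemma tag_inj m n x y : op (num m) x = op (num n) y -> m = n /\ x = y.
Proof. intros E. apply op_inj in E as [E ->]. now apply num_inj in E. Qed.

Lemma code_inj A : forall B, code A = code B -> A = B.
Proof.
  induction A as [i j|i j|A IH|A IHA A' IHA'|A IH]; intros [i' j'|i' j'|B|B B'|B] E;
    cbn [code] in E; apply tag_inj in E; destruct E as [T E]; try discriminate T.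
  - apply op_inj in E as [E1 E2]. apply num_inj in E1, E2. now subst.
  - apply op_inj in E as [E1 E2]. apply num_inj in E1, E2. now subst.
  - f_equal. auto.
  - apply op_inj in E as [E1 E2]. f_equal; auto.
  - f_equal. auto.
Qed.

Fixpoint subformulas A : list formula :=
  (A :: match A with
        | fneg B => subformulas B
        | fand B C => subformulas B ++ subformulas C
        | fall B => subformulas B
        | _ => nil
        end)%list.

Lemma subformulas_self A : List.In A (subformulas A).
Proof. destruct A; simpl; tauto. Qed.

Lemma subformulas_closed A C : List.In C (subformulas A) ->
  match C with
  | fneg B => List.In B (subformulas A)
  | fand B B' => List.In B (subformulas A) /\ List.In B' (subformulas A)
  | fall B => List.In B (subformulas A)
  | _ => True
  end.
Proof.
  assert (S := subformulas_self).
  induction A as [i j|i j|A IH|A IHA A' IHA'|A IH]; simpl; intros [<-|H];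
    try tauto; auto.
  - destruct C; auto. split; right; now apply IH.
  - split; right; apply List.in_or_app; auto.
  - apply List.in_app_or in H. destruct H as [H|H]; [apply IHA in H|apply IHA' in H];
      destruct C; auto; try (right; apply List.in_or_app; now auto);
      (split; right; apply List.in_or_app; tauto).
  - destruct C; auto. split; right; now apply IH.
Qed.

Lemma list_set (F : formula -> V -> Prop) l : (forall B, is_set (F B)) ->
  is_set (fun x => exists B, List.In B l /\ F B x).
Proof.
  intros HF. induction l as [|B l IH].
  - exists emp. intros x. split; [intros H; now apply in_emp in H|intros (B & [] & _)].
  - destruct IH as [b Hb]. destruct (HF B) as [c Hc]. exists (cup c b). intros x.
    rewrite in_cup, Hb, Hc. split.
    + intros [H|(C & H & K)]; [exists B|exists C]; simpl; tauto.
    + intros (C & [<-|H] & K); [tauto|right; now exists C].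
Qed.

(** For an external formula this set is finite, so it and the table below are obtained
    by induction on the list of subformulas. *)
Definition codes A : V := setof (fun c => exists B, List.In B (subformulas A) /\ c = code B).

Lemma in_codes c A : c ∈ codes A <-> exists B, List.In B (subformulas A) /\ c = code B.
Proof.
  revert c. apply setofP. apply (list_set (fun B c => c = code B)). intros B.
  exists (sing (code B)). intros x. apply in_sing.
Qed.

Lemma formula_setE t : formula_set t <-> forall c, c ∈ t ->
  (exists i j : V, is_nat i /\ is_nat j /\ (c = op (num 0) (op i j) \/ c = op (num 1) (op i j))) \/
  (exists a, a ∈ t /\ c = op (num 2) a) \/
  (exists a b, a ∈ t /\ b ∈ t /\ c = op (num 3) (op a b)) \/
  (exists a, a ∈ t /\ c = op (num 4) a).
Proof.
  unfold formula_set, code_mem, code_eq, code_neg, code_and, code_all.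
  setoid_rewrite tagged2E. setoid_rewrite taggedE. reflexivity.
Qed.

Lemma codes_formula_set A : formula_set (codes A).
Proof.
  apply formula_setE. intros c Hc. apply in_codes in Hc. destruct Hc as (B & HB & ->).
  assert (K := subformulas_closed A B HB).
  assert (I : forall C, List.In C (subformulas A) -> code C ∈ codes A)
    by (intros C HC; apply in_codes; now exists C).
  destruct B as [i j|i j|B|B C|B]; cbn [code].
  - left. exists (num i), (num j). auto using num_nat.
  - left. exists (num i), (num j). auto using num_nat.
  - right. left. exists (code B). auto.
  - right. right. left. exists (code B), (code C). destruct K. auto.
  - right. right. right. exists (code B). auto.
Qed.

Lemma formula_set_closed t A : formula_set t -> code A ∈ t ->
  match A with
  | fneg B => code B ∈ t
  | fand B C => code B ∈ t /\ code C ∈ t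
  | fall B => code B ∈ t
  | _ => True
  end.
Proof.
  rewrite formula_setE. intros H K. apply H in K.
  destruct A as [i j|i j|B|B C|B]; trivial; cbn [code] in K;
    destruct K as [(i & j & _ & _ & [E|E])|[(a & Ha & E)|[(a & b & Ha & Hb & E)|(a & Ha & E)]]];
    apply tag_inj in E; destruct E as [T E]; try discriminate T; try now subst.
  apply op_inj in E. destruct E; now subst.
Qed.

Lemma code_is_code A : is_code (code A).
Proof.
  exists (codes A). split; [apply codes_formula_set|]. apply in_codes.
  exists A. split; [apply subformulas_self|reflexivity].
Qed.

(** ** Satisfaction *)

Lemma assignmentE e a : assignment e a <-> is_fun e omega a.
Proof.
  split.
  - intros (w & Hw & H). apply is_omegaE in Hw. now subst.
  - intros H. exists omega. split; [now apply is_omegaE|exact H].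
Qed.

Lemma assignment_cons x e a : x ∈ a -> assignment e a -> assignment (cons x e) a.
Proof.
  rewrite !assignmentE. intros Hx He. assert (F := He). apply is_funE in F.
  destruct F as (F1 & F2 & F3). apply is_funE. split; [|split].
  - intros w Hw. apply in_cons in Hw. destruct Hw as [->|(i & y & Hiy & ->)].
    + exists emp, x. split; [apply in_omega, nat_emp|tauto].
    + apply (fun_bounds He) in Hiy. exists (suc i), y.
      split; [apply in_omega, nat_suc, in_omega|]; tauto.
  - intros i Hi. apply in_omega in Hi. destruct (nat_cases _ Hi) as [->|(k & Hk & ->)].
    + exists x. now apply op_in_cons_emp.
    + destruct (F2 k) as [y Hy]; [now apply in_omega|]. exists y. now apply op_in_cons_suc.
  - intros i y y' H H'.
    assert (Hi : i = emp \/ exists k, i = suc k).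
    { apply in_cons in H. destruct H as [H|(k & z & _ & H)]; apply op_inj in H;
        destruct H as [-> _]; [now left|right; now exists k]. }
    destruct Hi as [->|(k & ->)].
    + apply op_in_cons_emp in H, H'. congruence.
    + apply op_in_cons_suc in H, H'. now apply (F3 k).
Qed.

Fixpoint sat_at a A (e : V) : Prop :=
  match A with
  | fmem i j => exists x y, op (num i) x ∈ e /\ op (num j) y ∈ e /\ x ∈ y
  | feq i j => exists x, op (num i) x ∈ e /\ op (num j) x ∈ e
  | fneg B => ~ sat_at a B e
  | fand B C => sat_at a B e /\ sat_at a C e
  | fall B => forall x, x ∈ a -> sat_at a B (cons x e)
  end.

Lemma dp_sat_at a A : forall t : (nat -> V) -> V, dterm t ->
  definable (fun e => sat_at a A (t e)).
Proof.
  induction A as [i j|i j|A IH|A IHA B IHB|A IH]; intros t Ht; cbn [sat_at].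
  - definability.
  - definability.
  - apply dp_not, IH, Ht.
  - apply dp_and; auto.
  - apply dp_all, dp_imp; [definability|]. apply IH. definability.
Qed.

Lemma sat_tableE a t s : sat_table a t s <->
  forall c e, c ∈ t -> assignment e a ->
    (forall i j, c = op (num 0) (op i j) ->
       (op c e ∈ s <-> exists x y, op i x ∈ e /\ op j y ∈ e /\ x ∈ y)) /\
    (forall i j, c = op (num 1) (op i j) ->
       (op c e ∈ s <-> exists x, op i x ∈ e /\ op j x ∈ e)) /\
    (forall b, c = op (num 2) b -> (op c e ∈ s <-> ~ op b e ∈ s)) /\
    (forall b d, c = op (num 3) (op b d) -> (op c e ∈ s <-> (op b e ∈ s /\ op d e ∈ s))) /\
    (forall b, c = op (num 4) b ->
       (op c e ∈ s <-> forall x, x ∈ a -> op b (cons x e) ∈ s)).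
Proof.
  unfold sat_table, code_mem, code_eq, code_neg, code_and, code_all.
  setoid_rewrite tagged2E. setoid_rewrite taggedE. setoid_rewrite relE. setoid_rewrite is_consE.
  assert (E : forall e b, (forall x e', x ∈ a -> e' = cons x e -> op b e' ∈ s) <->
                (forall x, x ∈ a -> op b (cons x e) ∈ s))
    by (intros e b; split; intros H x; [eauto|intros e' Hx ->; auto]).
  setoid_rewrite E. reflexivity.
Qed.

(** Any table gives the right answer on codes of external formulas, whatever codes the
    set [t] contains besides; so [sat_in] does not depend on the table. *)
Lemma sat_table_sound a t s : formula_set t -> sat_table a t s ->
  forall A e, code A ∈ t -> assignment e a -> (op (code A) e ∈ s <-> sat_at a A e).
Proof.
  intros Ht Hs. rewrite sat_tableE in Hs.
  induction A as [i j|i j|A IH|A IHA B IHB|A IH]; intros e Hc He;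
    destruct (Hs _ e Hc He) as (H1 & H2 & H3 & H4 & H5); cbn [sat_at].
  - now apply H1.
  - now apply H2.
  - rewrite (H3 (code A) eq_refl), IH; [reflexivity|exact (formula_set_closed _ _ Ht Hc)|exact He].
  - destruct (formula_set_closed _ _ Ht Hc).
    rewrite (H4 (code A) (code B) eq_refl), IHA, IHB; tauto.
  - rewrite (H5 (code A) eq_refl). assert (L := formula_set_closed _ _ Ht Hc).
    split; intros K x Hx; apply IH; auto using assignment_cons.
Qed.

Lemma sat_table_exists a A : exists s, sat_table a (codes A) s.
Proof.
  destruct (list_set (fun B w => exists e, w = op (code B) e /\ assignment e a /\ sat_at a B e)
              (subformulas A)) as [s Hs].
  { intros B. apply (bounded_set _ (times (sing (code B)) (pow (times omega a)))).
    - repeat first [progress definability|apply dp_sat_at]. unfold assignment, is_omega. definability.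
    - intros w (e & -> & He & _). apply op_in_times. split; [now apply in_sing|].
      apply in_pow. intros z Hz. apply assignmentE, is_funE in He.
      destruct He as (F & _). destruct (F z Hz) as (x & y & Hx & Hy & ->).
      now apply op_in_times. }
  assert (E : forall B e, List.In B (subformulas A) -> assignment e a ->
    (op (code B) e ∈ s <-> sat_at a B e)).
  { intros B e HB He. rewrite Hs. split.
    - intros (C & HC & e' & E & _ & K). apply op_inj in E as [E ->].
      apply code_inj in E. now subst.
    - intros K. exists B. split; [exact HB|]. now exists e. }
  exists s. apply sat_tableE. intros c e Hc He. apply in_codes in Hc.
  destruct Hc as (B & HB & ->). assert (K := subformulas_closed A B HB).
  assert (E0 := E B e HB He).
  destruct B as [i j|i j|B|B C|B]; cbn [code sat_at] in *;
    (split; [|split; [|split; [|split]]]).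
  all: first [intros x y T|intros x T]; apply tag_inj in T; destruct T as [T F];
    try discriminate T; rewrite E0.
  - apply op_inj in F as [<- <-]. reflexivity.
  - apply op_inj in F as [<- <-]. reflexivity.
  - subst x. now rewrite (E B e K He).
  - apply op_inj in F as [<- <-]. destruct K as [K1 K2]. now rewrite (E B e K1 He), (E C e K2 He).
  - subst x. split; intros L y Hy; apply E; auto using assignment_cons.
Qed.

Lemma sat_inE a A e : assignment e a -> (sat_in a (code A) e <-> sat_at a A e).
Proof.
  intros He. unfold sat_in. split.
  - intros (t & s & Ht & Hc & Hs & K). apply relE in K.
    now apply (sat_table_sound a t s Ht Hs A e Hc He).
  - intros K. destruct (sat_table_exists a A) as [s Hs].
    assert (Hc : code A ∈ codes A).
    { apply in_codes. exists A. split; [apply subformulas_self|reflexivity]. }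
    exists (codes A), s. split; [apply codes_formula_set|]. split; [exact Hc|].
    split; [exact Hs|]. apply relE.
    now apply (sat_table_sound a _ s (codes_formula_set A) Hs A e Hc He).
Qed.

Fixpoint sat_rel a (v : nat -> V) A : Prop :=
  match A with
  | fmem i j => v i ∈ v j
  | feq i j => v i = v j
  | fneg B => ~ sat_rel a v B
  | fand B C => sat_rel a v B /\ sat_rel a v C
  | fall B => forall x, x ∈ a -> sat_rel a (scons x v) B
  end.

Lemma sat_at_rel a A : forall e (v : nat -> V), assignment e a ->
  (forall n, op (num n) (v n) ∈ e) ->
  (sat_at a A e <-> sat_rel a v A).
Proof.
  induction A as [i j|i j|A IH|A IHA B IHB|A IH]; intros e v He Hv; cbn [sat_at sat_rel].
  - apply assignmentE in He. split.
    + intros (x & y & Hx & Hy & K).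
      rewrite (fun_unique He (Hv i) Hx), (fun_unique He (Hv j) Hy).
      exact K.
    + intros K. exists (v i), (v j). auto.
  - apply assignmentE in He. split.
    + intros (x & Hx & Hy).
      rewrite (fun_unique He (Hv i) Hx), (fun_unique He (Hv j) Hy).
      reflexivity.
    + intros K. exists (v i). split; [apply Hv|]. rewrite K. apply Hv.
  - now rewrite (IH e v He Hv).
  - now rewrite (IHA e v He Hv), (IHB e v He Hv).
  - assert (K : forall x, x ∈ a -> (sat_at a A (cons x e) <-> sat_rel a (scons x v) A)).
    { intros x Hx. apply IH; [now apply assignment_cons|]. intros [|n]; simpl.
      - now apply op_in_cons_emp.
      - now apply op_in_cons_suc. }
    split; intros L x Hx; apply K; auto.
Qed.

(** The internal assignment with first values [l] and constant value [d] afterwards;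
    it is built by [cons], with which an embedding commutes. *)
Fixpoint assign (d : V) (l : list V) : V :=
  match l with
  | nil => times omega (sing d)
  | (x :: k)%list => cons x (assign d k)
  end.

Lemma assign_assignment a d l : d ∈ a -> List.Forall (fun x => x ∈ a) l ->
  assignment (assign d l) a.
Proof.
  intros Hd Hl. induction Hl as [|x l Hx Hl IH]; simpl.
  - apply assignmentE, is_funE. split; [|split].
    + intros z Hz. apply in_times in Hz. destruct Hz as (i & y & Hi & Hy & ->).
      apply in_sing in Hy. subst. now exists i, d.
    + intros i Hi. exists d. apply op_in_times. split; [exact Hi|now apply in_sing].
    + intros i y y'. rewrite !op_in_times, !in_sing. intuition congruence.
  - now apply assignment_cons.
Qed.

Lemma assign_value d l : forall n, op (num n) (List.nth n l d) ∈ assign d l.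
Proof.
  induction l as [|x l IH]; intros n; simpl.
  - apply op_in_times. split; [apply in_omega, num_nat|]. apply in_sing. now destruct n.
  - destruct n as [|n]; simpl; [now apply op_in_cons_emp|]. now apply op_in_cons_suc.
Qed.

Lemma elementary j N M A d d' l l' : elementary_embedding j N M -> op d d' ∈ j ->
  List.Forall2 (fun x y => op x y ∈ j) l l' ->
  (sat_rel N (fun n => List.nth n l d) A <-> sat_rel M (fun n => List.nth n l' d') A).
Proof.
  intros [Hj He] Hd Hl.
  assert (FN : List.Forall (fun x => x ∈ N) l).
  { induction Hl as [|x y l l' Hxy]; constructor; auto.
    now apply (fun_bounds Hj) in Hxy. }
  assert (FM : List.Forall (fun x => x ∈ M) l').
  { clear FN. induction Hl as [|x y l l' Hxy]; constructor; auto.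
    now apply (fun_bounds Hj) in Hxy. }
  assert (Dd := fun_bounds Hj Hd). destruct Dd as [DN DM].
  assert (EN := assign_assignment N d l DN FN). assert (EM := assign_assignment M d' l' DM FM).
  rewrite <- (sat_at_rel N A (assign d l) _ EN (assign_value d l)).
  rewrite <- (sat_at_rel M A (assign d' l') _ EM (assign_value d' l')).
  rewrite <- !sat_inE by assumption.
  apply He; auto using code_is_code.
  clear FN FM EN EM. induction Hl as [|x0 y0 l l' Hxy Hl IH]; intros i x y Hx Hy;
    apply relE in Hx, Hy; apply relE; simpl in Hx |- *.
  - apply op_in_times in Hx. rewrite in_sing in Hx. destruct Hx as [Hi ->].
    apply op_in_times. split; [exact Hi|]. apply in_sing.
    exact (fun_unique Hj Hy Hd).
  - apply in_cons in Hx. destruct Hx as [Hx|(k & z & Hk & Hx)]; apply op_inj in Hx;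
      destruct Hx as [-> ->].
    + apply op_in_cons_emp. exact (fun_unique Hj Hy Hxy).
    + apply op_in_cons_suc. apply relE. apply (IH k z y); now apply relE.
Qed.

End Elementarity.

(** * Rank stages *)

Section RankStage.
Context {V : structure} {HV : @ZF V}.
Implicit Types a b c d f g h p q r s t u v w x y z : V.

Lemma is_rank_stageE eta N : is_rank_stage eta N <-> is_ord eta /\
  exists f, fun_on f (suc eta) /\
    (forall a u, op a u ∈ f -> forall x, x ∈ u <-> exists b, b ∈ a /\ exists w, op b w ∈ f /\ subset x w) /\
    op eta N ∈ f.
Proof.
  unfold is_rank_stage. setoid_rewrite is_succE. setoid_rewrite relE.
  split; intros (O & H); (split; [exact O|]).
  - destruct H as (f & d & -> & H). now exists f.
  - destruct H as (f & H). now exists f, (suc eta).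
Qed.

Context eta N f (Oeta : is_ord eta) (Hf : fun_on f (suc eta))
  (Hstage : forall a u, op a u ∈ f ->
     forall x, x ∈ u <-> exists b, b ∈ a /\ exists w, op b w ∈ f /\ subset x w)
  (HN : op eta N ∈ f).

Lemma stage_ord a u : op a u ∈ f -> is_ord a.
Proof.
  intros H. destruct Hf as [c Hc]. apply (fun_bounds Hc) in H.
  apply (ord_elem (suc eta)); [now apply ord_suc|tauto].
Qed.

Lemma stage_total a u b : op a u ∈ f -> b ∈ a -> exists w, op b w ∈ f.
Proof.
  intros H Hb. destruct Hf as [c Hc]. apply (fun_bounds Hc) in H.
  apply (fun_total b Hc). apply (ord_trans _ a); [now apply ord_suc|tauto|exact Hb].
Qed.

Lemma stage_mono a u b w : op a u ∈ f -> op b w ∈ f -> b ∈ a -> subset w u.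
Proof.
  intros Ha Hb Hba x Hx. apply (Hstage _ _ Hb) in Hx. destruct Hx as (c & Hc & K).
  apply (Hstage _ _ Ha). exists c. split; [|exact K].
  apply (ord_trans a b); try assumption. exact (stage_ord _ _ Ha).
Qed.

Lemma stage_transitive a u : op a u ∈ f -> transitive u.
Proof.
  intros Ha x Hx y Hy. assert (K := Hx). apply (Hstage _ _ Ha) in K.
  destruct K as (b & Hb & w & Hw & K). apply (stage_mono a u b w); auto.
Qed.

Lemma ord_subset_stage a : forall u, op a u ∈ f -> subset a u.
Proof.
  pattern a. apply eps_induction; [definability|]. clear a. intros a IH u Ha x Hx.
  destruct (stage_total a u x Ha Hx) as [w Hw].
  apply (Hstage _ _ Ha). exists x. split; [exact Hx|]. exists w. split; [exact Hw|]. auto.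
Qed.

(** An ordinal in [V_a] is a subset of [V_b] for some [b < a], hence by induction a
    subset of [b]. *)
Lemma ord_in_stage a : forall u b, op a u ∈ f -> is_ord b -> b ∈ u -> b ∈ a.
Proof.
  pattern a. apply eps_induction; [definability|]. clear a. intros a IH u b Ha Ob Hb.
  assert (Oa := stage_ord _ _ Ha).
  apply (Hstage _ _ Ha) in Hb. destruct Hb as (c & Hc & w & Hw & K).
  assert (S : subset b c).
  { intros x Hx. apply (IH c Hc w x Hw); [now apply (ord_elem b)|auto]. }
  destruct (ord_trichotomy b c Ob (ord_elem _ _ Oa Hc)) as [L|[->|L]]; [|exact Hc|].
  - now apply (ord_trans a c).
  - apply S in L. now apply mem_irrefl in L.
Qed.

(** Unordered pairs of an element of a member of [U] and an ordinal below [rho] appear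
    before stage [eta]. Ordered pairs might not, when [eta] is the successor of the
    rank of [U]. *)
Lemma pairs_in_stage U Y rho F : regular rho -> rho ∈ N -> U ∈ N -> Y ∈ U ->
  (forall w, w ∈ F -> exists x b, x ∈ Y /\ b ∈ rho /\ w = pair x b) -> F ∈ N.
Proof.
  intros Hrho HrN HUN HY HF. assert (Or := regular_ord _ Hrho).
  assert (Hre := ord_in_stage _ _ _ HN Or HrN).
  assert (K := HUN). apply (Hstage _ _ HN) in K. destruct K as (xi & Hxi & w & Hw & K).
  apply K in HY. apply (Hstage _ _ Hw) in HY. destruct HY as (xi' & Hxi' & w' & Hw' & HY).
  assert (Oxi' := stage_ord _ _ Hw').
  assert (D : forall zeta wz, zeta ∈ eta -> op zeta wz ∈ f -> subset F wz -> F ∈ N).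
  { intros zeta wz Hz Hwz S. apply (Hstage _ _ HN). exists zeta. split; [exact Hz|]. now exists wz. }
  assert (P : forall a u b v x y, op a u ∈ f -> op b v ∈ f -> a ∈ b -> x ∈ u -> y ∈ u -> pair x y ∈ v).
  { intros a u b v x y Ha Hb Hab Hx Hy. apply (Hstage _ _ Hb). exists a. split; [exact Hab|].
    exists u. split; [exact Ha|]. intros z Hz. apply in_pair in Hz. destruct Hz; subst; assumption. }
  destruct (classic (xi' ∈ rho)) as [L|L].
  - destruct (stage_total _ _ _ HN Hre) as [wr Hwr].
    apply (D rho wr Hre Hwr). intros z Hz. apply HF in Hz. destruct Hz as (x & b & Hx & Hb & ->).
    assert (Hsb := regular_limit _ _ Hrho Hb).
    destruct (stage_total _ _ _ Hwr Hsb) as [wb Hwb].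
    assert (Hbw : b ∈ wb) by (apply (ord_subset_stage _ _ Hwb), in_suc; tauto).
    destruct (ord_trichotomy xi' (suc b) Oxi' (stage_ord _ _ Hwb)) as [M|[M|M]].
    + apply (P (suc b) wb rho wr); try assumption. apply (stage_mono (suc b) wb xi' w'); auto.
    + subst xi'. apply (P (suc b) w' rho wr); auto. apply (ord_subset_stage _ _ Hw'), in_suc. tauto.
    + apply (P xi' w' rho wr); auto. now apply (stage_mono xi' w' (suc b) wb).
  - apply (D xi w Hxi Hw). intros z Hz. apply HF in Hz. destruct Hz as (x & b & Hx & Hb & ->).
    apply (P xi' w' xi w); auto. apply (ord_subset_stage _ _ Hw').
    now apply (ord_subset rho xi').
Qed.

End RankStage.

(** * Indecomposability *)

Section Relativization.
Context {V : structure} {HV : @ZF V}.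
Implicit Types (a : V) (v : nat -> V) (A B : formula).

Lemma sat_rel_imp a v A B : sat_rel a v (fimp A B) <-> (sat_rel a v A -> sat_rel a v B).
Proof. unfold fimp. simpl. split; [intros H K; apply NNPP; tauto|tauto]. Qed.

Lemma sat_rel_or a v A B : sat_rel a v (for_ A B) <-> (sat_rel a v A \/ sat_rel a v B).
Proof. unfold for_. simpl. destruct (classic (sat_rel a v A)); tauto. Qed.

Lemma sat_rel_iff a v A B : sat_rel a v (fiff A B) <-> (sat_rel a v A <-> sat_rel a v B).
Proof. unfold fiff. cbn [sat_rel]. rewrite !sat_rel_imp. tauto. Qed.

Lemma sat_rel_ex a v A : sat_rel a v (fex A) <-> exists x, x ∈ a /\ sat_rel a (scons x v) A.
Proof.
  unfold fex. simpl. split.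
  - intros H. apply NNPP. intros N. apply H. intros x Hx K. apply N. now exists x.
  - intros (x & Hx & K) H. now apply (H x).
Qed.

Lemma sat_rel_pair a v z x y : transitive a -> v z ∈ a -> v x ∈ a -> v y ∈ a ->
  (sat_rel a v (F_upair z x y) <-> v z = pair (v x) (v y)).
Proof.
  intros Ta Hz Hx Hy. unfold F_upair. cbn [sat_rel].
  assert (E : forall w, w ∈ a -> (sat_rel a (scons w v)
    (fiff (fmem 0 (S z)) (for_ (feq 0 (S x)) (feq 0 (S y)))) <->
    (w ∈ v z <-> w = v x \/ w = v y))).
  { intros w Hw. rewrite sat_rel_iff, sat_rel_or. reflexivity. }
  split.
  - intros H. apply ext. intros w. rewrite in_pair. split.
    + intros Hw. assert (Wa : w ∈ a) by now apply (Ta (v z)).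
      apply (proj1 (E w Wa) (H w Wa)), Hw.
    + intros Hw. assert (Wa : w ∈ a) by (destruct Hw; subst; assumption).
      apply (proj1 (E w Wa) (H w Wa)), Hw.
  - intros H w Hw. apply (E w Hw). rewrite H. apply in_pair.
Qed.

End Relativization.

Ltac embed_list :=
  repeat (apply List.Forall2_cons; [assumption|]); apply List.Forall2_nil.

Section Indecomposable.
Context {V : structure} {HV : @ZF V}.
Implicit Types a b c d f g h p q r s t u w x y z : V.

Section Embedding.
Context (X U rho N M j : V) (TN : transitive N) (TM : transitive M)
  (Hj : elementary_embedding j N M) (HU : ultrafilter U X) (HUN : U ∈ N) (HrN : rho ∈ N)
  (Hrho : regular rho).

(** [K] expresses [Q] in every transitive set; its arguments are the indices of a parameter,
    of an element of [X], and of an ordinal. *)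
Context (K : nat -> nat -> nat -> formula) (Q : V -> V -> V -> Prop) (F Y : V)
  (HK : forall a (v : nat -> V) i k l, transitive a -> v i ∈ a -> v k ∈ a -> v l ∈ a ->
     (sat_rel a v (K i k l) <-> Q (v i) (v k) (v l)))
  (HFN : F ∈ N) (HYU : Y ∈ U)
  (Htotal : forall x, x ∈ Y -> exists b, b ∈ rho /\ Q F x b)
  (Hlarge : forall b, b ∈ rho -> exists w, w ∈ U /\ forall x c, x ∈ w -> c ∈ b -> ~ Q F x c).

Lemma embed_total x : x ∈ N -> exists y, op x y ∈ j.
Proof. apply (fun_total x (proj1 Hj)). Qed.

Lemma embed_bounds x y : op x y ∈ j -> x ∈ N /\ y ∈ M.
Proof. apply fun_bounds. apply Hj. Qed.

Lemma embed_mem x x' y y' : op x x' ∈ j -> op y y' ∈ j -> (x ∈ y <-> x' ∈ y').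
Proof.
  intros Hx Hy. exact (elementary j N M (fmem 0 1) x x' (x :: y :: nil) (x' :: y' :: nil) Hj Hx
    ltac:(embed_list)).
Qed.

Lemma U_mem_N a : a ∈ U -> a ∈ N.
Proof. intros H. now apply (TN U). Qed.

(** With [x0] in [j(A)] for all [A] in [U], some [c < j(rho)] has [Q] at [x0] in [M].
    By continuity [c < j(b)] for some [b < rho], but [x0] belongs to [j] of the set
    given by [Hlarge] for [b]. *)
Lemma no_continuous_case : continuous_at j rho -> type_I_discontinuous_at j U -> False.
Proof.
  intros (rho' & s & y & Hs & Hr & (Oy & Hup & Hleast) & ->) (x0 & Hx0).
  apply relE in Hr.
  assert (Hx0' : forall a a', a ∈ U -> op a a' ∈ j -> x0 ∈ a')
    by (intros a a' Ha Haa; apply (Hx0 a); [exact Ha|now apply relE]). clear Hx0.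
  destruct (embed_total Y (U_mem_N _ HYU)) as [Y' HY'].
  destruct (embed_total F HFN) as [F' HF'].
  destruct (embed_bounds _ _ HF') as [_ FM]. destruct (embed_bounds _ _ HY') as [_ YM].
  destruct (embed_bounds _ _ Hr) as [_ RM].
  assert (E := elementary j N M
    (fall (fimp (fmem 0 1) (fex (fand (fmem 0 3) (K 4 1 0)))))
    F F' (Y :: rho :: F :: nil) (Y' :: rho' :: F' :: nil) Hj HF'
    ltac:(embed_list)).
  assert (x0M : x0 ∈ M) by (apply (TM Y'); auto; now apply (Hx0' Y)).
  destruct E as [E _]. cbn [sat_rel] in E.
  assert (L : exists b, b ∈ rho' /\ Q F' x0 b).
  { assert (E' : sat_rel M (scons x0 (fun n => List.nth n (Y' :: rho' :: F' :: nil) F'))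
      (fimp (fmem 0 1) (fex (fand (fmem 0 3) (K 4 1 0))))).
    { apply E; [|exact x0M]. intros x Hx. apply sat_rel_imp. intros HxY.
      apply sat_rel_ex. destruct (Htotal x HxY) as (b & Hb & HQ). exists b.
      assert (bN : b ∈ N) by now apply (TN rho).
      split; [exact bN|]. split; [exact Hb|]. apply HK; assumption. }
    assert (E'' := proj1 (sat_rel_imp _ _ _ _) E' (Hx0' Y Y' HYU HY')). clear E'. rename E'' into E'.
    apply sat_rel_ex in E'. destruct E' as (b & HbM & Hb & HQ). exists b.
    split; [exact Hb|]. apply HK in HQ; assumption. }
  destruct L as (c & Hc & HQ).
  assert (L : exists b b', b ∈ rho /\ op b b' ∈ j /\ c ∈ b').
  { apply NNPP. intros Nc. assert (Oc := ord_elem _ _ Oy Hc).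
    apply (mem_irrefl c). apply (Hleast c Oc); [|exact Hc].
    intros b' Hb'. apply Hs in Hb'. destruct Hb' as (b & Hb & Hbb). apply relE in Hbb.
    assert (Hb' : b' ∈ rho') by now apply (embed_mem b b' rho rho').
    apply ord_subset; [now apply (ord_elem rho')|exact Oc|].
    intros Hcb. apply Nc. now exists b, b'. }
  destruct L as (b & b' & Hb & Hbb & Hcb).
  destruct (Hlarge b Hb) as (w & Hw & Hwb).
  destruct (embed_total w (U_mem_N _ Hw)) as [w' Hw'].
  assert (E2 := elementary j N M
    (fall (fimp (fmem 0 1) (fall (fimp (fmem 0 3) (fneg (K 4 1 0))))))
    F F' (w :: b :: F :: nil) (w' :: b' :: F' :: nil) Hj HF'
    ltac:(embed_list)).
  destruct E2 as [E2 _]. cbn [sat_rel] in E2.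
  assert (cM : c ∈ M) by now apply (TM rho').
  refine (_ (proj1 (sat_rel_imp _ _ _ _) (E2 _ x0 x0M) _)).
  - cbn [sat_rel]. intros G. assert (G' := proj1 (sat_rel_imp _ _ _ _) (G c cM)).
    cbn in G'. apply G'; [exact Hcb|]. apply HK; assumption.
  - intros x Hx. apply sat_rel_imp. intros Hxw d Hd. apply sat_rel_imp.
    intros Hdb HQd. apply HK in HQd; try assumption. exact (Hwb x d Hxw Hdb HQd).
  - cbn. now apply (Hx0' w).
Qed.

(** The supremum [y] of the pointwise image of [rho] is below [j(rho)], so [Hlarge] at
    [y] holds in [M] and gives a member of [j(U)]. It meets the pointwise image of [X]
    in some [j(x1)], and [Q] holds there at [j(b)] with [b < rho]; but [j(b) < y]. *)
Lemma no_discontinuous_case : discontinuous_at j rho -> type_II_continuous_at j U -> False.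
Proof.
  intros (rho' & s & y & Hs & Hr & (Oy & Hup & _) & Hy) (u & s1 & U' & Hu & Hs1 & HUU & Hs1U).
  apply relE in Hr, HUU.
  destruct (embed_total Y (U_mem_N _ HYU)) as [Y' HY'].
  destruct (embed_total F HFN) as [F' HF'].
  destruct (embed_bounds _ _ HF') as [_ FM]. destruct (embed_bounds _ _ HY') as [_ YM].
  destruct (embed_bounds _ _ Hr) as [_ RM]. destruct (embed_bounds _ _ HUU) as [_ UM].
  assert (yM : y ∈ M) by now apply (TM rho').
  assert (E := elementary j N M
    (fall (fimp (fmem 0 1) (fex (fand (fmem 0 3)
      (fall (fimp (fmem 0 1) (fall (fimp (fmem 0 3) (fneg (K 6 1 0))))))))))
    F F' (rho :: U :: F :: nil) (rho' :: U' :: F' :: nil) Hj HF'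
    ltac:(embed_list)).
  destruct E as [E _]. cbn [sat_rel] in E.
  assert (L : exists w, w ∈ U' /\ forall x c, x ∈ w -> c ∈ y -> ~ Q F' x c).
  { refine (_ (proj1 (sat_rel_imp _ _ _ _) (E _ y yM) _)).
    - intros G. apply sat_rel_ex in G. destruct G as (w & wM & Hw & G). exists w.
      split; [exact Hw|]. intros x c Hx Hc HQ.
      assert (xM : x ∈ M) by now apply (TM w). assert (cM : c ∈ M) by now apply (TM y).
      cbn [sat_rel] in G. assert (G1 := proj1 (sat_rel_imp _ _ _ _) (G x xM) Hx).
      cbn [sat_rel] in G1. apply (proj1 (sat_rel_imp _ _ _ _) (G1 c cM) Hc).
      apply HK; assumption.
    - intros b Hb. apply sat_rel_imp. intros Hbr. apply sat_rel_ex.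
      destruct (Hlarge b Hbr) as (w & Hw & Hwb). exists w. split; [now apply U_mem_N|].
      split; [exact Hw|]. intros x Hx. apply sat_rel_imp. intros Hxw d Hd.
      apply sat_rel_imp. intros Hdb HQd. apply HK in HQd; try assumption.
      exact (Hwb x d Hxw Hdb HQd).
    - exact Hy. }
  destruct L as (w & Hw & Hwy).
  assert (E2 := elementary j N M
    (fall (fimp (fmem 0 1) (fall (fimp (fmem 0 2) (fex (fand (fmem 0 4) (fand (fmem 0 2) (fmem 0 1))))))))
    F F' (U :: Y :: nil) (U' :: Y' :: nil) Hj HF'
    ltac:(embed_list)).
  destruct E2 as [E2 _]. cbn [sat_rel] in E2.
  assert (L : exists x, x ∈ Y' /\ x ∈ w /\ x ∈ s1).
  { refine (_ (proj1 (sat_rel_imp _ _ _ _) (E2 _ w (TM U' UM w Hw)) Hw)).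
    - cbn [sat_rel]. intros G.
      assert (G1 := proj1 (sat_rel_imp _ _ _ _) (G s1 (TM U' UM s1 Hs1U)) Hs1U).
      apply sat_rel_ex in G1. destruct G1 as (x & _ & Gx). cbn in Gx. exists x. tauto.
    - intros a Ha. apply sat_rel_imp. intros HaU b Hb. apply sat_rel_imp. intros HbU.
      apply sat_rel_ex.
      destruct (U_inhabited X U HU (cap Y (cap a b))) as (x & Hx).
      { apply (U_cap X U HU); [exact HYU|]. now apply (U_cap X U HU). }
      rewrite !in_cap in Hx. exists x. split; [|exact Hx].
      apply (TN Y); [now apply U_mem_N|tauto]. }
  destruct L as (x & HxY & Hxw & Hxs). apply Hs1 in Hxs. destruct Hxs as (x1 & _ & Hx1).
  apply relE in Hx1. apply (embed_mem x1 x Y Y' Hx1 HY') in HxY.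
  destruct (Htotal x1 HxY) as (b & Hb & HQ).
  assert (bN : b ∈ N) by now apply (TN rho).
  destruct (embed_total b bN) as [b' Hb'].
  destruct (embed_bounds _ _ Hb') as [_ bM]. destruct (embed_bounds _ _ Hx1) as [xN xM].
  apply (Hwy x b' Hxw).
  - assert (Hsb := regular_limit _ _ Hrho Hb).
    destruct (embed_total (suc b)) as [c Hc]; [now apply (TN rho)|].
    apply (Hup c); [apply Hs; exists (suc b); split; [exact Hsb|now apply relE]|].
    apply (embed_mem b b' (suc b) c Hb' Hc). apply in_suc. tauto.
  - assert (E3 := elementary j N M (K 2 0 1) F F' (x1 :: b :: F :: nil) (x :: b' :: F' :: nil) Hj HF'
      ltac:(embed_list)).
    rewrite !HK in E3 by assumption. now apply E3.
Qed.

End Embedding.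

Theorem embedding_indecomposable (X U rho eta N M j : V) :
  ultrafilter U X -> regular rho -> is_rank_stage eta N -> rho ∈ N -> U ∈ N ->
  transitive M -> elementary_embedding j N M ->
  (continuous_at j rho /\ type_I_discontinuous_at j U) \/
  (discontinuous_at j rho /\ type_II_continuous_at j U) ->
  ~ decomposable U rho.
Proof.
  intros HU Hrho HN HrN HUN TM Hj Hcases (f & Hf & _ & (u & Uu & Hu) & Hsmall).
  apply is_rank_stageE in HN. destruct HN as (Oeta & st & Hst & Hstage & HN).
  assert (TN := stage_transitive eta st Oeta Hst Hstage _ _ HN).
  assert (Or := regular_ord _ Hrho).
  (* [first x a] is the map to the first index; its relation to [rho] must be expressed
     inside [N] by a formula with one parameter, chosen in two ways below. *)
  set (hit := fun x a => exists z, op a z ∈ f /\ x ∈ z).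
  assert (dphit : definable (fun e => hit (e 0) (e 1))) by (unfold hit; definability).
  assert (hit_u : forall x a, a ∈ rho -> hit x a -> x ∈ u).
  { intros x a Ha (z & Hz & Hx). apply Hu. exists a, z. split; [exact Ha|].
    split; [now apply relE|exact Hx]. }
  set (first := fun x a => a ∈ rho /\ hit x a /\ forall b, b ∈ a -> ~ hit x b).
  assert (dpfirst : definable (fun e => first (e 0) (e 1))) by (unfold first; definability).
  assert (first_ex : forall x, x ∈ u -> exists a, first x a).
  { intros x Hx. apply Hu in Hx. destruct Hx as (a & z & Ha & Hz & Hx). apply relE in Hz.
    destruct (ord_least (fun a => a ∈ rho /\ hit x a) a) as (m & Om & [Hm Km] & _ & Lm).
    - definability.
    - now apply (ord_elem rho).
    - split; [exact Ha|now exists z].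
    - exists m. split; [exact Hm|]. split; [exact Km|]. intros b Hb Hh. apply (Lm b Hb).
      split; [now apply (ord_trans rho m)|exact Hh]. }
  assert (first_unique : forall x a b, first x a -> first x b -> a = b).
  { intros x a b (Ha & Ka & La) (Hb & Kb & Lb).
    destruct (ord_trichotomy a b) as [H|[H|H]]; [now apply (ord_elem rho)..| |exact H|].
    - now apply Lb in H.
    - now apply La in H. }
  assert (tails : forall b, b ∈ rho -> exists w, w ∈ U /\ forall x, x ∈ w ->
    x ∈ u /\ forall a, a ∈ b -> ~ hit x a).
  { intros b Hb.
    destruct (U_split X U HU (fun x => exists a, a ∈ b /\ hit x a)) as (w & L & [Hw|Hw]); [definability| |].
    - exfalso. apply (Hsmall b Hb w); [|exact L]. intros x. rewrite Hw. split.
      + intros (_ & a & Ha & z & Hz & Hx). exists a, z. rewrite relE. tauto.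
      + intros (a & z & Ha & Hz & Hx). apply relE in Hz.
        assert (Hh : hit x a) by now exists z. split; [|now exists a].
        apply (U_subset X U HU u); [exact Uu|]. apply (hit_u x a); [|exact Hh].
        now apply (ord_trans rho b).
    - exists (cap u w). split; [now apply (U_cap X U HU)|]. intros x Hx.
      apply in_cap in Hx. destruct Hx as [Hx Hx']. split; [exact Hx|]. intros a Ha Hh.
      apply Hw in Hx'. apply (proj2 Hx'). now exists a. }
  assert (Main : forall K Q F Y,
    (forall a (v : nat -> V) i k l, transitive a -> v i ∈ a -> v k ∈ a -> v l ∈ a ->
       (sat_rel a v (K i k l) <-> Q (v i) (v k) (v l))) ->
    F ∈ N -> Y ∈ U ->
    (forall x, x ∈ Y -> exists b, b ∈ rho /\ Q F x b) ->
    (forall b, b ∈ rho -> exists w, w ∈ U /\ forall x c, x ∈ w -> c ∈ b -> ~ Q F x c) -> False).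
  { intros K Q F Y HK HF HY HT HL. destruct Hcases as [[H1 H2]|[H1 H2]].
    - apply (no_continuous_case U rho N M j) with (K := K) (Q := Q) (F := F) (Y := Y); assumption.
    - apply (no_discontinuous_case X U rho N M j) with (K := K) (Q := Q) (F := F) (Y := Y); assumption. }
  destruct (U_split X U HU (fun x => x ∈ rho)) as (d & L & [Hd|Hd]); [definability| |].
  (* [U] concentrates on [rho], and the identity can replace the map to the first
     index: were some [b < rho] in [U], that map would be bounded on [b]. *)
  - apply (Main (fun _ k l => feq k l) (fun _ x a => x = a) U (cap u d)); auto.
    + intros. reflexivity.
    + now apply (U_cap X U HU).
    + intros x Hx. apply in_cap in Hx. destruct Hx as [_ Hx]. apply Hd in Hx. exists x. tauto.
    + intros b Hb.
      destruct (U_split X U HU (fun x => x ∈ b)) as (w & L' & [Hw|Hw]); [definability| |].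
      * exfalso.
        destruct (fun_of_rel (fun x a => (x ∈ u /\ first x a) \/ (~ x ∈ u /\ a = emp)) b rho)
          as (g & Hg & Eg).
        -- definability.
        -- intros x _. destruct (classic (x ∈ u)) as [Hx|Hx].
           ++ destruct (first_ex x Hx) as [a Ha]. exists a. split; [apply Ha|tauto].
           ++ exists emp. split; [apply Hrho, nat_emp|tauto].
        -- intros x a a' _ [[H1 H2]|[H1 H2]] [[H1' H2']|[H1' H2']]; try tauto; [|congruence].
           now apply (first_unique x).
        -- destruct (regular_unbounded rho g b rho Hrho Hb Hg) as (e & He & Bound).
           destruct (tails e He) as (v & Hv & Kv).
           destruct (U_inhabited X U HU (cap w v)) as (x & Hx); [now apply (U_cap X U HU)|].
           apply in_cap in Hx. destruct Hx as [Hx Hx']. apply Hw in Hx. apply Kv in Hx'.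
           destruct Hx' as [Hxu Hx']. destruct (first_ex x Hxu) as [a Ha].
           apply (Hx' a); [|apply Ha]. apply (Bound x). apply Eg. tauto.
      * exists w. split; [exact L'|]. intros x a Hx Ha ->. apply Hw in Hx. tauto.
  - destruct (repl_set (fun x w => exists a, first x a /\ w = pair x a) (cap u d)) as [F HF].
    { definability. }
    { intros x w w' _ (a & Ha & ->) (a' & Ha' & ->). now rewrite (first_unique x a a'). }
    (* No element of [cap u d] is in [rho], so the unordered pairs determine the map. *)
    apply (Main (fun i k l => fex (fand (fmem 0 (S i)) (F_upair 0 (S k) (S l))))
      (fun F x a => pair x a ∈ F) F (cap u d)).
    + intros a v i k l Ta Hi Hk Hl. rewrite sat_rel_ex. split.
      * intros (z & Hz & Hzi & Hp). cbn in Hzi.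
        apply sat_rel_pair in Hp; try assumption. cbn in Hp. now subst z.
      * intros H. exists (pair (v k) (v l)).
        assert (Hp : pair (v k) (v l) ∈ a) by now apply (Ta (v i)).
        split; [exact Hp|]. split; [exact H|]. apply sat_rel_pair; try assumption. reflexivity.
    + apply (pairs_in_stage eta N st Oeta Hst Hstage HN U (cap u d) rho F Hrho HrN HUN).
      * now apply (U_cap X U HU).
      * intros w Hw. apply HF in Hw. destruct Hw as (x & Hx & a & Ha & ->). exists x, a.
        split; [exact Hx|]. split; [apply Ha|reflexivity].
    + now apply (U_cap X U HU).
    + intros x Hx. assert (Hx' := Hx). apply in_cap in Hx'. destruct (first_ex x) as [a Ha]; [tauto|].
      exists a. split; [apply Ha|]. apply HF. exists x. split; [exact Hx|]. now exists a.
    + intros b Hb. destruct (tails b Hb) as (w & Hw & Kw). exists (cap d w).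
      split; [now apply (U_cap X U HU)|]. intros x a Hx Ha Hp.
      apply in_cap in Hx. destruct Hx as [Hxd Hxw]. apply Kw in Hxw. destruct Hxw as [_ Hxw].
      apply Hd in Hxd. apply HF in Hp. destruct Hp as (x' & Hx' & a' & Ha' & E).
      apply in_cap in Hx'. destruct Hx' as [_ Hx']. apply Hd in Hx'.
      assert (Har : a ∈ rho) by now apply (ord_trans rho b).
      assert (a = a') as <-.
      { assert (K : a ∈ pair x' a') by (rewrite <- E; apply in_pair; tauto).
        apply in_pair in K. destruct K as [->|K]; [tauto|exact K]. }
      assert (x = x') as <-.
      { assert (K : x ∈ pair x' a) by (rewrite <- E; apply in_pair; tauto).
        apply in_pair in K. destruct K as [K| ->]; [exact K|tauto]. }
      apply (Hxw a Ha). apply Ha'.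
Qed.

End Indecomposable.

Theorem corollary40 (V : structure) (HV : @ZF V)
  (X U rho eta Veta M j : V)
  (HU : ultrafilter U X)
  (HUsigma : sigma_complete U X)
  (HUempty : forall x : V, ~ (forall A : V, A ∈ U -> x ∈ A))
  (Hrho : regular rho)
  (HVeta : is_rank_stage eta Veta)
  (HrhoV : rho ∈ Veta)
  (HUV : U ∈ Veta)
  (HM : transitive M)
  (Hj : elementary_embedding j Veta M)
  (Hcases :
     (continuous_at j rho /\ type_I_discontinuous_at j U) \/
     (discontinuous_at j rho /\ type_II_continuous_at j U)) :
  ~ decomposable U rho /\
  (forall tau : V, is_ord tau ->
     (forall kappa : V, is_cp U X kappa -> tau ∈ kappa) ->
     ~ tree_prikry_adds_cofinal X U tau rho).
Proof.
  assert (H := embedding_indecomposable X U rho eta Veta M j HU Hrho HVeta HrhoV HUV HM Hj Hcases).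
  split; [exact H|]. intros tau Ht Hcp.
  apply no_new_cofinal_map; try assumption. now apply closed_below_cp.
Qed.
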